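(* Fix an equation $\boldsymbol\omega=(\{P_j^{-1}\}_{j=0}^N,\{Q_i\}_{i=1}^N,\{W_i\}_{i=1}^N)\in\Omega_N^{\mathbb C}$ such that $P_0^{-1}$ is positive definite, and write $\lambda_n(\mathbf A)=\lambda_n(\boldsymbol\omega,\mathbf A)$ for $\mathbf A\in\mathcal B^{\mathbb C}$. (1) Let $0\le k\le 2d$. Then the restriction of $\lambda_n$ to $\mathcal B_k$ is continuous for every $1\le n\le Nd-k$. (2) Let $K\subset\{1,\dots,2d\}$, $r=\sharp(K\cap\{d+1,\dots,2d\})$, and consider the restriction of $\lambda_n$ to $\mathcal O_K^{\mathbb C}$. Let $(r^0,r^+,r^-)$ and $(r^0_1,r^+_1,r^-_1)$ be triples of nonnegative integers, each with sum $d+r$, such that $0\le r^0<r^0_1\le d+r$ and $r^\pm\ge r_1^\pm$. Then for any $\mathbf A\in\mathcal B_K^{(r_1^0,r_1^+,r_1^-)}$, $$\lim_{\mathcal B_K^{(r^0,r^+,r^-)}\ni\mathbf B\to\mathbf A}\lambda_n(\mathbf B)=-\infty,\quad 1\le n\le r^+-r_1^+,$$ $$\lim_{\mathcal B_K^{(r^0,r^+,r^-)}\ni\mathbf B\to\mathbf A}\lambda_n(\mathbf B)=\lambda_{n-(r^+-r_1^+)}(\mathbf A),\quad r^+-r_1^+<n\le Nd-r^0-(r^--r_1^-),$$ $$\lim_{\mathcal B_K^{(r^0,r^+,r^-)}\ni\mathbf B\to\mathbf A}\lambda_n(\mathbf B)=+\infty,\quad Nd-r^0-(r^--r_1^-)<n\le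 Nd-r^0.$$ Consequently, the singular set in $\mathcal B^{\mathbb C}$ is $\bigcup_{1\le k\le 2d}\mathcal B_k$.
   Context: Let $d\ge1$, $N\ge2$. $\Omega_N^{\mathbb C}$ is the set of $\boldsymbol\omega=(\{P_j^{-1}\}_{j=0}^N,\{Q_i\}_{i=1}^N,\{W_i\}_{i=1}^N)$ with all $P_j,Q_i,W_i$ complex $d\times d$ Hermitian matrices, $P_j$ invertible and $W_i$ positive definite. It is topologized as a subset of $\mathbb C^{(3N+1)d^2}$. $\mathcal B^{\mathbb C}$ is the space of self-adjoint boundary conditions: the quotient, with the quotient topology, of $\{(A,B)\in\mathcal M_{2d,4d}(\mathbb C):\operatorname{rank}(A,B)=2d,\ AB^*=BA^*\}$ ($A,B$ being $2d\times2d$) by left multiplication by $\mathrm{GL}(2d,\mathbb C)$. The class of $(A,B)$ is written $[A\,|\,B]$. The discrete Sturm-Liouville problem $(\boldsymbol\omega,\mathbf A)$, $\mathbf A=[A\,|\,B]$, is $$-\nabla(P_i\Delta y_i)+Q_iy_i=\lambda W_iy_i,\ 1\le i\le N,\qquad A\begin{pmatrix}-y_0\\ y_N\end{pmatrix}+B\begin{pmatrix}P_0\Delta y_0\\ P_N\Delta y_N\end{pmatrix}=0,$$ where $y=\{y_i\}_{i=0}^{N+1}$, $y_i\in\mathbb C^d$, $\Delta y_i=y_{i+1}-y_i$, $\nabla x_i=x_i-x_{i-1}$ (so $\nabla(P_i\Delta y_i)=P_i\Delta y_i-P_{i-1}\Delta y_{i-1}$). $\lambda$ is an eigenvalue if there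 is a nontrivial solution $y$ (an eigenfunction). The multiplicity is the number of linearly independent eigenfunctions. The spectrum $\sigma(\boldsymbol\omega,\mathbf A)$ is real and finite, $\sharp_1(\sigma(\boldsymbol\omega,\mathbf A))$ is the number of eigenvalues counted with multiplicity (always $\le Nd$), and they are listed as $\lambda_1(\boldsymbol\omega,\mathbf A)\le\lambda_2(\boldsymbol\omega,\mathbf A)\le\cdots\le\lambda_{\sharp_1(\sigma(\boldsymbol\omega,\mathbf A))}(\boldsymbol\omega,\mathbf A)$. For $K\subset\{1,\dots,2d\}$ put $K_1=K\cap\{1,\dots,d\}$, $K_2=K\cap\{d+1,\dots,2d\}$, $r=\sharp(K_2)$. $E_1$ is the diagonal $d\times d$ matrix whose $i$-th diagonal entry is $0$ if $i\in K_1$ and $1$ otherwise. $E_2$ is the diagonal $d\times d$ matrix whose $i$-th diagonal entry is $0$ if $d+i\in K_2$ and $1$ otherwise. Let $$E_K=\begin{pmatrix}E_1&0&I_d-E_1&0\\ 0&E_2&0&I_d-E_2\\ E_1-I_d&0&E_1&0\\ 0&E_2-I_d&0&E_2\end{pmatrix},$$ and $\mathcal O_K^{\mathbb C}=\{[(S\,|\,I_{2d})E_K]:S\in\mathcal H_{2d}(\mathbb C)\}$, where $\mathcal H_m(\mathbb C)$ denotes the Hermitian $m\times m$ matrices. For $\mathbf A=[(S\,|\,I_{2d})E_K]$ write $S=S(\mathbf A)=\begin{pmatrix}S_1&S_2\\ S_2^*&S_3\end{pmatrix}$ with $d\times d$ blocks. The $\mathcal O_K^{\mathbb C}$ are local coordinate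 systems covering $\mathcal B^{\mathbb C}$. If $K_2=\{k_1+d,\dots,k_r+d\}\ne\emptyset$ with $k_1<\dots<k_r$, let $E_0=(e_{k_1},\dots,e_{k_r})$, with $e_i$ the $i$-th column of $I_d$. For $\mathbf A\in\mathcal O_K^{\mathbb C}$ define the Hermitian $(d+r)\times(d+r)$ matrix $$S_K^D(\mathbf A)=\begin{pmatrix}S_1+[(E_1-I_d)P_0^{-1}+E_1](E_1P_0^{-1}+I_d-E_1)^{-1}&S_2E_0\\ E_0^*S_2^*&E_0^*S_3E_0\end{pmatrix}\ \text{if }K_2\ne\emptyset,$$ and $S_K^D(\mathbf A)=S_1+[(E_1-I_d)P_0^{-1}+E_1](E_1P_0^{-1}+I_d-E_1)^{-1}$ if $K_2=\emptyset$. For $\mathbf A=[(A_1,A_2)\,|\,(B_1,B_2)]$ with $2d\times d$ blocks let $D(\mathbf A)=(A_1P_0^{-1}+B_1,\,B_2)$, a $2d\times2d$ matrix whose rank does not depend on the representative. For Hermitian $M$, $r^0(M),r^+(M),r^-(M)$ are the total multiplicities of its zero, positive, negative eigenvalues. $r^0(D(\mathbf A))$ means $2d-\operatorname{rank}D(\mathbf A)$. Define $$\mathcal B_k=\{\mathbf A\in\mathcal B^{\mathbb C}:r^0(D(\mathbf A))=k\},\qquad \mathcal B_K^{(r^0,r^+,r^-)}=\{\mathbf A\in\mathcal O_K^{\mathbb C}:r^0(S_K^D(\mathbf A))=r^0,\ r^\pm(S_K^D(\mathbf A))=r^\pm\}$$ for nonnegative integers with $r^0+r^++r^-=d+r$.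 Singular set: $\lambda_n$ ($1\le n\le Nd$) is regarded as a function on the part of the considered space where there are at least $n$ eigenvalues. The singular set is the set of points of the space at which some $\lambda_n$ is discontinuous. Here a point at which $\lambda_n$ is not defined but which is a limit of points at which it is defined counts as a discontinuity point. *)

(* Defs.v *)
From HB Require Import structures.
From mathcomp Require Import all_boot all_order all_algebra.
From mathcomp Require Import sesquilinear spectral generic_quotient complex.
From mathcomp Require Import all_classical all_reals all_analysis.

Set Implicit Arguments.
Unset Strict Implicit.
Unset Printing Implicit Defensive.

Import Order.TTheory GRing.Theory Num.Theory.
Import numFieldNormedType.Exports.

Local Open Scope classical_set_scope.
Local Open Scope ring_scope.
Local Open Scope sesquilinear_scope.

(* R[i] with its numClosedFieldType structure: the plain type R[i] carries no
   topology in the library, but every numFieldType does. *)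
Definition cplx (R : realType) : numClosedFieldType := R[i].

Definition posdefmx (C : numClosedFieldType) (n : nat) (M : 'M[C]_n) : Prop :=
  M \is hermsymmx /\
  forall x : 'cV[C]_n, x != 0 -> 0 < (x ^t* *m M *m x) ord0 ord0.

(** Inertia of a Hermitian matrix *)

Section inertia.
Context {C : numClosedFieldType} {n : nat}.

(* Roots of the characteristic polynomial, repeated with multiplicity. *)
Definition mx_eigenvalues (M : 'M[C]_n) : seq C :=
  sval (closed_field_poly_normal (char_poly M)).

(* On C, 0 < z means that z is real and positive. *)
Definition r_zero (M : 'M[C]_n) : nat := count (pred1 0) (mx_eigenvalues M).
Definition r_pos (M : 'M[C]_n) : nat :=
  count (fun z => 0 < z) (mx_eigenvalues M).
Definition r_neg (M : 'M[C]_n) : nat :=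
  count (fun z => z < 0) (mx_eigenvalues M).

End inertia.

(** The space of equations *)

(* P_j^{-1} is [Pinv j], 0 <= j <= N, but Q_i and W_i, 1 <= i <= N, are
   [Qc i'] and [Wc i'] with i' : 'I_N of value i - 1. *)
Record Omega (R : realType) (d N : nat) := MkOmega {
  Pinv : 'I_N.+1 -> 'M[cplx R]_d;
  Qc : 'I_N -> 'M[cplx R]_d;
  Wc : 'I_N -> 'M[cplx R]_d;
  Pinv_herm : forall j, Pinv j \is hermsymmx;
  Pinv_unit : forall j, Pinv j \in unitmx;
  Qc_herm : forall i, Qc i \is hermsymmx;
  Wc_posdef : forall i, posdefmx (Wc i)
}.

(** The space of self-adjoint boundary conditions *)

(* A pair (A, B) of square matrices of size 2d is the matrix [row_mx A B]. *)
Definition bc_pairs (R : realType) (d : nat) :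
    set 'M[cplx R]_(d + d, (d + d) + (d + d)) :=
  [set M | \rank M = (d + d)%N /\
           lsubmx M *m (rsubmx M) ^t* = rsubmx M *m (lsubmx M) ^t*].

Section bc_space.
Local Open Scope quotient_scope.
Context {R : realType} {d : nat}.

Definition bc_equiv : rel (set_type (@bc_pairs R d)) := fun M M' =>
  `[< exists2 U : 'M[cplx R]_(d + d),
        U \in unitmx & set_val M' = U *m set_val M >].

Lemma bc_equiv_refl : reflexive bc_equiv.
Proof. by move=> M; apply/asboolP; exists 1%:M; rewrite ?unitmx1 ?mul1mx. Qed.

Lemma bc_equiv_sym : symmetric bc_equiv.
Proof.
have sub M M' : bc_equiv M M' -> bc_equiv M' M.
  move=> /asboolP[U Uu eqU]; apply/asboolP; exists (invmx U).
    by rewrite unitmx_inv.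
  by rewrite eqU mulKmx.
by move=> M M'; apply/idP/idP; exact: sub.
Qed.

Lemma bc_equiv_trans : transitive bc_equiv.
Proof.
move=> M' M M'' /asboolP[U Uu eqU] /asboolP[V Vu eqV]; apply/asboolP.
by exists (V *m U); rewrite ?unitmx_mul ?Vu ?Uu // eqV eqU mulmxA.
Qed.

Canonical bc_equiv_rel :=
  EquivRel bc_equiv bc_equiv_refl bc_equiv_sym bc_equiv_trans.

End bc_space.

Definition bc (R : realType) (d : nat) : Type :=
  quotient_topology {eq_quot @bc_equiv R d}%qT.
HB.instance Definition _ (R : realType) (d : nat) :=
  Quotient.copy (bc R d) (quotient_topology {eq_quot @bc_equiv R d}%qT).
HB.instance Definition _ (R : realType) (d : nat) :=
  Topological.copy (bc R d) (quotient_topology {eq_quot @bc_equiv R d}%qT).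

(* A = [M], where M is required to be an admissible pair. *)
Definition is_bc_class (R : realType) (d : nat)
    (M : 'M[cplx R]_(d + d, (d + d) + (d + d))) (A : bc R d) : Prop :=
  exists2 M' : set_type (@bc_pairs R d),
    set_val M' = M & A = (\pi_(bc R d) M')%qT.

(* The notions defined below through this representative (solutions, rank of
   D(A)) do not depend on its choice. *)
Definition bc_repr (R : realType) (d : nat) (A : bc R d) :
    'M[cplx R]_(d + d, (d + d) + (d + d)) :=
  set_val (repr A : set_type (@bc_pairs R d)).

(** The Sturm-Liouville problem *)

(* This is the forward difference x_{i+1} - x_i of x_0, ..., x_n, but also its
   backward difference, indexed from 0: the value at i is that of nabla x at
   i + 1. *)
Definition fdiff (V : zmodType) (n : nat) (x : 'I_n.+1 -> V) : 'I_n -> V :=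
  fun i => x (lift ord0 i) - x (widen_ord (leqnSn n) i).

Section problem.
Context {R : realType} {d N : nat}.
Implicit Types (omega : Omega R d N) (A : bc R d).

Definition Pc omega (j : 'I_N.+1) : 'M[cplx R]_d := invmx (Pinv omega j).

(* y_0, ..., y_{N+1} *)
Definition slseq := {ffun 'I_N.+2 -> 'cV[cplx R]_d}.

Definition sl_quasi_diff omega (y : slseq) (j : 'I_N.+1) : 'cV[cplx R]_d :=
  Pc omega j *m fdiff y j.

Definition sl_equation omega (lam : cplx R) (y : slseq) : Prop :=
  forall i : 'I_N,
    let y_i := y (lift ord0 (widen_ord (leqnSn N) i)) in
    - fdiff (sl_quasi_diff omega y) i + Qc omega i *m y_i
      = lam *: (Wc omega i *m y_i).

Definition sl_boundary omega A (y : slseq) : Prop :=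
  lsubmx (bc_repr A)
    *m col_mx (- y ord0) (y (widen_ord (leqnSn N.+1) ord_max))
  + rsubmx (bc_repr A)
    *m col_mx (sl_quasi_diff omega y ord0) (sl_quasi_diff omega y ord_max) = 0.

Definition sl_solution omega A (lam : cplx R) (y : slseq) : Prop :=
  sl_equation omega lam y /\ sl_boundary omega A y.

(* The largest number of linearly independent solutions; it is 0 exactly when
   lam is not an eigenvalue. *)
Definition multiplicity omega A (lam : cplx R) : nat :=
  \max_(m < (\dim {: slseq}).+1 |
        `[< exists2 ys : m.-tuple slseq,
              free ys & forall y, y \in ys -> sl_solution omega A lam y >]) m.

Definition is_eigenvalue_list omega A (s : seq R) : Prop :=
  sorted <=%R s /\
  forall lam : cplx R,
    count_mem lam [seq (x%:C)%C : cplx R | x <- s] = multiplicity omega A lam.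

Definition eigenvalue_list omega A : seq R :=
  xget [::] [set s | is_eigenvalue_list omega A s].

Definition nb_eigenvalues omega A : nat := size (eigenvalue_list omega A).

(* lambda_n, for 1 <= n <= nb_eigenvalues; the value is 0 otherwise. *)
Definition lambda omega (n : nat) A : R := nth 0 (eigenvalue_list omega A) n.-1.

Definition lambda_dom omega (n : nat) : set (bc R d) :=
  [set A | (n <= nb_eigenvalues omega A)%N].

Definition lambda_discontinuous omega (n : nat) A : Prop :=
  (lambda_dom omega n A /\
     ~ (lambda omega n @ within (lambda_dom omega n) (nbhs A)
          --> lambda omega n A))
  \/ (~ lambda_dom omega n A /\ closure (lambda_dom omega n) A).

Definition singular_set omega : set (bc R d) :=
  [set A | exists2 n : nat,
    (1 <= n <= N * d)%N & lambda_discontinuous omega n A].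

(** The layers of the space of boundary conditions *)

Definition Dmx omega A : 'M[cplx R]_(d + d) :=
  let A' := lsubmx (bc_repr A) in let B' := rsubmx (bc_repr A) in
  row_mx (lsubmx A' *m Pinv omega ord0 + lsubmx B') (rsubmx B').

Definition B_layer omega (k : nat) : set (bc R d) :=
  [set A | (d + d - \rank (Dmx omega A))%N = k].

End problem.

(** Coordinate charts *)

(* A subset K of {1, ..., 2d} is a set of indices shifted to start at 0;
   [K_lo K] is K_1 and [K_hi K] is K_2 translated by -d. *)
Section charts.
Context {R : realType} {d : nat}.
Implicit Types (K : {set 'I_(d + d)}) (S : 'M[cplx R]_(d + d)).

Definition K_lo K : {set 'I_d} := [set i | lshift d i \in K].
Definition K_hi K : {set 'I_d} := [set i | rshift d i \in K].

Definition E1 K : 'M[cplx R]_d := diag_mx (\row_i (i \notin K_lo K)%:R).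
Definition E2 K : 'M[cplx R]_d := diag_mx (\row_i (i \notin K_hi K)%:R).

Definition E_ K : 'M[cplx R]_((d + d) + (d + d)) :=
  block_mx
    (block_mx (E1 K) 0 0 (E2 K))
    (block_mx (1%:M - E1 K) 0 0 (1%:M - E2 K))
    (block_mx (E1 K - 1%:M) 0 0 (E2 K - 1%:M))
    (block_mx (E1 K) 0 0 (E2 K)).

(* A lies in the chart O_K, with (unique) coordinate matrix S(A) = S. *)
Definition is_coord K (A : bc R d) S : Prop :=
  S \is hermsymmx /\ is_bc_class (row_mx S 1%:M *m E_ K) A.

(* Columns e_k of the identity for k in K_2 - d; [enum_val] is increasing. *)
Definition E0 K : 'M[cplx R]_(d, #|K_hi K|) :=
  \matrix_(i, j) (i == enum_val j)%:R.

(* When K_2 is empty, the three blocks other than the first have no entry. *)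
Definition S_D (N : nat) (omega : Omega R d N) K S :
    'M[cplx R]_(d + #|K_hi K|) :=
  let P0inv := Pinv omega ord0 in
  block_mx
    (ulsubmx S + ((E1 K - 1%:M) *m P0inv + E1 K)
                   *m invmx (E1 K *m P0inv + 1%:M - E1 K))
    (ursubmx S *m E0 K)
    ((E0 K) ^t* *m (ursubmx S) ^t*)
    ((E0 K) ^t* *m drsubmx S *m E0 K).

Definition B_chart_layer (N : nat) (omega : Omega R d N) K (r0 rp rm : nat) :
    set (bc R d) :=
  [set A | exists2 S, is_coord K A S &
     [/\ r_zero (S_D omega K S) = r0, r_pos (S_D omega K S) = rp
       & r_neg (S_D omega K S) = rm]].

End charts.

(* Main.v *)
From HB Require Import structures.
Require Import Defs.
From mathcomp Require Import all_boot all_order all_algebra.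
From mathcomp Require Import sesquilinear spectral generic_quotient complex.
From mathcomp Require Import all_classical all_reals all_analysis.
From mathcomp Require Import zify ring.

Import Order.TTheory GRing.Theory Num.Theory.
Import numFieldNormedType.Exports.

Local Open Scope classical_set_scope.
Local Open Scope ring_scope.
Local Open Scope sesquilinear_scope.

Set Implicit Arguments.
Unset Strict Implicit.
Unset Printing Implicit Defensive.

(** Write u = (- y_0, y_N) for the boundary values and v for the boundary
quasi-differences (P_0 Delta y_0, P_N Delta y_N).  Once y_0 and y_{N+1} are
eliminated, u is replaced by R y = (- y_1, y_N), the equation becomes
T y - R^* v = lam W y on C^(N d), with a Hermitian Jacobi matrix T, and the
boundary condition becomes A u + D v = 0, where (A, D) is again a Lagrangian
pair and D is the matrix D(A) of the statement.  If X is Hermitian and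
J = A + D X is invertible, then the substitution v = X u - w turns the boundary
condition into R y = L w, with L = J^-1 D Hermitian, and T into T - R^* X R.
The eigenvalues are therefore the points where the Hermitian pencil

  H(mu) = [ T - R^* X R - mu W , R^* ; R , - L ]

degenerates.  The variable w can be eliminated outside ker L, while ker L pairs
with a complement into hyperbolic planes; this gives N d - dim ker L real
eigenvalues and, for mu off the spectrum, the exact count

  #{ n | lam_n < mu } = n_-(H(mu)) - n_+(L) - n_0(L)

([pencil_spectrum], [eigenvalue_list_spec]).

The inertia of a nondegenerate Hermitian matrix is locally constant, because
neither n_+ nor n_- can drop in a limit ([near_r_neg_eq]).  So, near a given
boundary condition and for a fixed mu off its spectrum, the number of
eigenvalues below mu changes exactly by the change of n_-(L)
([near_count]), and every assertion about limits of single eigenvalues is read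
off from such a shift of the counting functions ([nth_cvg_shift] and its two
companions).  Two choices of X are made.

- X = t, a real scalar.  Along a layer of constant nullity of D the number n_0(L)
  is fixed and n_+(L), n_-(L) can only grow, so they are locally constant and
  there is no shift: this is the continuity on the layers ([layer_count]).

- In the chart O_K, X is a function of the coordinate matrix S for which - L is
  congruent to the direct sum of S_K^D and of a negative definite matrix
  ([chart_indices]).  Then n_-(L) is the number of positive eigenvalues of
  S_K^D, and the shift is r^+ - r_1^+ ([chart_count]).

Finally L can be made invertible by an arbitrarily small real shift, so that the
layer of nullity 0 is dense; it is also open, whence the singular set. *)

(** * Adjoints and coordinate selection *)

Section Adjoint.
Context {C : numClosedFieldType}.

Lemma adjM m n p (A : 'M[C]_(m, n)) (B : 'M[C]_(n, p)) :
  (A *m B) ^t* = B ^t* *m A ^t*.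
Proof. by rewrite trmx_mul map_mxM. Qed.

Lemma adjD m n (A B : 'M[C]_(m, n)) : (A + B) ^t* = A ^t* + B ^t*.
Proof. by rewrite linearD map_mxD. Qed.

Lemma adjN m n (A : 'M[C]_(m, n)) : (- A) ^t* = - A ^t*.
Proof. by rewrite linearN map_mxN. Qed.

Lemma adjB m n (A B : 'M[C]_(m, n)) : (A - B) ^t* = A ^t* - B ^t*.
Proof. by rewrite adjD adjN. Qed.

Lemma adjZ m n (a : C) (A : 'M[C]_(m, n)) : (a *: A) ^t* = a^* *: A ^t*.
Proof. by rewrite linearZ map_mxZ. Qed.

Lemma adj0 m n : (0 : 'M[C]_(m, n)) ^t* = 0.
Proof. by rewrite trmx0 map_mx0. Qed.

Lemma adj1 n : (1%:M : 'M[C]_n) ^t* = 1%:M.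
Proof. by rewrite trmx1 map_mx1. Qed.

Lemma adj_sum I (r : seq I) m n (F : I -> 'M[C]_(m, n)) :
  (\sum_(i <- r) F i) ^t* = \sum_(i <- r) (F i) ^t*.
Proof. exact: (big_morph (fun A : 'M[C]_(m, n) => A ^t*) (@adjD m n) (@adj0 m n)). Qed.

Lemma adj_block m1 m2 n1 n2 (A : 'M[C]_(m1, n1)) (B : 'M[C]_(m1, n2))
    (A' : 'M[C]_(m2, n1)) (B' : 'M[C]_(m2, n2)) :
  (block_mx A B A' B') ^t* = block_mx (A ^t*) (A' ^t*) (B ^t*) (B' ^t*).
Proof. by rewrite tr_block_mx map_block_mx. Qed.

Lemma adj_row m n1 n2 (A : 'M[C]_(m, n1)) (B : 'M[C]_(m, n2)) :
  (row_mx A B) ^t* = col_mx (A ^t*) (B ^t*).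
Proof. by rewrite tr_row_mx map_col_mx. Qed.

Lemma adj_col m1 m2 n (A : 'M[C]_(m1, n)) (B : 'M[C]_(m2, n)) :
  (col_mx A B) ^t* = row_mx (A ^t*) (B ^t*).
Proof. by rewrite tr_col_mx map_row_mx. Qed.

Lemma hermP n (H : 'M[C]_n) : reflect (H ^t* = H) (H \is hermsymmx).
Proof.
apply: (iffP (is_hermitianmxP _ _ _)); rewrite expr0 scale1r.
  by move=> eqH; rewrite -eqH.
by move=> ->.
Qed.

Lemma unitmx_adj n (A : 'M[C]_n) : (A ^t* \in unitmx) = (A \in unitmx).
Proof. by rewrite map_unitmx unitmx_tr. Qed.

Lemma adj_inv n (A : 'M[C]_n) : (invmx A) ^t* = invmx (A ^t*).
Proof. by rewrite trmx_inv map_invmx. Qed.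

Lemma mxrank_adj m n (A : 'M[C]_(m, n)) : \rank (A ^t*) = \rank A.
Proof. by rewrite mxrank_map mxrank_tr. Qed.

Lemma herm_conj k n (V : 'M[C]_(k, n)) (H : 'M[C]_n) :
  H \is hermsymmx -> V *m H *m V ^t* \is hermsymmx.
Proof. by move=> /hermP eH; apply/hermP; rewrite !adjM trmxCK eH mulmxA. Qed.

Lemma hermN n (H : 'M[C]_n) : H \is hermsymmx -> - H \is hermsymmx.
Proof. by move=> /hermP eH; apply/hermP; rewrite adjN eH. Qed.

Lemma hermD n (H H' : 'M[C]_n) :
  H \is hermsymmx -> H' \is hermsymmx -> H + H' \is hermsymmx.
Proof. by move=> /hermP eH /hermP eH'; apply/hermP; rewrite adjD eH eH'. Qed.

(** The columns of the identity whose index satisfies [P]. *)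
Definition sel n (P : {pred 'I_n}) : 'M[C]_(n, #|P|) :=
  \matrix_(i, j) (i == enum_val j)%:R.

Lemma sel_adjK n (P : {pred 'I_n}) : (sel P) ^t* *m sel P = 1%:M.
Proof.
apply/matrixP => i j; rewrite !mxE (bigD1 (enum_val i)) //= !mxE eqxx rmorph1.
rewrite mul1r big1 ?addr0 => [|k /negPf nk]; last first.
  by rewrite !mxE nk rmorph0 mul0r.
by rewrite (inj_eq enum_val_inj).
Qed.

Lemma sel_adj n (P : {pred 'I_n}) :
  sel P *m (sel P) ^t* = diag_mx (\row_i (i \in P)%:R).
Proof.
apply/matrixP => i j; rewrite !mxE; have [Pi|nPi] := boolP (i \in P).
  rewrite (bigD1 (enum_rank_in Pi i)) //= !mxE enum_rankK_in // eqxx mul1r.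
  rewrite big1 ?addr0 => [|k nk]; last first.
    rewrite !mxE; case: eqP => [ik|]; last by rewrite mul0r.
    by case/eqP: nk; apply: enum_val_inj; rewrite enum_rankK_in.
  by rewrite [j == i]eq_sym; case: eqP => _; rewrite ?rmorph1 ?rmorph0.
rewrite big1 => [|k _]; first by rewrite mul0rn.
rewrite !mxE; case: eqP => [ik|]; last by rewrite mul0r.
by move: nPi; rewrite ik enum_valP.
Qed.

Lemma mul_sel_entry k n (P : {pred 'I_n}) (A : 'M[C]_(k, n)) i j :
  (A *m sel P) i j = A i (enum_val j).
Proof.
rewrite !mxE (bigD1 (enum_val j)) //= !mxE eqxx mulr1 big1 ?addr0 // => l nl.
by rewrite !mxE (negPf nl) mulr0.
Qed.

End Adjoint.

(** * Inertia of Hermitian matrices *)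

Section Inertia.
Context {C : numClosedFieldType}.

(** The spectral theorem, with the conjugating matrix and the eigenvalues left
    abstract. *)
Lemma herm_spectral n (H : 'M[C]_n) : H \is hermsymmx ->
  exists U : 'M[C]_n, exists d : 'rV[C]_n,
    [/\ U *m U ^t* = 1%:M, U ^t* *m U = 1%:M,
        (forall i, d 0 i \is Num.real) & H = U ^t* *m diag_mx d *m U].
Proof.
move=> hH; exists (spectralmx H), (spectral_diag H).
have uU := spectral_unitarymx H.
have UU : spectralmx H *m (spectralmx H) ^t* = 1%:M by apply/unitarymxP.
split=> //; first exact: mulmx1C.
  by move=> i; move/mxOverP: (hermitian_spectral_diag_real hH); apply.
have /orthomx_spectralP eH := hermitian_normalmx hH.
by rewrite {1}eH invmx_unitary.
Qed.

Lemma char_poly_similar n (P Q A : 'M[C]_n) : P *m Q = 1%:M ->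
  char_poly (Q *m A *m P) = char_poly A.
Proof.
move=> /mulmx1C QP; rewrite /char_poly.
have QP' : map_mx polyC Q *m map_mx polyC P = 1%:M by rewrite -map_mxM QP map_mx1.
have -> : char_poly_mx (Q *m A *m P) =
    map_mx polyC Q *m char_poly_mx A *m map_mx polyC P.
  rewrite /char_poly_mx mulmxBr mulmxBl !map_mxM mul_mx_scalar -scalemxAl.
  by rewrite QP' scalemx1.
by rewrite !det_mulmx mulrAC -det_mulmx QP' det1 mul1r.
Qed.

Lemma mx_eigenvalues_diag n (U : 'M[C]_n) (d : 'rV[C]_n) :
  U *m U ^t* = 1%:M ->
  perm_eq (mx_eigenvalues (U ^t* *m diag_mx d *m U)) [seq d 0 i | i <- enum 'I_n].
Proof.
move=> UU; rewrite /mx_eigenvalues; case: closed_field_poly_normal => s /= es.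
apply: prod_XsubC_eq; rewrite big_map big_enum /=.
move: es; rewrite (monicP (char_poly_monic _)) scale1r => <-.
rewrite char_poly_similar // char_poly_trig ?diag_mx_is_trig //.
by apply: eq_bigr => i _; rewrite mxE eqxx mulr1n.
Qed.

Lemma count_mx_eigenvalues n (U : 'M[C]_n) (d : 'rV[C]_n) (p : pred C) :
  U *m U ^t* = 1%:M ->
  count p (mx_eigenvalues (U ^t* *m diag_mx d *m U)) = #|[pred i | p (d 0 i)]|.
Proof.
move=> UU; have /permP -> := mx_eigenvalues_diag d UU.
by rewrite count_map cardE size_filter enumT.
Qed.

Lemma sel_diag n (P : {pred 'I_n}) (d : 'rV[C]_n) :
  (sel P) ^t* *m diag_mx d *m sel P = diag_mx (\row_j d 0 (enum_val j)).
Proof.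
apply/matrixP => i j; rewrite mul_sel_entry mul_mx_diag !mxE.
rewrite [enum_val j == _]eq_sym (inj_eq enum_val_inj) eq_sym.
by case: eqP => [->|_]; rewrite ?rmorph1 ?rmorph0 ?mul1r ?mul0r ?mulr0n ?mulr1n.
Qed.

Lemma rank_diag_mx n (d : 'rV[C]_n) :
  \rank (diag_mx d) = #|[pred i | d 0 i != 0]|.
Proof.
set P := [pred i | _]; apply/eqP; rewrite eqn_leq; apply/andP; split.
  have -> : diag_mx d = sel P *m ((sel P) ^t* *m diag_mx d).
    rewrite mulmxA sel_adj mulmx_diag; congr diag_mx; apply/rowP => i.
    rewrite !mxE inE; case: (eqVneq (d 0 i) 0) => [->|_]; rewrite ?mulr0 //.
    by rewrite mul1r.
  exact: mulmx_max_rank.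
have <- : \rank ((sel P) ^t* *m diag_mx d *m sel P) = #|P|.
  rewrite sel_diag mxrank_unit // unitmxE det_diag unitfE.
  by apply/prodf_neq0 => i _; rewrite mxE; exact: (enum_valP i).
by apply: leq_trans (mxrankM_maxl _ _) (mxrankM_maxr _ _).
Qed.

(** Hermitian matrices are diagonalisable, so that the multiplicity of 0 as a
    root is the corank. *)
Lemma r_zeroE n (H : 'M[C]_n) : H \is hermsymmx -> r_zero H = (n - \rank H)%N.
Proof.
move=> /herm_spectral[U [d [UU UU' _ ->]]].
rewrite /r_zero count_mx_eigenvalues // mxrankMfree; last first.
  by rewrite -row_leq_rank mxrank_unit // ; have [] := mulmx1_unit UU.
rewrite -[X in (_ = n - X)%N]mxrank_tr trmx_mul mxrankMfree; last first.
  by rewrite row_free_unit unitmx_tr; have [] := mulmx1_unit UU.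
rewrite mxrank_tr rank_diag_mx.
have := cardC [pred i | d 0 i != 0]; rewrite card_ord => en.
rewrite -[X in (X - _)%N]en addKn.
by apply: eq_card => i; rewrite !inE negbK.
Qed.

Lemma r_total n (H : 'M[C]_n) : H \is hermsymmx ->
  (r_zero H + r_pos H + r_neg H = n)%N.
Proof.
move=> /herm_spectral[U [d [UU UU' dr ->]]].
rewrite /r_zero /r_pos /r_neg !count_mx_eigenvalues //.
apply: etrans (card_ord n).
rewrite -cardUI [#|predI _ _|]eq_card0 ?addn0; last first.
  by move=> i; rewrite !inE; case: (eqVneq (d 0 i) 0) => // ->; rewrite ltxx.
rewrite -cardUI [#|predI _ _|]eq_card0 ?addn0; last first.
  move=> i; rewrite !inE; case: (eqVneq (d 0 i) 0) => /= [->|_].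
    by rewrite ltxx.
  by apply/negP => /andP[/lt_trans h /h]; rewrite ltxx.
apply: eq_card => i; rewrite !inE.
by have := dr i; rewrite realE => /orP[]; rewrite le_eqVlt => /orP[]; 
  rewrite 1?eq_sym => ->; rewrite ?orbT.
Qed.

(** A Hermitian matrix has a diagonal square-root scaling on the sum of its
    positive eigenspaces. *)
Lemma r_pos_basis n (H : 'M[C]_n) : H \is hermsymmx ->
  exists V : 'M[C]_(r_pos H, n), V *m H *m V ^t* = 1%:M.
Proof.
move=> /herm_spectral[U [d [UU UU' dr eH]]].
have -> : r_pos H = #|[pred i | 0 < d 0 i]|.
  by rewrite /r_pos eH count_mx_eigenvalues.
set P := [pred i | _].
pose q := \row_(j < #|P|) (sqrtC (d 0 (enum_val j)))^-1.
exists (diag_mx q *m (sel P) ^t* *m U).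
rewrite eH !adjM trmxCK.
have -> : diag_mx q *m (sel P) ^t* *m U *m (U ^t* *m diag_mx d *m U)
    *m (U ^t* *m (sel P *m (diag_mx q) ^t*)) =
    diag_mx q *m ((sel P) ^t* *m (U *m U ^t*) *m diag_mx d *m (U *m U ^t*) *m sel P)
     *m (diag_mx q) ^t* by rewrite !mulmxA.
rewrite UU !mulmx1 sel_diag tr_diag_mx map_diag_mx !mulmx_diag.
apply/matrixP => i j; rewrite !mxE; case: eqP => // _; rewrite !mulr1n.
have di : 0 < d 0 (enum_val i) by exact: (enum_valP i).
rewrite fmorphV /= (@conj_Creal _ (sqrtC _)) ?ger0_real ?sqrtC_ge0 ?ltW //.
have s0 : sqrtC (d 0 (enum_val i)) != 0 by rewrite sqrtC_eq0 gt_eqF.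
by rewrite -{2}[d 0 _]sqrtCK expr2 mulKf ?mulfV.
Qed.

Lemma posdefmx_inj n (H : 'M[C]_n) (x : 'rV[C]_n) : posdefmx H -> x != 0 ->
  0 < (x *m H *m x ^t*) 0 0.
Proof.
move=> [_ pH] x0; have := pH (x ^t*); rewrite trmxCK; apply.
by apply: contra x0 => /eqP e; rewrite -[x]trmxCK e adj0.
Qed.

(** Conversely a positive definite compression has at most [r_pos] rows: a
    combination of more rows can be chosen orthogonal to all the positive
    eigenvectors. *)
Lemma leq_r_pos k n (V : 'M[C]_(k, n)) (H : 'M[C]_n) : H \is hermsymmx ->
  posdefmx (V *m H *m V ^t*) -> (k <= r_pos H)%N.
Proof.
move=> /herm_spectral[U [d [UU UU' dr eH]]] pV.
have -> : r_pos H = #|[pred i | 0 < d 0 i]|.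
  by rewrite /r_pos eH count_mx_eigenvalues.
set P := [pred i | _]; rewrite leqNgt; apply/negP => ltk.
have : kermx (V *m U ^t* *m sel P) != 0.
  rewrite kermx_eq0 -row_leq_rank -ltnNge.
  exact: leq_ltn_trans (rank_leq_col _) ltk.
rewrite -nz_row_eq0; set x := nz_row _ => x0.
have /sub_kermxP xk : (x <= kermx (V *m U ^t* *m sel P))%MS by exact: nz_row_sub.
have := posdefmx_inj pV x0; rewrite eH.
have [z ez] : {z | z = x *m V *m U ^t*} by eexists.
have -> : x *m (V *m (U ^t* *m diag_mx d *m U) *m V ^t*) *m x ^t*
   = z *m diag_mx d *m z ^t* by rewrite ez !adjM trmxCK !mulmxA.
rewrite mul_mx_diag !mxE; apply/negP; rewrite le_gtF // sumr_le0 // => i _.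
rewrite !mxE mulrAC -normCK.
have [Pi|] := boolP (i \in P).
  suff -> : z 0 i = 0 by rewrite normr0 expr0n mul0r.
  have := congr1 (fun A : 'rV_ _ => A 0 (enum_rank_in Pi i)) xk.
  by rewrite !mulmxA -ez mul_sel_entry enum_rankK_in // mxE.
rewrite inE -real_leNgt ?real0 // => di.
by apply: mulr_ge0_le0 => //; rewrite exprn_ge0.
Qed.

Lemma posdefmx1 n : posdefmx (1%:M : 'M[C]_n).
Proof.
split; first by apply/hermP; rewrite adj1.
move=> x x0; rewrite mulmx1 mxE.
have /existsP[i xi] : [exists i, x i 0 != 0].
  apply: contraR x0 => /existsPn h; apply/eqP/colP => i; rewrite mxE.
  by apply/eqP; move: (h i); rewrite negbK.
rewrite (bigD1 i) //= ltr_pwDl // ?sumr_ge0 // => [|j _]; rewrite !mxE mulrC.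
  by rewrite -normCK exprn_gt0 // normr_gt0.
by rewrite -normCK exprn_ge0.
Qed.

Lemma leq_r_pos1 k n (V : 'M[C]_(k, n)) (H : 'M[C]_n) : H \is hermsymmx ->
  V *m H *m V ^t* = 1%:M -> (k <= r_pos H)%N.
Proof. by move=> hH eV; apply: (leq_r_pos hH (V := V)); rewrite eV; apply: posdefmx1. Qed.

(** A definite subspace of the compressed form is mapped by [V] onto one of the
    original form. *)
Lemma r_pos_compress k n (V : 'M[C]_(k, n)) (H : 'M[C]_n) : H \is hermsymmx ->
  (r_pos (V *m H *m V ^t*) <= r_pos H)%N.
Proof.
move=> hH; have [V' eV'] := r_pos_basis (herm_conj V hH).
apply: (leq_r_pos1 (V := V' *m V)) => //.
by rewrite adjM -eV' !mulmxA.
Qed.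

Lemma r_negE n (H : 'M[C]_n) : H \is hermsymmx -> r_neg H = r_pos (- H).
Proof.
move=> /herm_spectral[U [d [UU UU' dr eH]]].
have eH' : - H = U ^t* *m diag_mx (- d) *m U.
  by rewrite eH linearN /= mulmxN mulNmx.
rewrite /r_pos eH' /r_neg eH !count_mx_eigenvalues //.
by apply: eq_card => i; rewrite !inE mxE oppr_gt0.
Qed.

Lemma r_posE n (H : 'M[C]_n) : H \is hermsymmx -> r_pos H = r_neg (- H).
Proof. by move=> hH; rewrite r_negE ?hermN // opprK. Qed.

Lemma r_neg_compress k n (V : 'M[C]_(k, n)) (H : 'M[C]_n) : H \is hermsymmx ->
  (r_neg (V *m H *m V ^t*) <= r_neg H)%N.
Proof.
move=> hH; rewrite !r_negE // ?herm_conj // -mulNmx -mulmxN.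
by rewrite r_pos_compress // hermN.
Qed.

(** Sylvester's law of inertia.  The two sizes are related by the inverse pair
    [V], [V'] and so need not be literally equal. *)
Lemma r_pos_congr m n (V : 'M[C]_(m, n)) (V' : 'M[C]_(n, m)) (H : 'M[C]_n) :
  H \is hermsymmx -> V' *m V = 1%:M -> r_pos (V *m H *m V ^t*) = r_pos H.
Proof.
move=> hH VV; apply/eqP; rewrite eqn_leq r_pos_compress //=.
have {1}-> : H = V' *m (V *m H *m V ^t*) *m V' ^t*.
  by rewrite !mulmxA VV mul1mx -mulmxA -adjM VV adj1 mulmx1.
by rewrite r_pos_compress // herm_conj.
Qed.

Lemma r_neg_congr m n (V : 'M[C]_(m, n)) (V' : 'M[C]_(n, m)) (H : 'M[C]_n) :
  H \is hermsymmx -> V' *m V = 1%:M -> r_neg (V *m H *m V ^t*) = r_neg H.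
Proof.
move=> hH VV; rewrite !r_negE // ?herm_conj // -mulNmx -mulmxN.
by apply: r_pos_congr VV; rewrite hermN.
Qed.

Lemma herm_block_diag m n (A : 'M[C]_m) (B : 'M[C]_n) :
  A \is hermsymmx -> B \is hermsymmx -> block_mx A 0 0 B \is hermsymmx.
Proof. by move=> /hermP eA /hermP eB; apply/hermP; rewrite adj_block eA eB !adj0. Qed.

Lemma r_pos_block_ge m n (A : 'M[C]_m) (B : 'M[C]_n) :
  A \is hermsymmx -> B \is hermsymmx ->
  (r_pos A + r_pos B <= r_pos (block_mx A 0 0 B))%N.
Proof.
move=> hA hB; have [V eV] := r_pos_basis hA; have [W eW] := r_pos_basis hB.
apply: (leq_r_pos1 (V := block_mx V 0 0 W)); first exact: herm_block_diag.
by rewrite adj_block !adj0 !mulmx_block !(mul0mx, mulmx0, addr0, add0r) eV eW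
  -scalar_mx_block.
Qed.

Lemma r_neg_block_ge m n (A : 'M[C]_m) (B : 'M[C]_n) :
  A \is hermsymmx -> B \is hermsymmx ->
  (r_neg A + r_neg B <= r_neg (block_mx A 0 0 B))%N.
Proof.
move=> hA hB; rewrite !r_negE ?herm_block_diag // opp_block_mx !oppr0.
by apply: r_pos_block_ge; rewrite hermN.
Qed.

Lemma r_zero_block m n (A : 'M[C]_m) (B : 'M[C]_n) :
  A \is hermsymmx -> B \is hermsymmx ->
  r_zero (block_mx A 0 0 B) = (r_zero A + r_zero B)%N.
Proof.
move=> hA hB; rewrite !r_zeroE ?herm_block_diag // rank_diag_block_mx.
by rewrite subnDA addnBA ?rank_leq_row // -addnBAC ?rank_leq_row // addnC subnDA.
Qed.

(* The lower bounds for the three indices add up to the whole size. *)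
Lemma r_pos_block m n (A : 'M[C]_m) (B : 'M[C]_n) :
  A \is hermsymmx -> B \is hermsymmx ->
  r_pos (block_mx A 0 0 B) = (r_pos A + r_pos B)%N.
Proof.
move=> hA hB; have hAB := herm_block_diag hA hB.
apply/eqP; rewrite eqn_leq r_pos_block_ge // andbT.
have := r_total hAB; rewrite r_zero_block //.
have := r_total hA; have := r_total hB; have := r_neg_block_ge hA hB.
move: (r_pos (block_mx _ _ _ _)) (r_neg (block_mx _ _ _ _)) => p q.
by clear; lia.
Qed.

Lemma r_neg_block m n (A : 'M[C]_m) (B : 'M[C]_n) :
  A \is hermsymmx -> B \is hermsymmx ->
  r_neg (block_mx A 0 0 B) = (r_neg A + r_neg B)%N.
Proof.
move=> hA hB; rewrite !r_negE ?herm_block_diag // opp_block_mx !oppr0.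
by rewrite r_pos_block ?hermN.
Qed.

Lemma herm1 n : (1%:M : 'M[C]_n) \is hermsymmx.
Proof. by apply/hermP; rewrite adj1. Qed.

Lemma r_pos1 n : r_pos (1%:M : 'M[C]_n) = n.
Proof.
apply/eqP; rewrite eqn_leq (leq_r_pos1 (V := 1%:M)) ?herm1 //; last first.
  by rewrite mul1mx adj1 mulmx1.
by rewrite andbT -[X in (_ <= X)%N](r_total (herm1 n)) addnAC leq_addl.
Qed.

Lemma r_neg1 n : r_neg (1%:M : 'M[C]_n) = 0%N.
Proof.
have := r_total (herm1 n); rewrite r_pos1 => /eqP.
by rewrite addnAC -[X in _ == X]add0n eqn_add2r addn_eq0 => /andP[_ /eqP].
Qed.

End Inertia.

(** * Semicontinuity of the inertia *)

Section Dominance.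
Context {C : numClosedFieldType}.

Lemma herm_form_real n (H : 'M[C]_n) (x : 'cV[C]_n) : H \is hermsymmx ->
  (x ^t* *m H *m x) 0 0 \is Num.real.
Proof.
move=> /hermP eH; apply/CrealP.
have -> : ((x ^t* *m H *m x) 0 0)^* = ((x ^t* *m H *m x) ^t*) 0 0 by rewrite !mxE.
by rewrite !adjM trmxCK eH mulmxA.
Qed.

(** Diagonal dominance: by the inequality of the means, a perturbation of the
    identity with entries at most 1 / (n + 1) moves the form by less than its
    value. *)
Lemma posdefmx_near1 n (G : 'M[C]_n) : G \is hermsymmx ->
  (forall i j, `|(1%:M : 'M[C]_n) i j - G i j| <= n.+1%:R^-1) -> posdefmx G.
Proof.
move=> hG dG; split=> // x x0.
have /= [_ /(_ _ x0)] := @posdefmx1 C n; rewrite mulmx1.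
set s := (x ^t* *m x) 0 0 => s0.
have es : s = \sum_i `|x i 0| ^+ 2.
  by rewrite /s mxE; apply: eq_bigr => i _; rewrite !mxE mulrC normCK.
have hD : 1%:M - G \is hermsymmx.
  by apply: hermD (hermN hG); apply/hermP; rewrite adj1.
have eG : (x ^t* *m G *m x) 0 0 = s - (x ^t* *m (1%:M - G) *m x) 0 0.
  by rewrite -[G in LHS](subKr 1%:M) mulmxBr mulmxBl mulmx1 [in LHS]mxE [X in _ + X]mxE.
rewrite eG subr_gt0.
apply: (le_lt_trans (real_ler_norm (herm_form_real x hD))).
suff h : `|(x ^t* *m (1%:M - G) *m x) 0 0| <= n.+1%:R^-1 * (n%:R * s).
  apply: (le_lt_trans h); rewrite mulrA gtr_pMl // mulrC ltr_pdivrMr ?ltr0Sn //.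
  by rewrite mul1r ltr_nat.
rewrite mxE; apply: (le_trans (ler_norm_sum _ _ _)).
have h2 j i : `|x i 0| * `|x j 0| <= (`|x i 0| ^+ 2 + `|x j 0| ^+ 2) / 2%:R.
  rewrite ler_pdivlMr ?ltr0n // -subr_ge0.
  have -> : `|x i 0| ^+ 2 + `|x j 0| ^+ 2 - `|x i 0| * `|x j 0| * 2%:R
    = (`|x i 0| - `|x j 0|) ^+ 2 by rewrite sqrrB mulr_natr addrAC.
  by rewrite real_exprn_even_ge0 // realB ?normr_real.
apply: (@le_trans _ _ (\sum_j \sum_i n.+1%:R^-1 * (`|x i 0| * `|x j 0|))).
  apply: ler_sum => j _; rewrite normrM mxE.
  apply: (@le_trans _ _ ((\sum_i `|x i 0| * n.+1%:R^-1) * `|x j 0|)).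
    apply: ler_wpM2r => //; apply: (le_trans (ler_norm_sum _ _ _)).
    apply: ler_sum => i _; rewrite normrM !mxE norm_conjC.
    by apply: ler_wpM2l => //; have := dG i j; rewrite !mxE.
  rewrite mulr_suml; apply: ler_sum => i _.
  by rewrite [_ * n.+1%:R^-1]mulrC mulrA.
under eq_bigr do rewrite -mulr_sumr.
rewrite -mulr_sumr; apply: ler_wpM2l; first by rewrite invr_ge0 ler0n.
apply: (@le_trans _ _ (\sum_j \sum_i (`|x i 0| ^+ 2 + `|x j 0| ^+ 2) / 2%:R)).
  by apply: ler_sum => j _; apply: ler_sum => i _; exact: h2.
under eq_bigr => j _ do
  rewrite -mulr_suml big_split /= sumr_const card_ord -es.
rewrite -mulr_suml big_split /= sumr_const card_ord sumrMnl -es.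
by rewrite -mulr2n -[X in X / _]mulr_natr mulfK ?pnatr_eq0 // mulr_natl.
Qed.

End Dominance.

Section Entrywise.
Context {R : realType} {T : Type} {F : set_system T} {FF : Filter F}.
Local Notation K := (cplx R).

(** Entrywise convergence along a filter: the form in which continuity of
    matrix expressions is propagated. *)
Definition mcvg m n (H : T -> 'M[K]_(m, n)) (H0 : 'M[K]_(m, n)) : Prop :=
  forall i j, (fun x => H x i j) @ F --> H0 i j.

Lemma mcvg_cst m n (H0 : 'M[K]_(m, n)) : mcvg (fun=> H0) H0.
Proof. by move=> i j; exact: cvg_cst. Qed.
#[local] Arguments mcvg_cst {m n} H0.

Lemma mcvgD m n (H G : T -> 'M[K]_(m, n)) H0 G0 :
  mcvg H H0 -> mcvg G G0 -> mcvg (fun x => H x + G x) (H0 + G0).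
Proof.
move=> cH cG i j; rewrite mxE; under eq_fun do rewrite mxE.
exact: (cvgD (cH i j) (cG i j)).
Qed.

Lemma mcvgN m n (H : T -> 'M[K]_(m, n)) H0 :
  mcvg H H0 -> mcvg (fun x => - H x) (- H0).
Proof.
by move=> cH i j; rewrite mxE; under eq_fun do rewrite mxE; exact: (cvgN (cH i j)).
Qed.

Lemma mcvgB m n (H G : T -> 'M[K]_(m, n)) H0 G0 :
  mcvg H H0 -> mcvg G G0 -> mcvg (fun x => H x - G x) (H0 - G0).
Proof. by move=> cH cG; exact: (mcvgD cH (mcvgN cG)). Qed.

Lemma mcvgZ m n (a : K) (H : T -> 'M[K]_(m, n)) H0 :
  mcvg H H0 -> mcvg (fun x => a *: H x) (a *: H0).
Proof.
move=> cH i j; rewrite mxE; under eq_fun do rewrite mxE.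
exact: (cvgM (cvg_cst a) (cH i j)).
Qed.

Lemma cvg_bigsum I (r : seq I) (f : I -> T -> K) (l : I -> K) :
  (forall i, f i @ F --> l i) ->
  (fun x => \sum_(i <- r) f i x) @ F --> \sum_(i <- r) l i.
Proof.
move=> cf; elim: r => [|i r IH].
  by under eq_fun do rewrite big_nil; rewrite big_nil; exact: cvg_cst.
under eq_fun do rewrite big_cons; rewrite big_cons; exact: (cvgD (cf i) IH).
Qed.

Lemma cvg_bigprod I (r : seq I) (f : I -> T -> K) (l : I -> K) :
  (forall i, f i @ F --> l i) ->
  (fun x => \prod_(i <- r) f i x) @ F --> \prod_(i <- r) l i.
Proof.
move=> cf; elim: r => [|i r IH].
  by under eq_fun do rewrite big_nil; rewrite big_nil; exact: cvg_cst.
under eq_fun do rewrite big_cons; rewrite big_cons; exact: (cvgM (cf i) IH).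
Qed.

Lemma mcvgM m n p (H : T -> 'M[K]_(m, n)) (G : T -> 'M[K]_(n, p)) H0 G0 :
  mcvg H H0 -> mcvg G G0 -> mcvg (fun x => H x *m G x) (H0 *m G0).
Proof.
move=> cH cG i j; rewrite mxE; under eq_fun do rewrite mxE.
by apply: cvg_bigsum => k; exact: (cvgM (cH i k) (cG k j)).
Qed.

Lemma cvg_conjC (f : T -> K) (l : K) :
  f @ F --> l -> (fun x => (f x)^*) @ F --> l^*.
Proof.
move=> /cvgrPdist_lt cf; apply/cvgrPdist_lt => e e0.
near=> x; rewrite -rmorphB norm_conjC; near: x; exact: cf.
Unshelve. all: by end_near. Qed.

Lemma mcvg_adj m n (H : T -> 'M[K]_(m, n)) H0 :
  mcvg H H0 -> mcvg (fun x => (H x) ^t*) (H0 ^t*).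
Proof.
by move=> cH i j; rewrite !mxE; under eq_fun do rewrite !mxE; exact: cvg_conjC.
Qed.

Lemma mcvg_row_mx m n p (H : T -> 'M[K]_(m, n)) (G : T -> 'M[K]_(m, p)) H0 G0 :
  mcvg H H0 -> mcvg G G0 -> mcvg (fun x => row_mx (H x) (G x)) (row_mx H0 G0).
Proof.
move=> cH cG i j; rewrite mxE; under eq_fun do rewrite mxE.
by case: splitP => k _; [exact: cH|exact: cG].
Qed.

Lemma mcvg_col_mx m n p (H : T -> 'M[K]_(m, n)) (G : T -> 'M[K]_(p, n)) H0 G0 :
  mcvg H H0 -> mcvg G G0 -> mcvg (fun x => col_mx (H x) (G x)) (col_mx H0 G0).
Proof.
move=> cH cG i j; rewrite mxE; under eq_fun do rewrite mxE.
by case: splitP => k _; [exact: cH|exact: cG].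
Qed.

Lemma mcvg_block m n p q (A : T -> 'M[K]_(m, p)) (B : T -> 'M[K]_(m, q))
    (A' : T -> 'M[K]_(n, p)) (B' : T -> 'M[K]_(n, q)) A0 B0 A0' B0' :
  mcvg A A0 -> mcvg B B0 -> mcvg A' A0' -> mcvg B' B0' ->
  mcvg (fun x => block_mx (A x) (B x) (A' x) (B' x)) (block_mx A0 B0 A0' B0').
Proof.
by move=> cA cB cA' cB'; exact: (mcvg_col_mx (mcvg_row_mx cA cB) (mcvg_row_mx cA' cB')).
Qed.

Lemma mcvg_lsub m n p (H : T -> 'M[K]_(m, n + p)) H0 :
  mcvg H H0 -> mcvg (fun x => lsubmx (H x)) (lsubmx H0).
Proof. by move=> cH i j; rewrite mxE; under eq_fun do rewrite mxE; exact: cH. Qed.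

Lemma mcvg_rsub m n p (H : T -> 'M[K]_(m, n + p)) H0 :
  mcvg H H0 -> mcvg (fun x => rsubmx (H x)) (rsubmx H0).
Proof. by move=> cH i j; rewrite mxE; under eq_fun do rewrite mxE; exact: cH. Qed.

Lemma mcvg_dsub m n p (H : T -> 'M[K]_(n + p, m)) H0 :
  mcvg H H0 -> mcvg (fun x => dsubmx (H x)) (dsubmx H0).
Proof. by move=> cH i j; rewrite mxE; under eq_fun do rewrite mxE; exact: cH. Qed.

Lemma cvg_det n (H : T -> 'M[K]_n) H0 :
  mcvg H H0 -> (fun x => \det (H x)) @ F --> \det H0.
Proof.
move=> cH; rewrite /determinant; apply: cvg_bigsum => s.
by apply: cvgM; [exact: cvg_cst|apply: cvg_bigprod => i; exact: cH].
Qed.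

Lemma near_unitmx n (H : T -> 'M[K]_n) H0 :
  mcvg H H0 -> H0 \in unitmx -> \forall x \near F, H x \in unitmx.
Proof.
move=> /cvg_det /cvgrPdist_lt cH; rewrite unitmxE unitfE => d0.
have e0 : 0 < `|\det H0| by rewrite normr_gt0.
have := cH _ e0; apply: filterS => x; rewrite unitmxE unitfE.
by apply: contraTneq => ->; rewrite subr0 ltxx.
Qed.

(** By the cofactor formula. *)
Lemma mcvg_inv n (H : T -> 'M[K]_n) H0 :
  mcvg H H0 -> H0 \in unitmx -> mcvg (fun x => invmx (H x)) (invmx H0).
Proof.
move=> cH u0 i j; have nu := near_unitmx cH u0.
rewrite /invmx u0 !mxE.
apply: (@cvg_trans _ ((fun x => (\det (H x))^-1 * cofactor (H x) j i) @ F)).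
  apply: near_eq_cvg; apply: filterS nu => x ux.
  by rewrite /invmx ux !mxE.
apply: cvgM.
  by apply: cvgV; [rewrite -unitfE -unitmxE|exact: cvg_det].
apply: cvgM; first exact: cvg_cst.
apply: cvg_det => k l; rewrite !mxE.
by under eq_fun do rewrite !mxE; exact: cH.
Qed.

(** Definiteness of a compression is an open condition, so that neither index
    can drop in the limit. *)
Lemma near_r_pos n (H : T -> 'M[K]_n) H0 : mcvg H H0 -> H0 \is hermsymmx ->
  (\forall x \near F, H x \is hermsymmx) ->
  \forall x \near F, (r_pos H0 <= r_pos (H x))%N.
Proof.
move=> cH h0 hH; have [V eV] := r_pos_basis h0.
have cG : mcvg (fun x => V *m H x *m V ^t*) 1%:M.
  rewrite -eV.
  exact: (mcvgM (mcvgM (mcvg_cst V) cH) (mcvg_cst (V ^t*))).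
have e0 : 0 < (r_pos H0).+1%:R^-1 :> K by rewrite invr_gt0 ltr0Sn.
have nG : \forall x \near F, forall i j,
   `|(1%:M : 'M[K]_(r_pos H0)) i j - (V *m H x *m V ^t*) i j| <= (r_pos H0).+1%:R^-1.
  apply: filter_forall => i; apply: filter_forall => j.
  move/cvgrPdist_le: (cG i j); exact.
near=> x; apply: (leq_r_pos (V := V)); first by near: x.
by apply: posdefmx_near1; [apply: herm_conj|]; near: x.
Unshelve. all: by end_near. Qed.

Lemma near_r_neg n (H : T -> 'M[K]_n) H0 : mcvg H H0 -> H0 \is hermsymmx ->
  (\forall x \near F, H x \is hermsymmx) ->
  \forall x \near F, (r_neg H0 <= r_neg (H x))%N.
Proof.
move=> cH h0 hH.
have hH' : \forall x \near F, - H x \is hermsymmx.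
  by apply: filterS hH => x; exact: hermN.
have := near_r_pos (mcvgN cH) (hermN h0) hH'.
by apply: filterS2 hH => x hx; rewrite !r_negE.
Qed.

(** The inertia of a nondegenerate Hermitian matrix is locally constant. *)
Lemma near_r_neg_eq n (H : T -> 'M[K]_n) H0 : mcvg H H0 -> H0 \is hermsymmx ->
  H0 \in unitmx -> (\forall x \near F, H x \is hermsymmx) ->
  \forall x \near F, r_neg (H x) = r_neg H0.
Proof.
move=> cH h0 u0 hH; near=> x.
have hx : H x \is hermsymmx by near: x.
have px : (r_pos H0 <= r_pos (H x))%N by near: x; exact: near_r_pos.
have nx : (r_neg H0 <= r_neg (H x))%N by near: x; exact: near_r_neg.
have := r_total hx; have := r_total h0; rewrite (r_zeroE h0) mxrank_unit // subnn.
move: px nx; move: (r_pos (H x)) (r_neg (H x)) (r_zero (H x)) => p q z.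
by clear; lia.
Unshelve. all: by end_near. Qed.

End Entrywise.
Arguments mcvg {R T} F {m n} H H0.
Arguments mcvg_cst {R T F FF m n} H0.

(** * Decoupling a Hermitian pencil *)

Section Pencil.
Context {C : numClosedFieldType}.

Lemma posdef_compress k n (B : 'M[C]_(k, n)) (W : 'M[C]_n) :
  posdefmx W -> row_free B -> posdefmx (B *m W *m B ^t*).
Proof.
move=> [hW pW] fB; split; first exact: herm_conj.
move=> x x0; have := pW (B ^t* *m x).
rewrite adjM trmxCK !mulmxA; apply; apply: contra x0 => /eqP e.
have : x ^t* *m B == 0 by rewrite -[B]trmxCK -adjM e adj0.
by rewrite mulmx_free_eq0 // => /eqP e'; rewrite -[x]trmxCK e' adj0.
Qed.

(** Simultaneous diagonalisation of two Hermitian forms, one of them positive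
    definite. *)
Lemma simdiag n (T W : 'M[C]_n) : T \is hermsymmx -> posdefmx W ->
  exists Z : 'M[C]_n, exists d : 'rV[C]_n,
    [/\ (forall i, d 0 i \is Num.real), Z ^t* *m W *m Z = 1%:M
      & Z ^t* *m T *m Z = diag_mx d].
Proof.
move=> hT pW; have hW := pW.1.
have e : r_pos W = n.
  have := r_total hW; have : (n <= r_pos W)%N.
    by apply: (leq_r_pos (V := 1%:M)) => //; rewrite mul1mx adj1 mulmx1.
  by lia.
have := r_pos_basis hW; rewrite e => -[V eV].
have [U [d [UU UU' dr eT]]] := herm_spectral (herm_conj V hT).
exists (V ^t* *m U ^t*), d; split=> //.
  by rewrite adjM !trmxCK !mulmxA -2!(mulmxA U) eV mulmx1.
rewrite adjM !trmxCK !mulmxA -2!(mulmxA U) eT !mulmxA UU mul1mx.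
by rewrite -mulmxA UU mulmx1.
Qed.

(** The pseudo-inverse [Lp] of a Hermitian matrix, and the orthogonal projector
    [P] onto its kernel. *)
Lemma herm_pinv m (L : 'M[C]_m) : L \is hermsymmx ->
  exists Lp P : 'M[C]_m,
    [/\ Lp ^t* = Lp, P ^t* = P, P *m P = P, L *m P = 0 & L *m Lp = 1%:M - P] /\
    [/\ Lp *m P = 0, \rank P = r_zero L,
        r_pos (L + 2%:R *: P) = (r_pos L + r_zero L)%N
      & r_neg (L - 2%:R *: P) = (r_neg L + r_zero L)%N].
Proof.
move=> hL; have [U [d [UU UU' dr eL]]] := herm_spectral hL.
(* The functional calculus of [L]. *)
pose D (f : C -> C) := U ^t* *m diag_mx (map_mx f d) *m U.
have DM f g : D f *m D g = D (fun z => f z * g z).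
  rewrite /D !mulmxA -[_ *m U *m U ^t*]mulmxA UU mulmx1 -[_ *m _ *m diag_mx _]mulmxA.
  by rewrite mulmx_diag; congr (_ *m diag_mx _ *m _); apply/rowP => i; rewrite !mxE.
have DE f g : (forall z, z \is Num.real -> f z = g z) -> D f = D g.
  move=> fg; congr (_ *m diag_mx _ *m _); apply/rowP => i; rewrite !mxE.
  exact: fg.
have DA f : (forall z, z \is Num.real -> f z \is Num.real) -> (D f) ^t* = D f.
  move=> fr; rewrite /D !adjM trmxCK tr_diag_mx map_diag_mx mulmxA.
  congr (_ *m diag_mx _ *m _); apply/rowP => i; rewrite !mxE.
  by apply/CrealP/fr.
have eLD : L = D id by rewrite /D (_ : map_mx id d = d) //; apply/rowP => i; rewrite mxE.
have D0 : D (fun=> 0) = 0.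
  have -> : D (fun=> 0) = U ^t* *m diag_mx 0 *m U.
    by congr (_ *m diag_mx _ *m _); apply/rowP=> i; rewrite !mxE.
  by rewrite linear0 mulmx0 mul0mx.
have Dlin f g (a : C) : D f + a *: D g = D (fun z => f z + a * g z).
  rewrite /D scalemxAl scalemxAr -mulmxDl -mulmxDr -linearZ -linearD.
  by congr (_ *m diag_mx _ *m _); apply/rowP => i; rewrite !mxE.
have D1 : D (fun=> 1) = 1%:M.
  have -> : D (fun=> 1) = U ^t* *m diag_mx (const_mx 1) *m U.
    by congr (_ *m diag_mx _ *m _); apply/rowP=> i; rewrite !mxE.
  by rewrite diag_const_mx mulmx1.
pose z0 (z : C) : C := if z == 0 then 1 else 0.
have rpD f : r_pos (D f) = #|[pred i | 0 < f (d 0 i)]|.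
  by rewrite /r_pos count_mx_eigenvalues //; apply: eq_card => i; rewrite !inE mxE.
have rnD f : r_neg (D f) = #|[pred i | f (d 0 i) < 0]|.
  by rewrite /r_neg count_mx_eigenvalues //; apply: eq_card => i; rewrite !inE mxE.
have rzL : r_zero L = #|[pred i | d 0 i == 0]|.
  by rewrite /r_zero eL count_mx_eigenvalues.
have z0r z : z0 z \is Num.real by rewrite /z0; case: ifP; rewrite ?real0 ?real1.
have dP : \rank (D z0) = r_zero L.
  rewrite rzL /D mxrankMfree ?row_free_unit; last by have [] := mulmx1_unit UU.
  rewrite -[LHS]mxrank_tr trmx_mul mxrankMfree; last first.
    by rewrite row_free_unit unitmx_tr; have [] := mulmx1_unit UU.
  rewrite mxrank_tr rank_diag_mx; apply: eq_card => i.
  by rewrite !inE mxE /z0; case: (d 0 i == 0); rewrite ?oner_eq0 ?eqxx.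
exists (D (fun z => z^-1)), (D z0); do !split=> //.
- by apply: DA => z; rewrite realV.
- by apply: DA => z _.
- rewrite DM; apply: DE => z _; rewrite /z0; case: eqP => _.
    by rewrite mulr1.
  by rewrite mulr0.
- rewrite eLD DM -D0; apply: DE => z _; rewrite /z0; case: eqP => [->|_];
  by rewrite ?mul0r ?mulr0.
- rewrite eLD DM -D1 -scaleN1r Dlin; apply: DE => z _; rewrite /z0.
  case: eqP => [->|/eqP nz]; rewrite ?mul0r ?mulr1 ?subrr //.
  by rewrite mulfV // mulr0 addr0.
- rewrite DM -D0; apply: DE => z _; rewrite /z0; case: eqP => [->|_];
  by rewrite ?invr0 ?mul0r ?mulr0.
- rewrite {1 2}eLD rzL Dlin !rpD -cardUI [#|predI _ _|]eq_card0 ?addn0; last first.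
    by move=> i; rewrite !inE; case: (eqVneq (d 0 i) 0) => [->|_]; rewrite ?ltxx ?andbF.
  apply: eq_card => i; rewrite !inE /z0; case: (eqVneq (d 0 i) 0) => [->|_].
    by rewrite mulr1 add0r ltr0n orbT.
  by rewrite mulr0 addr0 orbF.
- rewrite {1 2}eLD rzL -scaleNr Dlin !rnD -cardUI [#|predI _ _|]eq_card0 ?addn0; last first.
    by move=> i; rewrite !inE; case: (eqVneq (d 0 i) 0) => [->|_]; rewrite ?ltxx ?andbF.
  apply: eq_card => i; rewrite !inE /z0; case: (eqVneq (d 0 i) 0) => [->|_].
    by rewrite mulr1 add0r oppr_lt0 ltr0n orbT.
  by rewrite mulr0 addr0 orbF.
Qed.

(** The column space of [A] is the annihilator of its left kernel, by equality of
    dimensions. *)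
Lemma kermx_ann m n k (A : 'M[C]_(n, m)) (f : 'M[C]_(n, k)) :
  kermx A *m f = 0 -> exists g, f = A *m g.
Proof.
move=> Kf.
suff /submxP[g eg] : (f^T <= A^T)%MS.
  by exists g^T; rewrite -[f]trmxK eg trmx_mul trmxK.
have sA : (A^T <= kermx (kermx A)^T)%MS.
  by apply/sub_kermxP; rewrite -trmx_mul mulmx_ker trmx0.
have /eqmxP/eqmx_sym eA : (A^T == kermx (kermx A)^T)%MS.
  rewrite -(mxrank_leqif_eq sA) mxrank_ker !mxrank_tr mxrank_ker.
  by rewrite subKn ?rank_leq_row.
by rewrite -eA; apply/sub_kermxP; rewrite -trmx_mul Kf trmx0.
Qed.

Lemma r_pos_diag n (d : 'rV[C]_n) : r_pos (diag_mx d) = #|[pred i | 0 < d 0 i]|.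
Proof.
rewrite /r_pos -[diag_mx d]mulmx1 -[diag_mx d]mul1mx -{1}adj1.
by rewrite count_mx_eigenvalues // adj1 mulmx1.
Qed.

Lemma r_neg_diag n (d : 'rV[C]_n) : r_neg (diag_mx d) = #|[pred i | d 0 i < 0]|.
Proof.
rewrite /r_neg -[diag_mx d]mulmx1 -[diag_mx d]mul1mx -{1}adj1.
by rewrite count_mx_eigenvalues // adj1 mulmx1.
Qed.

(** At [mu] its kernel is made of the pairs (y, w) such that
    (T - mu W) y + Rm^* w = 0 and Rm y = L w. *)
Definition pencil n m (T W : 'M[C]_n) (Rm : 'M[C]_(m, n)) (L : 'M[C]_m) (mu : C) :
    'M[C]_(n + m) :=
  block_mx (T - mu *: W) (Rm ^t*) Rm (- L).

Lemma herm_pencil n m (T W : 'M[C]_n) (Rm : 'M[C]_(m, n)) (L : 'M[C]_m) (mu : C) :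
  T \is hermsymmx -> W \is hermsymmx -> L \is hermsymmx -> mu \is Num.real ->
  pencil T W Rm L mu \is hermsymmx.
Proof.
move=> /hermP eT /hermP eW /hermP eL /CrealP eM; apply/hermP.
by rewrite adj_block adjB adjZ adjN eT eW eL eM trmxCK.
Qed.

(** A congruence that decouples the pencil.  The first block of columns lies
    over the solutions of [P *m Rm *m y = 0]; the second one replaces the
    kernel of [L] by a definite plane, of sign [- s], taken inside the
    hyperbolic planes that this kernel spans with a complement. *)
Lemma pencil_compress n m q (E : 'M[C]_n) (Rm : 'M[C]_(m, n)) (L Lp P : 'M[C]_m)
    (Z : 'M[C]_(n, q)) (Rp : 'M[C]_(n, m)) (s : C) :
  E ^t* = E -> L ^t* = L -> Lp ^t* = Lp -> P ^t* = P -> P *m P = P ->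
  L *m P = 0 -> L *m Lp = 1%:M - P ->
  P *m Rm *m Z = 0 -> Rm *m Rp = 1%:M -> s^* = s -> s * s = 1 ->
  let H := block_mx E (Rm ^t*) Rm (- L) in
  exists V : 'M[C]_(q + m, n + m),
    V *m H *m V ^t* =
    block_mx (Z ^t* *m (E + Rm ^t* *m Lp *m Rm) *m Z) 0 0 (- (L + (2%:R * s) *: P)).
Proof.
move=> eE eL eLp eP PP LP LLp PRZ RRp es ss H.
have PL : P *m L = 0 by rewrite -eP -eL -adjM LP adj0.
set E' := E + Rm ^t* *m Lp *m Rm.
have eE' : E' ^t* = E' by rewrite /E' adjD !adjM trmxCK eE eLp mulmxA.
have ZRP : Z ^t* *m Rm ^t* *m P = 0.
  by rewrite -mulmxA -eP -!adjM PRZ adj0.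
have RpR : Rp ^t* *m Rm ^t* = 1%:M by rewrite -adjM RRp adj1.
(* [g1] and [g2] add to the columns vectors of 0 + ker L, an isotropic space
   that pairs only with the complement [a2]; they cancel the coupling of the two
   blocks of columns and the term in [E] of the second one. *)
pose g1 := - (Rp ^t* *m E' *m Z).
pose g2 := (s / 2%:R) *: (Rp ^t* *m E *m Rp *m P).
pose a2 := - s *: (Rp *m P).
pose b1 := Lp *m Rm *m Z + P *m g1.
pose b2 := 1%:M + P *m g2.
have H1 : H *m col_mx Z b1 = col_mx (E' *m Z + Rm ^t* *m P *m g1) 0.
  rewrite mul_block_col /b1; congr col_mx.
    by rewrite /E' mulmxDl mulmxDr !mulmxA addrA.
  rewrite mulNmx mulmxDr !mulmxA LP LLp mul0mx addr0 mulmxBl mul1mx mulmxBl PRZ.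
  by rewrite subr0 subrr.
have H2 : H *m col_mx a2 b2 =
    col_mx (- s *: (E *m Rp *m P) + Rm ^t* + Rm ^t* *m P *m g2) (- s *: P - L).
  rewrite mul_block_col /a2 /b2; congr col_mx.
    by rewrite mulmxDr mulmx1 -scalemxAr !mulmxA addrA.
  by rewrite -scalemxAr mulmxA RRp mul1mx mulNmx mulmxDr mulmx1 !mulmxA LP mul0mx addr0.
have G11 : (col_mx Z b1) ^t* *m (H *m col_mx Z b1) = Z ^t* *m E' *m Z.
  by rewrite H1 adj_col mul_row_col mulmx0 addr0 mulmxDr !mulmxA ZRP mul0mx addr0.
have G21 : (col_mx a2 b2) ^t* *m (H *m col_mx Z b1) = 0.
  rewrite H1 adj_col mul_row_col mulmx0 addr0 /a2 adjZ adjM eP -scalemxAl.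
  rewrite mulmxDr !mulmxA -[P *m _ *m Rm ^t*]mulmxA RpR mulmx1 PP /g1 mulmxN.
  by rewrite !mulmxA subrr scaler0.
have eH : H ^t* = H by rewrite adj_block eE adjN eL trmxCK.
have G12 : (col_mx Z b1) ^t* *m (H *m col_mx a2 b2) = 0.
  by rewrite -[RHS]adj0 -G21 !adjM trmxCK eH mulmxA.
have eg2 : g2 ^t* = (s / 2%:R) *: (P *m Rp ^t* *m E *m Rp).
  by rewrite /g2 adjZ !adjM eP eE trmxCK rmorphM /= es fmorphV rmorph_nat !mulmxA.
have G22 : (col_mx a2 b2) ^t* *m (H *m col_mx a2 b2) = - (L + (2%:R * s) *: P).
  pose X := P *m Rp ^t* *m E *m Rp *m P.
  have Pg2 : P *m g2 = (s / 2%:R) *: X by rewrite -scalemxAr !mulmxA.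
  have g2P : g2 ^t* *m P = (s / 2%:R) *: X by rewrite eg2 -scalemxAl.
  have F1 : P *m Rp ^t* *m (- s *: (E *m Rp *m P) + Rm ^t* + Rm ^t* *m P *m g2)
      = - s *: X + P + (s / 2%:R) *: X.
    rewrite !mulmxDr -scalemxAr !mulmxA -[P *m _ *m Rm ^t*]mulmxA RpR mulmx1 PP.
    by rewrite -Pg2.
  have F2 : b2 ^t* *m (- s *: P - L) = - s *: P - L - (s * (s / 2%:R)) *: X.
    rewrite /b2 adjD adj1 adjM eP mulmxDl mul1mx; congr (_ + _).
    rewrite g2P -scalemxAl mulmxBr -scalemxAr.
    have -> : X *m P = X by rewrite /X -mulmxA PP.
    have -> : X *m L = 0 by rewrite /X -mulmxA PL mulmx0.
    by rewrite subr0 scalerA mulrN scaleNr mulrC.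
  rewrite H2 adj_col mul_row_col F2 /a2 adjZ adjM eP -scalemxAl rmorphN /= es F1.
  have s2 : s * (s / 2%:R) = 2%:R^-1 by rewrite mulrA ss mul1r.
  rewrite !scalerDr !scalerA mulrNN ss scale1r mulNr s2.
  by apply/matrixP => i j; rewrite !mxE; field.
exists ((row_mx (col_mx Z b1) (col_mx a2 b2)) ^t*).
rewrite trmxCK -mulmxA mul_mx_row adj_row mul_col_row.
by rewrite G11 G12 G21 G22.
Qed.

End Pencil.

(** * The spectrum of a Hermitian pencil *)

Section Spectrum.
Context {C : numClosedFieldType}.

(** The pseudo-inverse of [L] eliminates w: y has to lie in the kernel V of
    [P *m Rm], [P] being the projector onto ker L, and the pencil becomes the
    form T + Rm^* Lp Rm on V, because the vectors Rm^* P g are exactly those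
    orthogonal to V.  [Z] is an eigenbasis of V for this form, orthonormal for
    [W].  For the inertia, the two decouplings of [pencil_compress] bound both
    indices from below by numbers that add up to the full size as soon as [mu] is
    not an eigenvalue; so the bounds are attained. *)
Theorem pencil_spectrum n m (T W : 'M[C]_n) (Rm : 'M[C]_(m, n)) (L : 'M[C]_m) :
  T \is hermsymmx -> posdefmx W -> L \is hermsymmx -> row_free Rm ->
  exists q (Z : 'M[C]_(n, q)) (d : 'rV[C]_q),
    [/\ (q + r_zero L = n)%N, (forall i, d 0 i \is Num.real),
        Z ^t* *m W *m Z = 1%:M,
        (forall (lam : C) (y : 'cV[C]_n),
           (exists2 w, T *m y + Rm ^t* *m w = lam *: (W *m y) & Rm *m y = L *m w)
           <-> (exists2 x, y = Z *m x & diag_mx d *m x = lam *: x))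
      & (forall mu : C, mu \is Num.real ->
           (pencil T W Rm L mu \in unitmx) = [forall i, d 0 i != mu] /\
           (pencil T W Rm L mu \in unitmx ->
            r_neg (pencil T W Rm L mu) =
             (#|[pred i | (d 0 i < mu)%R]| + r_pos L + r_zero L)%N))].
Proof.
move=> hT pW hL fR; have hW := pW.1.
have [Lp [P [[eLp eP PP LP LLp] [LpP rP rpL rnL]]]] := herm_pinv hL.
have eL : L ^t* = L by apply/hermP.
have eT : T ^t* = T by apply/hermP.
have eW : W ^t* = W by apply/hermP.
have PL : P *m L = 0 by rewrite -eP -eL -adjM LP adj0.
have LpL : Lp *m L = 1%:M - P by rewrite -eLp -eL -adjM LLp adjB adj1 eP.
have RRp : Rm *m pinvmx Rm = 1%:M by exact: mulmxVp.
set Rp := pinvmx Rm in RRp.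
pose K := kermx (Rm ^t* *m P).
pose B := row_base K.
(* [B1] is a basis of V, written in rows. *)
have [q [eq [B1 [eB fB]]]] : exists q, (q + r_zero L = n)%N /\
   exists B1 : 'M[C]_(q, n), (B1 :=: K)%MS /\ row_free B1.
  exists (\rank K); split; last by exists B; split; [exact: eq_row_base|exact: row_base_free].
  rewrite mxrank_ker -rP.
  have -> : \rank (Rm ^t* *m P) = \rank P.
    by rewrite -mxrank_adj adjM trmxCK eP mxrankMfree.
  rewrite subnK //; apply: leq_trans (rank_leq_col P) _.
  by rewrite -(eqP fR) rank_leq_col.
have [T' eTT] : {T' | T' = T + Rm ^t* *m Lp *m Rm} by eexists.
have eT' : T' ^t* = T' by rewrite eTT adjD !adjM trmxCK eT eLp mulmxA.
have hT' : T' \is hermsymmx by apply/hermP.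
have [Z1 [d [dr ZW ZT]]] := simdiag (herm_conj B1 hT') (posdef_compress pW fB).
have [Z eZZ] : {Z | Z = B1 ^t* *m Z1} by eexists.
have eZ (A : 'M[C]_n) : Z ^t* *m A *m Z = Z1 ^t* *m (B1 *m A *m B1 ^t*) *m Z1.
  by rewrite eZZ adjM trmxCK !mulmxA.
have ZW1 : Z ^t* *m W *m Z = 1%:M by rewrite eZ.
have ZTd : Z ^t* *m T' *m Z = diag_mx d by rewrite eZ.
have BRP : B1 *m Rm ^t* *m P = 0.
  by rewrite -mulmxA; apply/sub_kermxP; rewrite eB.
have PRZ : P *m Rm *m Z = 0.
  by rewrite eZZ mulmxA -eP -[Rm]trmxCK -!adjM mulmxA BRP adj0 mul0mx.
have uZ1 : Z1 \in unitmx by have [] := mulmx1_unit ZW.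
have inZ (y : 'cV[C]_n) : P *m Rm *m y = 0 -> exists x, y = Z *m x.
  move=> PRy; have : (y ^t* <= B1)%MS.
    rewrite eB; apply/sub_kermxP.
    by rewrite -eP -adjM -adjM PRy adj0.
  case/submxP => x ex; exists (invmx Z1 *m x ^t*).
  by rewrite eZZ -mulmxA mulKVmx // -adjM -ex trmxCK.
have annZ (f : 'cV[C]_n) : Z ^t* *m f = 0 -> exists g, f = Rm ^t* *m P *m g.
  rewrite eZZ adjM trmxCK -mulmxA => Zf.
  have Bf : B1 *m f = 0.
    have uZ1' : Z1 ^t* \in unitmx by rewrite unitmx_adj.
    by rewrite -[LHS](mulKmx uZ1') Zf mulmx0.
  apply: kermx_ann; rewrite -/K; have /submxP[G ->] : (K <= B1)%MS by rewrite eB.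
  by rewrite -mulmxA Bf mulmx0.
have solE (lam : C) (y : 'cV[C]_n) :
    (exists2 w, T *m y + Rm ^t* *m w = lam *: (W *m y) & Rm *m y = L *m w)
    <-> (exists2 x, y = Z *m x & diag_mx d *m x = lam *: x).
  split=> [[w e1 e2]|[x ey ex]].
    have [x ex] : exists x, y = Z *m x.
      by apply: inZ; rewrite -mulmxA e2 mulmxA PL mul0mx.
    exists x => //.
    have e3 : Rm ^t* *m w = Rm ^t* *m Lp *m Rm *m y + Rm ^t* *m P *m w.
      by rewrite -2!mulmxA e2 [Lp *m _]mulmxA LpL mulmxBl mul1mx mulmxBr -[in X in _ + X]mulmxA subrK.
    have ZRP : Z ^t* *m Rm ^t* *m P = 0 by rewrite -mulmxA -eP -!adjM PRZ adj0.
    have : Z ^t* *m (T' *m y + Rm ^t* *m P *m w) = Z ^t* *m (lam *: (W *m y)).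
      by rewrite -e1 e3 eTT mulmxDl addrA.
    rewrite mulmxDr !mulmxA ZRP mul0mx addr0 -scalemxAr ex !mulmxA ZTd.
    by rewrite ZW1 mul1mx.
  have : Z ^t* *m (lam *: (W *m y) - T' *m y) = 0.
    by rewrite mulmxBr -scalemxAr !mulmxA ey !mulmxA ZTd ZW1 mul1mx ex subrr.
  case/annZ=> g eg; exists (Lp *m Rm *m y + P *m g).
    by rewrite mulmxDr !mulmxA -eg eTT mulmxDl addrA addrC subrK.
  rewrite mulmxDr !mulmxA LP mul0mx addr0 LLp mulmxBl mul1mx mulmxBl.
  by rewrite ey [P *m Rm *m _]mulmxA PRZ mul0mx subr0.
(* The pencil has been reduced; what remains is its inertia. *)
exists q, Z, d; split=> // mu mur.
suff main : [forall i, d 0 i != mu] -> pencil T W Rm L mu \in unitmx /\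
    r_neg (pencil T W Rm L mu) =
      (#|[pred i | (d 0 i < mu)%R]| + r_pos L + r_zero L)%N.
  suff uE : pencil T W Rm L mu \in unitmx -> [forall i, d 0 i != mu].
    split; last by move=> /uE /main[].
    by apply/idP/idP=> [/uE //|/main[]].
  move=> uH; apply/forallP => i; apply/eqP => di.
  (* An eigenvalue gives a vector in the kernel of the pencil. *)
  pose x : 'cV[C]_q := delta_mx i 0.
  have [w e1 e2] : exists2 w, T *m (Z *m x) + Rm ^t* *m w
      = mu *: (W *m (Z *m x)) & Rm *m (Z *m x) = L *m w.
    apply/solE; exists x => //; apply/colP => j.
    rewrite mul_diag_mx !mxE; case: eqP => [->|_]; last by rewrite !mulr0.
    by rewrite di.
  have : pencil T W Rm L mu *m col_mx (Z *m x) w = 0.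
    rewrite mul_block_col mulmxBl -scalemxAl addrAC e1 e2 mulNmx !subrr.
    exact: col_mx0.
  move=> /(congr1 (mulmx (invmx (pencil T W Rm L mu)))); rewrite mulKmx // mulmx0.
  rewrite -col_mx0 => /eq_col_mx[Ze _].
  have := congr1 (fun u => Z ^t* *m W *m u) Ze.
  rewrite mulmx0 mulmxA ZW1 mul1mx => /colP/(_ i); rewrite !mxE !eqxx => /eqP.
  by rewrite oner_eq0.
move=> /forallP dmu.
have hH : pencil T W Rm L mu \is hermsymmx by exact: herm_pencil.
have eE : (T - mu *: W) ^t* = T - mu *: W.
  by rewrite adjB adjZ eT eW (CrealP mur).
have eF : Z ^t* *m (T - mu *: W + Rm ^t* *m Lp *m Rm) *m Z
    = diag_mx (\row_i (d 0 i - mu)).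
  rewrite addrAC mulmxBr mulmxBl -eTT ZTd -scalemxAr -scalemxAl ZW1 scalemx1.
  by apply/matrixP => i j; rewrite !mxE -mulrnBl.
have hD : diag_mx (\row_i (d 0 i - mu)) \is hermsymmx.
  apply/hermP; rewrite tr_diag_mx map_diag_mx; congr diag_mx.
  by apply/rowP => i; rewrite !mxE rmorphB /= (CrealP (dr i)) (CrealP mur).
have hP : P \is hermsymmx by apply/hermP.
have h2P : 2%:R *: P \is hermsymmx by apply/hermP; rewrite adjZ rmorph_nat eP.
have hneg := hermN (hermD hL h2P).
have hpos : - (L - 2%:R *: P) \is hermsymmx by exact: hermN (hermD hL (hermN h2P)).
have [V eV] := pencil_compress eE eL eLp eP PP LP LLp PRZ RRp (rmorph1 _) (mulr1 1).
have eN1 : (- 1 : C)^* = - 1 by rewrite rmorphN rmorph1.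
have [V' eV'] := pencil_compress eE eL eLp eP PP LP LLp PRZ RRp eN1
  (etrans (mulrNN _ _) (mulr1 1)).
have nH : (#|[pred i | (d 0 i < mu)%R]| + (r_pos L + r_zero L) <= r_neg (pencil T W Rm L mu))%N.
  apply: leq_trans (r_neg_compress V hH); rewrite eV eF mulr1.
  apply: leq_trans (r_neg_block_ge hD hneg).
  rewrite r_neg_diag -rpL (r_posE (hermD hL h2P)) leq_add2r.
  by rewrite eq_leq //; apply: eq_card => i; rewrite !inE mxE subr_lt0.
have pH : (#|[pred i | (mu < d 0 i)%R]| + (r_neg L + r_zero L) <= r_pos (pencil T W Rm L mu))%N.
  apply: leq_trans (r_pos_compress V' hH); rewrite eV' eF mulrN1 scaleNr.
  apply: leq_trans (r_pos_block_ge hD hpos).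
  rewrite r_pos_diag -rnL (r_negE (hermD hL (hermN h2P))) leq_add2r.
  by rewrite eq_leq //; apply: eq_card => i; rewrite !inE mxE subr_gt0.
have cq : (#|[pred i | (d 0 i < mu)%R]| + #|[pred i | (mu < d 0 i)%R]| = q)%N.
  apply: etrans (card_ord q); rewrite -cardUI [#|predI _ _|]eq_card0 ?addn0; last first.
    by move=> i; rewrite !inE; apply/negP => /andP[/lt_trans h /h]; rewrite ltxx.
  by apply: eq_card => i; rewrite !inE -real_neqr_lt ?dmu.
have tH := r_total hH; have tL := r_total hL.
have [zH nE] : r_zero (pencil T W Rm L mu) = 0%N /\
    r_neg (pencil T W Rm L mu) = (#|[pred i | (d 0 i < mu)%R]| + r_pos L + r_zero L)%N.
  move: nH pH cq tH tL eq; clear.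
  move: (r_zero (pencil _ _ _ _ _)) (r_neg (pencil _ _ _ _ _)) (r_pos (pencil _ _ _ _ _)).
  by move=> z g p; lia.
split=> //; move: zH; rewrite (r_zeroE hH) => /eqP; rewrite subn_eq0 => rk.
by rewrite -row_free_unit -row_leq_rank.
Qed.

End Spectrum.

(** * From the difference equation to a pencil *)

Section Reduction.
Context {R : realType} {d N' : nat}.
Local Notation K := (cplx R).
Local Notation N := N'.+1.
Local Notation n := (N * d)%N.

(** The interior values y_1, ..., y_N are stacked into one vector y of C^(N d),
    with y_{i+1} = [ysel i *m y]. *)
Definition ysel (i : 'I_N) : 'M[K]_(d, n) :=
  \matrix_(a, b) (mxvec_index i a == b)%:R.

Lemma mxvec_index_inj (i j : 'I_N) (a b : 'I_d) :
  (mxvec_index i a == mxvec_index j b) = (i == j) && (a == b).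
Proof.
have [g gK _] := curry_mxvec_bij N d.
apply/eqP/andP => [e|[/eqP-> /eqP->] //].
have := gK (i, a); have := gK (j, b); rewrite !inE /= e => /(_ isT) -> /(_ isT).
by case=> -> ->.
Qed.

Lemma ysel_adjK (i j : 'I_N) :
  ysel i *m (ysel j) ^t* = (i == j)%:R *: 1%:M.
Proof.
apply/matrixP => a b; rewrite !mxE (bigD1 (mxvec_index i a)) //= !mxE eqxx mul1r.
rewrite big1 ?addr0 => [|c /negPf nc]; last by rewrite !mxE eq_sym nc mul0r.
rewrite rmorph_nat mxvec_index_inj [b == a]eq_sym [j == i]eq_sym.
by case: (i == j); case: (a == b); rewrite ?(mulr0, mul0r, mulr1).
Qed.

Lemma ysel_sum : \sum_i (ysel i) ^t* *m ysel i = 1%:M.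
Proof.
apply/matrixP => b c; rewrite summxE; case/mxvec_indexP: b => i a.
rewrite (bigD1 i) //= big1 ?addr0 => [|j /negPf nj]; last first.
  rewrite mxE big1 // => e _; rewrite !mxE mxvec_index_inj nj /= rmorph0 mul0r //.
rewrite mxE (bigD1 a) //= big1 ?addr0 => [|e /negPf ne]; last first.
  by rewrite !mxE mxvec_index_inj ne andbF rmorph0 mul0r.
by rewrite !mxE eqxx rmorph1 mul1r.
Qed.

Lemma ysel_ext (y z : 'cV[K]_n) : (forall i, ysel i *m y = ysel i *m z) -> y = z.
Proof.
move=> e; rewrite -[y]mul1mx -[z]mul1mx -ysel_sum !mulmx_suml.
by apply: eq_bigr => i _; rewrite -!mulmxA e.
Qed.

Variable omega : Omega R d N.

(* The rows of y_{j+1} and of y_j; those of y_{N+1} and of y_0 are not among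
   the unknowns and are replaced by 0. *)
Definition ynext (j : 'I_N.+1) : 'M[K]_(d, n) :=
  if unlift ord_max j is Some i then ysel i else 0.
Definition yprev (j : 'I_N.+1) : 'M[K]_(d, n) :=
  if unlift ord0 j is Some i then ysel i else 0.

(* At j = 0 and j = N the quasi-difference is an independent unknown, not a
   function of the interior values. *)
Definition inner (j : 'I_N.+1) : bool := (j != ord0) && (j != ord_max).

Definition inner_Pc (j : 'I_N.+1) : 'M[K]_d := if inner j then Pc omega j else 0.

(** The Jacobi matrix of the equation with y_0 and y_{N+1} discarded, written
    as a sum of squares. *)
Definition jacobi_mx : 'M[K]_n :=
  \sum_j (ynext j - yprev j) ^t* *m inner_Pc j *m (ynext j - yprev j)
  + \sum_i (ysel i) ^t* *m Qc omega i *m ysel i.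

Definition weight_mx : 'M[K]_n := \sum_i (ysel i) ^t* *m Wc omega i *m ysel i.

(** The trace of a sequence on the boundary, (- y_1, y_N). *)
Definition trace_mx : 'M[K]_(d + d, n) := col_mx (- ysel ord0) (ysel ord_max).

Lemma Pc_herm j : (Pc omega j) ^t* = Pc omega j.
Proof. by rewrite /Pc adj_inv; congr invmx; apply/hermP/Pinv_herm. Qed.

Lemma jacobi_mx_herm : jacobi_mx \is hermsymmx.
Proof.
apply/hermP; rewrite adjD !adj_sum; congr (_ + _); apply: eq_bigr => i _.
  rewrite !adjM trmxCK mulmxA; congr (_ *m _ *m _).
  by rewrite /inner_Pc; case: ifP => _; rewrite ?Pc_herm ?adj0.
by rewrite !adjM trmxCK mulmxA; congr (_ *m _ *m _); apply/hermP/Qc_herm.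
Qed.

Lemma weight_mx_posdef : posdefmx weight_mx.
Proof.
split.
  apply/hermP; rewrite adj_sum; apply: eq_bigr => i _.
  rewrite !adjM trmxCK mulmxA; congr (_ *m _ *m _); apply/hermP.
  by case: (Wc_posdef omega i).
move=> x x0; rewrite /weight_mx mulmx_sumr mulmx_suml summxE.
have ex i : x ^t* *m ((ysel i) ^t* *m Wc omega i *m ysel i) *m x
    = (ysel i *m x) ^t* *m Wc omega i *m (ysel i *m x) by rewrite adjM !mulmxA.
have pos i : ysel i *m x != 0 ->
    0 < (x ^t* *m ((ysel i) ^t* *m Wc omega i *m ysel i) *m x) ord0 ord0.
  by move=> xi; rewrite ex; have [_ /(_ _ xi)] := Wc_posdef omega i.
have ge0 i : 0 <= (x ^t* *m ((ysel i) ^t* *m Wc omega i *m ysel i) *m x) ord0 ord0.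
  have [e|/pos/ltW //] := eqVneq (ysel i *m x) 0.
  by rewrite ex e mulmx0 mxE.
have /existsP[i xi] : [exists i, ysel i *m x != 0].
  apply: contraR x0 => /existsPn h; apply/eqP/ysel_ext => i.
  by rewrite mulmx0; apply/eqP; move: (h i); rewrite negbK.
by rewrite (bigD1 i) //= ltr_pwDl ?pos // sumr_ge0.
Qed.

Lemma ysel_jacobi_mx i : ysel i *m jacobi_mx =
  inner_Pc (widen_ord (leqnSn N) i)
    *m (ynext (widen_ord (leqnSn N) i) - yprev (widen_ord (leqnSn N) i))
  - inner_Pc (lift ord0 i) *m (ynext (lift ord0 i) - yprev (lift ord0 i))
  + Qc omega i *m ysel i.
Proof.
have yn j : ysel i *m (ynext j) ^t* = (j == widen_ord (leqnSn N) i)%:R *: 1%:M.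
  rewrite /ynext; case: unliftP => [k ->|->].
    rewrite ysel_adjK; congr (_%:R *: _).
    by rewrite -!val_eqE /= /bump leqNgt ltn_ord add0n eq_sym.
  rewrite adj0 mulmx0; case: eqP => [/(congr1 val) /= e|_]; last by rewrite scale0r.
  by have := ltn_ord i; rewrite -e ltnn.
have yp j : ysel i *m (yprev j) ^t* = (j == lift ord0 i)%:R *: 1%:M.
  rewrite /yprev; case: unliftP => [k ->|->].
    by rewrite ysel_adjK (inj_eq (@lift_inj _ _)) eq_sym.
  rewrite adj0 mulmx0; case: eqP => [/(congr1 val) //|_]; by rewrite scale0r.
rewrite /jacobi_mx mulmxDr !mulmx_sumr; congr (_ + _); last first.
  rewrite (bigD1 i) //= big1 ?addr0 => [|j /negPf nj].
    by rewrite !mulmxA ysel_adjK eqxx scale1r mul1mx.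
  by rewrite !mulmxA ysel_adjK eq_sym nj scale0r !mul0mx.
have yd j : ysel i *m (ynext j - yprev j) ^t* =
    (j == widen_ord (leqnSn N) i)%:R *: 1%:M - (j == lift ord0 i)%:R *: 1%:M.
  by rewrite adjB mulmxBr yn yp.
have ydP j (A : 'M[K]_(d, n)) : ysel i *m ((ynext j - yprev j) ^t* *m inner_Pc j *m A) =
    (j == widen_ord (leqnSn N) i)%:R *: (inner_Pc j *m A) - (j == lift ord0 i)%:R *: (inner_Pc j *m A).
  by rewrite !mulmxA yd !mulmxBl -!scalemxAl !mul1mx.
under eq_bigr => j _ do rewrite ydP.
rewrite sumrB; congr (_ - _).
  rewrite (bigD1 (widen_ord (leqnSn N) i)) //= eqxx scale1r big1 ?addr0 //.
  by move=> j /negPf ->; rewrite scale0r.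
rewrite (bigD1 (lift ord0 i)) //= eqxx scale1r big1 ?addr0 //.
by move=> j /negPf ->; rewrite scale0r.
Qed.

Lemma ysel_weight_mx i : ysel i *m weight_mx = Wc omega i *m ysel i.
Proof.
rewrite /weight_mx mulmx_sumr (bigD1 i) //= big1 ?addr0 => [|j /negPf nj].
  by rewrite !mulmxA ysel_adjK eqxx scale1r mul1mx.
by rewrite !mulmxA ysel_adjK eq_sym nj scale0r !mul0mx.
Qed.

Definition seq_vec (y : @slseq R d N) : 'cV[K]_n :=
  \sum_i (ysel i) ^t* *m y (lift ord0 (widen_ord (leqnSn N) i)).

Lemma ysel_seq_vec y i : ysel i *m seq_vec y = y (lift ord0 (widen_ord (leqnSn N) i)).
Proof.
rewrite /seq_vec mulmx_sumr (bigD1 i) //= big1 ?addr0 => [|j /negPf nj].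
  by rewrite mulmxA ysel_adjK eqxx scale1r mul1mx.
by rewrite mulmxA ysel_adjK eq_sym nj scale0r mul0mx.
Qed.

Definition bd_vec (y : @slseq R d N) : 'cV[K]_(d + d) :=
  col_mx (sl_quasi_diff omega y ord0) (sl_quasi_diff omega y ord_max).

(** The sequence with given y_1, ..., y_N and given boundary quasi-differences. *)
Definition mk_seq (Y : 'cV[K]_n) (v : 'cV[K]_(d + d)) : @slseq R d N :=
  [ffun k => if unlift ord0 k is Some j then
      if unlift ord_max j is Some i then ysel i *m Y
      else ysel ord_max *m Y + Pinv omega ord_max *m dsubmx v
    else ysel ord0 *m Y - Pinv omega ord0 *m usubmx v].

Lemma mk_seq_in Y v i :
  mk_seq Y v (lift ord0 (widen_ord (leqnSn N) i)) = ysel i *m Y.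
Proof.
rewrite ffunE liftK; case: unliftP => [k /(congr1 val)|/(congr1 val)] /=.
  by rewrite /bump leqNgt ltn_ord add0n => /val_inj ->.
by move=> e; have := ltn_ord i; rewrite e ltnn.
Qed.

Lemma seq_vec_mk Y v : seq_vec (mk_seq Y v) = Y.
Proof. by apply: ysel_ext => i; rewrite ysel_seq_vec mk_seq_in. Qed.

Lemma lift_ord0_widen : lift ord0 (ord0 : 'I_N.+1) = lift ord0 (widen_ord (leqnSn N) ord0).
Proof. exact: val_inj. Qed.

Lemma widen_max : widen_ord (leqnSn N.+1) ord_max = lift ord0 (widen_ord (leqnSn N) ord_max).
Proof. exact: val_inj. Qed.

(** Together with [seq_vec_mk] and [bd_vec_mk]: sequences correspond linearly to
    their interior values and boundary quasi-differences, as the P_j^{-1} are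
    defined and invertible. *)
Lemma mk_seqK y : mk_seq (seq_vec y) (bd_vec y) = y.
Proof.
have PPc j z : Pinv omega j *m (Pc omega j *m z) = z.
  by rewrite /Pc mulKVmx // Pinv_unit.
apply/ffunP => k; rewrite ffunE; case: unliftP => [j ->|->].
  case: unliftP => [i ej|->].
    rewrite ysel_seq_vec; congr (y (lift _ _)); apply: val_inj; rewrite ej /=.
    by rewrite /bump leqNgt ltn_ord.
  rewrite ysel_seq_vec col_mxKd PPc /fdiff widen_max addrC subrK.
  by congr (y _); apply: val_inj.
rewrite ysel_seq_vec col_mxKu PPc /fdiff lift_ord0_widen subKr.
by congr (y _); apply: val_inj.
Qed.

Lemma bd_vec_mk Y v : bd_vec (mk_seq Y v) = v.
Proof.
rewrite /bd_vec -[v in RHS]vsubmxK; congr col_mx.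
  rewrite /sl_quasi_diff /fdiff lift_ord0_widen mk_seq_in.
  have -> : widen_ord (leqnSn N.+1) ord0 = ord0 :> 'I_N.+2 by apply: val_inj.
  rewrite ffunE unlift_none subKr /Pc mulKmx // Pinv_unit //.
rewrite /sl_quasi_diff /fdiff widen_max mk_seq_in ffunE liftK unlift_none.
by rewrite addrC addKr /Pc mulKmx // Pinv_unit.
Qed.

Hypothesis N'0 : (0 < N')%N.

Lemma ord0_max : (ord0 == ord_max :> 'I_N) = false.
Proof. by apply/negbTE; rewrite -val_eqE /= eq_sym -lt0n. Qed.

Lemma trace_mx_adj : trace_mx *m trace_mx ^t* = 1%:M.
Proof.
rewrite adj_col mul_col_row !adjN !mulmxN !mulNmx opprK !ysel_adjK !eqxx.
by rewrite [ord_max == _]eq_sym ord0_max !scale0r oppr0 scale1r -scalar_mx_block.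
Qed.

Lemma trace_mx_free : row_free trace_mx.
Proof. by rewrite -row_leq_rank mxrank_unitary //; apply/unitarymxP/trace_mx_adj. Qed.

(** Summation by parts: the boundary quasi-differences enter the equation
    through the adjoint of the trace. *)
Lemma sl_equationE lam y : sl_equation omega lam y <->
  jacobi_mx *m seq_vec y - trace_mx ^t* *m bd_vec y = lam *: (weight_mx *m seq_vec y).
Proof.
move: (seq_vec y) (ysel_seq_vec y) => Y ysY.
have Wi i : ysel i *m (lam *: (weight_mx *m Y)) =
    lam *: (Wc omega i *m y (lift ord0 (widen_ord (leqnSn N) i))).
  by rewrite -scalemxAr mulmxA ysel_weight_mx -mulmxA ysY.
have nY j : inner j -> (ynext j - yprev j) *m Y = fdiff y j.
  case/andP=> j0 jm; rewrite mulmxBl /ynext /yprev /fdiff.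
  have [a ea ->] : {a | j = lift ord_max a & unlift ord_max j = Some a}.
    by apply: unlift_some; rewrite eq_sym.
  have [b eb ->] : {b | j = lift ord0 b & unlift ord0 j = Some b}.
    by apply: unlift_some; rewrite eq_sym.
  rewrite !ysY; congr (y _ - y _); apply: val_inj => /=.
    by rewrite ea /= /bump [(N <= a)%N]leqNgt ltn_ord.
  by rewrite eb.
have Pi j : inner_Pc j *m ((ynext j - yprev j) *m Y) =
    if inner j then sl_quasi_diff omega y j else 0.
  by rewrite /inner_Pc; case: ifP => [ij|_]; rewrite ?mul0mx // nY.
have Ri i : ysel i *m (trace_mx ^t* *m bd_vec y) =
    - ((i == ord0)%:R *: sl_quasi_diff omega y ord0)
    + (i == ord_max)%:R *: sl_quasi_diff omega y ord_max.
  rewrite adj_col mul_row_col mulmxDr adjN mulNmx mulmxN !mulmxA !ysel_adjK.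
  by rewrite -!scalemxAl !mul1mx.
have Ti i : ysel i *m (jacobi_mx *m Y - trace_mx ^t* *m bd_vec y) =
    - fdiff (sl_quasi_diff omega y) i
    + Qc omega i *m y (lift ord0 (widen_ord (leqnSn N) i)).
  rewrite mulmxBr mulmxA ysel_jacobi_mx !mulmxDl mulNmx -!mulmxA ysY !Pi Ri.
  rewrite addrAC; congr (_ + _); rewrite /fdiff opprB.
  have -> : inner (widen_ord (leqnSn N) i) = (i != ord0).
    rewrite /inner -!val_eqE /= andb_idr // => _.
    by rewrite neq_ltn (ltn_ord i).
  have -> : inner (lift ord0 i) = (i != ord_max).
    by rewrite /inner -!val_eqE /=.
  have [->|i0] := eqVneq i ord0.
    rewrite ord0_max /= scale0r addr0 opprK scale1r sub0r addrC.
    by congr (sl_quasi_diff _ _ _ - _); apply: val_inj.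
  rewrite /= scale0r oppr0 add0r.
  have [->|im] := eqVneq i ord_max; last by rewrite scale0r subr0.
  rewrite scale1r subr0; congr (_ - sl_quasi_diff _ _ _).
  exact: val_inj.
split=> [eq|eq i].
  by apply: ysel_ext => i; rewrite Ti Wi; exact: eq.
by rewrite /= -Ti -Wi eq.
Qed.

(** The two blocks of the boundary condition once y_0 has been eliminated. *)
Definition Amx (M : 'M[K]_(d + d, (d + d) + (d + d))) := lsubmx M.
Definition Dpair (M : 'M[K]_(d + d, (d + d) + (d + d))) : 'M[K]_(d + d) :=
  row_mx (lsubmx (lsubmx M) *m Pinv omega ord0 + lsubmx (rsubmx M))
         (rsubmx (rsubmx M)).

Lemma boundaryE (M : 'M[K]_(d + d, (d + d) + (d + d))) (y : @slseq R d N) :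
  lsubmx M *m col_mx (- y ord0) (y (widen_ord (leqnSn N.+1) ord_max))
  + rsubmx M *m bd_vec y
  = Amx M *m (trace_mx *m seq_vec y) + Dpair M *m bd_vec y.
Proof.
have y0 : y ord0 = ysel ord0 *m seq_vec y - Pinv omega ord0 *m usubmx (bd_vec y).
  by rewrite -{1}[y]mk_seqK ffunE unlift_none.
rewrite widen_max -ysel_seq_vec y0 opprB /trace_mx mul_col_mx mulNmx.
set u := bd_vec y; set a := ysel ord0 *m _; set b := ysel ord_max *m _.
rewrite /Dpair -[u in RHS]vsubmxK mul_row_col mulmxDl.
rewrite -[lsubmx M in LHS]hsubmxK -[rsubmx M in LHS]hsubmxK -[u in LHS]vsubmxK.
rewrite /Amx -[lsubmx M in X in _ = X + _]hsubmxK !mul_row_col.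
rewrite col_mxKu mulmxBr mulmxN !mulmxA -!addrA addrCA; congr (_ + _).
by rewrite addrCA.
Qed.

End Reduction.

(** * Eigenvalue lists *)

Section EigenvalueList.
Context {R : realType} {d N' : nat}.
Local Notation K := (cplx R).
Local Notation N := N'.+1.
Local Notation n := (N * d)%N.
Local Notation slsq := (@slseq R d N).
Variable omega : Omega R d N.
Hypothesis N'0 : (0 < N')%N.

Lemma multiplicity_dim A lam (V : {vspace slsq}) :
  (forall y, y \in V <-> sl_solution omega A lam y) ->
  multiplicity omega A lam = \dim V.
Proof.
move=> VP; apply/eqP; rewrite eqn_leq; apply/andP; split.
  apply/bigmax_leqP => /= m /asboolP[ys fys sys].
  have <- : \dim <<ys>> = m by move/eqP: fys; rewrite size_tuple.
  by apply: dimvS; apply/span_subvP => y /sys /VP.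
have dV : (\dim V < (\dim {: slsq}).+1)%N by rewrite ltnS dimvS // subvf.
apply: (@leq_bigmax_cond _ _ (fun m : 'I_(\dim {: slsq}).+1 => m : nat) (Ordinal dV)).
apply/asboolP; exists (vbasis V); first exact: (basis_free (vbasisP V)).
by move=> y /vbasis_mem /VP.
Qed.

Lemma bc_class_repr (A : bc R d) M : is_bc_class M A ->
  exists2 U : 'M[K]_(d + d), U \in unitmx & bc_repr A = U *m M.
Proof.
case=> M' <- ->; rewrite /bc_repr; set B := (\pi_(bc R d) M')%qT.
have /eqmodP /asboolP[U uU eU] : M' = repr B %[mod {eq_quot @bc_equiv R d}]%qT.
  exact: (esym (reprK B)).
by exists U.
Qed.

Lemma DpairE (M : 'M[K]_(d + d, (d + d) + (d + d))) :
  Dpair omega M = lsubmx M *m block_mx (Pinv omega ord0) 0 0 0 + rsubmx M.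
Proof.
rewrite /Dpair -[in RHS](hsubmxK (lsubmx M)) -[rsubmx M in RHS]hsubmxK.
by rewrite mul_row_block !mulmx0 addr0 add_row_mx !addr0 add0r.
Qed.

Lemma DpairM (U : 'M[K]_(d + d)) M : Dpair omega (U *m M) = U *m Dpair omega M.
Proof.
by rewrite !DpairE -[in LHS](hsubmxK M) mul_mx_row row_mxKl row_mxKr mulmxDr mulmxA.
Qed.

Lemma AmxM (U : 'M[K]_(d + d)) M : Amx (U *m M) = U *m Amx M.
Proof. by rewrite /Amx -[in LHS](hsubmxK M) mul_mx_row row_mxKl. Qed.

Lemma Dmx_repr A : Dmx omega A = Dpair omega (bc_repr A).
Proof. by []. Qed.

Lemma rank_Dmx (A : bc R d) M : is_bc_class M A ->
  \rank (Dmx omega A) = \rank (Dpair omega M).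
Proof.
case/bc_class_repr=> U uU eU; rewrite Dmx_repr eU DpairM.
by rewrite eqmxMfull // row_full_unit.
Qed.

Lemma sl_boundaryE (A : bc R d) M y : is_bc_class M A ->
  sl_boundary omega A y <->
  Amx M *m (trace_mx *m seq_vec y) + Dpair omega M *m bd_vec omega y = 0.
Proof.
case/bc_class_repr=> U uU eU; rewrite /sl_boundary -/(bd_vec omega y) boundaryE.
rewrite eU AmxM DpairM -!mulmxA -mulmxDr.
by split=> [e|->]; [rewrite -[LHS](mulKmx uU) e mulmx0|rewrite mulmx0].
Qed.

(** The elimination of y_0 adds to B the matrix A diag(P_0^{-1}, 0), and
    A diag(P_0^{-1}, 0) A^* is Hermitian. *)
Lemma bc_class_lagrangian (A : bc R d) M : is_bc_class M A ->
  \rank M = (d + d)%N /\ Amx M *m (Dpair omega M) ^t* = Dpair omega M *m (Amx M) ^t*.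
Proof.
case=> M' <- _; have /set_mem[rM eM] := valP M'; split=> //.
rewrite DpairE adjD adjM mulmxDr mulmxDl -mulmxA; congr (_ + _).
  congr (_ *m (_ *m _)).
  by rewrite adj_block !adj0 (elimT (hermP _) (Pinv_herm omega ord0)).
exact: eM.
Qed.

Section Chart.
Variables (A : bc R d) (M : 'M[K]_(d + d, (d + d) + (d + d))) (X : 'M[K]_(d + d)).
Hypothesis AM : is_bc_class M A.
Hypothesis hX : X \is hermsymmx.

(** Shifting the boundary quasi-differences by [X *m u] turns the boundary
    condition A u + D v = 0 into J u + D v' = 0; it is then the graph
    u = - L v' as soon as J is invertible. *)
Definition Jmx : 'M[K]_(d + d) := Amx M + Dpair omega M *m X.
Definition Lmx : 'M[K]_(d + d) := invmx Jmx *m Dpair omega M.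
Definition shifted_jacobi_mx : 'M[K]_n := jacobi_mx omega - trace_mx ^t* *m X *m trace_mx.

Hypothesis uJ : Jmx \in unitmx.

Lemma JD_herm : Dpair omega M *m Jmx ^t* = Jmx *m (Dpair omega M) ^t*.
Proof.
have [_ e] := bc_class_lagrangian AM.
rewrite /Jmx adjD adjM mulmxDr mulmxDl e (elimT (hermP _) hX); congr (_ + _).
by rewrite mulmxA.
Qed.

Lemma Lmx_congr : Jmx *m Lmx *m Jmx ^t* = Dpair omega M *m Jmx ^t*.
Proof. by rewrite /Lmx mulKVmx. Qed.

Lemma Lmx_herm : Lmx \is hermsymmx.
Proof.
apply/hermP; rewrite /Lmx adjM adj_inv.
apply: (canLR (mulmxK _)); first by rewrite unitmx_adj.
by rewrite -mulmxA JD_herm mulKmx.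
Qed.

Lemma shifted_jacobi_mx_herm : shifted_jacobi_mx \is hermsymmx.
Proof.
apply: hermD (jacobi_mx_herm omega) (hermN _).
by apply/hermP; rewrite !adjM trmxCK mulmxA (elimT (hermP _) hX).
Qed.

Lemma r_zero_Lmx : r_zero Lmx = (d + d - \rank (Dpair omega M))%N.
Proof.
rewrite (r_zeroE Lmx_herm); congr (_ - _)%N.
by rewrite eqmxMfull // row_full_unit unitmx_inv.
Qed.

(** On solutions w = X u - v is determined by y, since the trace is onto. *)
Lemma sl_solution_pencil lam y :
  sl_solution omega A lam y <->
  exists2 w, shifted_jacobi_mx *m seq_vec y + trace_mx ^t* *m w = lam *: (weight_mx omega *m seq_vec y)
           & trace_mx *m seq_vec y = Lmx *m w /\ bd_vec omega y = X *m (trace_mx *m seq_vec y) - w.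
Proof.
have bE (v : 'cV[K]_(d + d)) u : Amx M *m u + Dpair omega M *m v = 0 <->
    u = Lmx *m (X *m u - v).
  have -> : Amx M *m u + Dpair omega M *m v = Jmx *m u - Dpair omega M *m (X *m u - v).
    by rewrite /Jmx mulmxDl mulmxBr mulmxA opprB addrACA subrr addr0.
  split=> [/eqP|e]; first by rewrite subr_eq0 => /eqP e; rewrite /Lmx -mulmxA -e mulKmx.
  by rewrite {1}e /Lmx -mulmxA mulKVmx // subrr.
have tE w : shifted_jacobi_mx *m seq_vec y + trace_mx ^t* *m w =
    jacobi_mx omega *m seq_vec y - trace_mx ^t* *m (X *m (trace_mx *m seq_vec y) - w).
  by rewrite /shifted_jacobi_mx mulmxBl mulmxBr !mulmxA opprB addrA addrAC.
split=> [[/(sl_equationE _ N'0) e1 /(sl_boundaryE _ AM)/bE e2]|[w e1 [e2 e3]]].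
  exists (X *m (trace_mx *m seq_vec y) - bd_vec omega y); last by rewrite subKr.
  by rewrite tE subKr.
split; first by apply/(sl_equationE _ N'0); rewrite e3 -tE.
by apply/(sl_boundaryE _ AM)/bE; rewrite e3 subKr.
Qed.

(** A sorted list is determined by the multiplicities of its entries. *)
Lemma eigenvalue_list_unique (s : seq R) :
  is_eigenvalue_list omega A s -> eigenvalue_list omega A = s.
Proof.
move=> sP; rewrite /eigenvalue_list.
have /= [s1 c1] := @xgetPex _ [::] [set s | is_eigenvalue_list omega A s] (ex_intro _ s sP).
case: sP => s2 c2; apply: (sorted_eq (@le_trans _ R) (@le_anti _ R)) => //.
apply: (perm_map_inj (@complexI R)); apply/allP => x _ /=.
by rewrite c1 c2.
Qed.

Lemma mk_seq_linear (a : K) (Y Y' : 'cV[K]_n) (v v' : 'cV[K]_(d + d)) :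
  mk_seq omega (a *: Y + Y') (a *: v + v')
  = a *: mk_seq omega Y v + mk_seq omega Y' v'.
Proof.
apply/ffunP => k; rewrite !ffunE.
have lin (S : 'M[K]_(d, n)) : S *m (a *: Y + Y') = a *: (S *m Y) + S *m Y'.
  by rewrite mulmxDr -scalemxAr.
case: unliftP => [j _|_]; last first.
  by rewrite lin linearP mulmxDr -scalemxAr scalerBr opprD addrACA.
case: unliftP => [i _|_]; first by rewrite lin.
by rewrite lin linearP mulmxDr -scalemxAr scalerDr addrACA.
Qed.

(** The eigenvalue list exists, and its counting function is read off the
    inertia of the pencil. *)
Theorem eigenvalue_list_spec :
  let s := eigenvalue_list omega A in
  [/\ sorted <=%R s, (size s + r_zero Lmx = n)%N
    & forall mu : R,
        (pencil shifted_jacobi_mx (weight_mx omega) (@trace_mx R d N') Lmx (mu%:C)%C \in unitmx) = (mu \notin s) /\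
        (mu \notin s -> r_neg (pencil shifted_jacobi_mx (weight_mx omega) (@trace_mx R d N') Lmx (mu%:C)%C) =
          (count (fun x => (x < mu)%R) s + r_pos Lmx + r_zero Lmx)%N)].
Proof.
have [q [Z [dd [eq ddr ZWZ solE negE]]]] :=
  pencil_spectrum shifted_jacobi_mx_herm (weight_mx_posdef omega) Lmx_herm (trace_mx_free N'0).
pose s := sort <=%R [seq complex.Re (dd 0 i) | i <- enum 'I_q].
have ddE i : ((complex.Re (dd 0 i))%:C)%C = dd 0 i by exact: RRe_real.
have cs p : count p s = #|[pred i | p (complex.Re (dd 0 i))]|.
  by rewrite /s count_sort count_map cardE size_filter enumT.
have sP : is_eigenvalue_list omega A s.
  split; first by apply: sort_sorted; exact: le_total.
  move=> lam; rewrite count_map cs.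
  set P := [pred i | dd 0 i == lam].
  have -> : #|[pred i | preim (fun x : R => (x%:C)%C : K) (pred1 lam) (complex.Re (dd 0 i))]| = #|P|.
    by apply: eq_card => i; rewrite !inE /= ddE.
  (* [Cm] recovers v from y: w = trace_mx (trace_mx^* w), and the equation gives
   trace_mx^* w. *)
pose Cm := X *m trace_mx - trace_mx *m (lam *: weight_mx omega - shifted_jacobi_mx).
  pose F (x : 'cV[K]_#|P|) : slsq :=
    mk_seq omega (Z *m (sel P *m x)) (Cm *m (Z *m (sel P *m x))).
  have Flin : linear F.
    by move=> a x y; rewrite /F -mk_seq_linear !mulmxDr -!scalemxAr.
  pose FL : {linear 'cV[K]_#|P| -> slsq} :=
    HB.pack F (GRing.isLinear.Build _ _ _ _ F Flin).
  have Fdim : \dim (limg (linfun FL)) = #|P|.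
    rewrite limg_dim_eq ?dimvf /dim /= ?muln1 //.
    apply/eqP; rewrite -subv0; apply/subvP => x /memv_capP[_].
    rewrite memv_ker (lfunE FL) /= => /eqP Fx; rewrite memv0; apply/eqP.
    have : Z *m (sel P *m x) = 0.
      rewrite -[LHS](seq_vec_mk omega _ (Cm *m (Z *m (sel P *m x)))) -/(F x) Fx.
      by rewrite /seq_vec big1 // => i _; rewrite ffunE mulmx0.
    move=> /(congr1 (fun u => Z ^t* *m weight_mx omega *m u)).
    rewrite mulmx0 mulmxA ZWZ mul1mx => /(congr1 (fun u => (sel P) ^t* *m u)).
    by rewrite mulmx0 mulmxA sel_adjK mul1mx.
  rewrite -Fdim; symmetry; apply: multiplicity_dim => y.
  have RR := @trace_mx_adj R d N' N'0.
  have wE (Y : 'cV[K]_n) (w : 'cV[K]_(d + d)) : shifted_jacobi_mx *m Y + trace_mx ^t* *m w = lam *: (weight_mx omega *m Y) ->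
      X *m (trace_mx *m Y) - w = Cm *m Y.
    move=> e; rewrite /Cm mulmxBl -!mulmxA; congr (_ - _).
    by rewrite mulmxBl -scalemxAl -e addrAC subrr add0r mulmxA RR mul1mx.
  split.
    case/memv_imgP => x _ ->; rewrite (lfunE FL) /=; apply/sl_solution_pencil.
    have [_] := solE lam (Z *m (sel P *m x)); case.
      exists (sel P *m x) => //; apply/colP => i; rewrite mul_diag_mx !mxE mulr_sumr mulr_sumr.
      apply: eq_bigr => j _; rewrite !mxE; case: eqP => [->|_]; last by rewrite !mul0r !mulr0.
      by have /eqP -> := enum_valP j.
    move=> w e1 e2; exists w; rewrite seq_vec_mk // ; split=> //.
    by rewrite bd_vec_mk (wE _ _ e1).
  case/sl_solution_pencil=> w e1 [e2 e3].
  have [x ex1 ex2] := (solE lam (seq_vec y)).1 (ex_intro2 _ _ w e1 e2).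
  apply/memv_imgP; exists ((sel P) ^t* *m x); first exact: memvf.
  rewrite (lfunE FL) /= /F.
  have -> : sel P *m ((sel P) ^t* *m x) = x.
    rewrite mulmxA sel_adj mul_diag_mx; apply/colP => i; rewrite !mxE.
    have [iP|] := boolP (i \in P); first by rewrite mul1r.
    rewrite inE => di; rewrite mul0r; apply/esym/eqP.
    have /colP/(_ i) := ex2; rewrite mul_diag_mx !mxE => /eqP.
    by rewrite -subr_eq0 -mulrBl mulf_eq0 subr_eq0 (negPf di).
  by rewrite -ex1 -(wE _ _ e1) -e3 mk_seqK.
rewrite (eigenvalue_list_unique sP) /=; split; first exact: sP.1.
  by rewrite size_sort size_map size_enum_ord.
move=> mu; have muR : (mu%:C)%C \is @Num.real K by rewrite complex_real.
have muE : (mu \notin s) = [forall i, dd 0 i != (mu%:C)%C].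
  apply/idP/forallP => [mus i|dmu].
    apply: contra mus => /eqP e; rewrite mem_sort; apply/mapP; exists i.
      by rewrite mem_enum.
    by rewrite e.
  rewrite mem_sort; apply/mapP => -[i _ e].
  by have := dmu i; rewrite e ddE eqxx.
have [uE nE] := negE _ muR; rewrite muE uE; split=> //.
rewrite -uE => /nE ->; congr (_ + _ + _)%N.
rewrite cs; apply: eq_card => i; rewrite !inE -ddE.
by rewrite ltcR.
Qed.

End Chart.
End EigenvalueList.

(** * Topology of the space of boundary conditions *)

Section QuotientTopology.
Context {R : realType} {d : nat}.
Local Notation K := (cplx R).
Local Notation bcT := (set_type (@bc_pairs R d)).

Lemma mcvg_cvg T (F : set_system T) (FF : Filter F) m n (H : T -> 'M[K]_(m, n)) H0 :
  mcvg F H H0 -> H @ F --> H0.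
Proof.
move=> cH P /nbhs_ballP [e /= e0 eP].
have nH : \forall x \near F, forall i j, `|H0 i j - H x i j| < e.
  apply: filter_forall => i; apply: filter_forall => j.
  by move/cvgrPdist_lt: (cH i j); exact.
by apply: filterS nH => x hx; apply: eP; split.
Qed.

Lemma set_val_mcvg (M0 : bcT) : mcvg (nbhs M0) (fun M : bcT => set_val M) (set_val M0).
Proof.
move=> i j.
have h1 : set_val @ nbhs M0 --> (set_val M0 : 'M[K]_(d + d, (d + d) + (d + d))).
  exact: initial_continuous.
exact: (cvg_comp _ _ h1 (@coord_continuous K _ _ i j _)).
Qed.
#[local] Arguments set_val_mcvg M0 : clear implicits.

Lemma bc_pairsM (U : 'M[K]_(d + d)) M : U \in unitmx ->
  bc_pairs M -> bc_pairs (U *m M).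
Proof.
move=> uU [rM eM]; split.
  by rewrite eqmxMfull // row_full_unit.
rewrite -{1 2 3 4}[M]hsubmxK mul_mx_row !row_mxKl !row_mxKr.
by rewrite !adjM -mulmxA [lsubmx M *m _]mulmxA eM !mulmxA.
Qed.

Definition bc_act (U : 'M[K]_(d + d)) (uU : U \in unitmx) (M : bcT) : bcT :=
  exist _ (U *m set_val M) (mem_set (bc_pairsM uU (set_mem (valP M)))).

(** The space of pairs carries the topology induced by the matrices. *)
Lemma bc_act_cvg U (uU : U \in unitmx) (M : bcT) :
  bc_act uU @ nbhs M --> bc_act uU M.
Proof.
suff c : continuous (bc_act uU) by exact: c.
apply: continuous_comp_initial => x.
exact: (mcvg_cvg _ (mcvgM (mcvg_cst U) (set_val_mcvg x))).
Qed.

Lemma pi_bc_act U (uU : U \in unitmx) (M : bcT) :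
  (\pi_(bc R d) (bc_act uU M) = \pi_(bc R d) M)%qT.
Proof.
suff : (M = bc_act uU M %[mod {eq_quot @bc_equiv R d}])%qT by move=> ->.
by apply/eqmodP/asboolP; exists U.
Qed.

Lemma pi_bc_eq (M M' : bcT) : (\pi_(bc R d) M = \pi_(bc R d) M')%qT ->
  exists U (uU : U \in unitmx), M' = bc_act uU M.
Proof.
move=> e; have /eqmodP/asboolP[U uU eU] : (M = M' %[mod {eq_quot @bc_equiv R d}])%qT.
  exact: e.
by exists U, uU; apply: val_inj.
Qed.

(** The quotient map is open, because GL acts by homeomorphisms. *)
Lemma nbhs_pi (M0 : bcT) (P : set bcT) : nbhs M0 P ->
  nbhs (\pi_(bc R d) M0)%qT [set A | exists2 M, P M & A = (\pi_(bc R d) M)%qT].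
Proof.
rewrite nbhsE => -[V [oV VM0] VP].
rewrite nbhsE; exists [set A | exists2 M, V M & A = (\pi_(bc R d) M)%qT].
  split; last by exists M0.
  rewrite /open /= /quotient_open openE => M [M1 VM1 eM].
  have [U [uU eU]] := pi_bc_eq eM.
  have nV : nbhs (bc_act uU M) V by apply: open_nbhs_nbhs; split=> //; rewrite -eU.
  have nV' : nbhs M (bc_act uU @^-1` V) := bc_act_cvg nV.
  rewrite /interior /=; apply: filterS nV' => x Vx.
  by exists (bc_act uU x) => //; rewrite pi_bc_act.
by move=> A [M VM eA]; exists M => //; exact: VP.
Qed.

Lemma near_pi_within (M0 : bcT) (S P : set (bc R d)) :
  (\forall M \near M0, S (\pi_(bc R d) M)%qT -> P (\pi_(bc R d) M)%qT) ->
  \forall A \near within S (nbhs (\pi_(bc R d) M0)%qT), P A.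
Proof.
move=> /nbhs_pi h.
suff : nbhs (\pi_(bc R d) M0)%qT (fun A => S A -> P A) by [].
by apply: filterS h => _ [M SP ->].
Qed.

Lemma is_bc_class_pi (M : bcT) : is_bc_class (set_val M) (\pi_(bc R d) M)%qT.
Proof. by exists M. Qed.

End QuotientTopology.

Arguments set_val_mcvg {R d} M0.

(** * Counting eigenvalues near a boundary condition *)

Section LocalCount.
Context {R : realType} {d N' : nat}.
Local Notation K := (cplx R).
Local Notation N := N'.+1.
Local Notation bcT := (set_type (@bc_pairs R d)).
Variable omega : Omega R d N.
Hypothesis N'0 : (0 < N')%N.

Local Notation evs A := (eigenvalue_list omega A).
Local Notation "[bc M ]" := (\pi_(bc R d) M)%qT.
Local Notation below mu s := (count (fun x => (x < mu)%R) s).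

Section Near.
Variables (M0 : bcT) (X : bcT -> 'M[K]_(d + d)).
Hypothesis cX : mcvg (nbhs M0) X (X M0).
Hypothesis hX : \forall M \near M0, X M \is hermsymmx.
Hypothesis uJ : Jmx omega (set_val M0) (X M0) \in unitmx.

Let hX0 : X M0 \is hermsymmx. Proof. exact: nbhs_singleton hX. Qed.

Lemma Dpair_mcvg :
  mcvg (nbhs M0) (fun M : bcT => Dpair omega (set_val M)) (Dpair omega (set_val M0)).
Proof.
have c := set_val_mcvg M0.
have ca := mcvg_lsub (mcvg_lsub c).
exact: (mcvg_row_mx (mcvgD (mcvgM ca (mcvg_cst (Pinv omega ord0)))
  (mcvg_lsub (mcvg_rsub c))) (mcvg_rsub (mcvg_rsub c))).
Qed.

Lemma Jmx_mcvg :
  mcvg (nbhs M0) (fun M : bcT => Jmx omega (set_val M) (X M)) (Jmx omega (set_val M0) (X M0)).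
Proof. exact: (mcvgD (mcvg_lsub (set_val_mcvg M0)) (mcvgM Dpair_mcvg cX)). Qed.

Lemma Lmx_mcvg :
  mcvg (nbhs M0) (fun M : bcT => Lmx omega (set_val M) (X M)) (Lmx omega (set_val M0) (X M0)).
Proof. exact: (mcvgM (mcvg_inv Jmx_mcvg uJ) Dpair_mcvg). Qed.

Lemma near_Jmx_unit : \forall M \near M0, Jmx omega (set_val M) (X M) \in unitmx.
Proof. exact: near_unitmx Jmx_mcvg uJ. Qed.

Lemma near_Lmx_herm : \forall M \near M0, Lmx omega (set_val M) (X M) \is hermsymmx.
Proof.
by apply: filterS2 near_Jmx_unit hX => M uM hM; exact: (Lmx_herm (is_bc_class_pi M)).
Qed.

(** Away from the spectrum the pencil is nondegenerate and its inertia is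
    locally constant: the number of eigenvalues below [mu] can only change by
    what the inertia of [Lmx] loses. *)
Lemma near_count (mu : R) : mu \notin evs [bc M0] ->
  \forall M \near M0,
    (below mu (evs [bc M]) + r_pos (Lmx omega (set_val M) (X M))
      + r_zero (Lmx omega (set_val M) (X M)) =
     below mu (evs [bc M0]) + r_pos (Lmx omega (set_val M0) (X M0))
      + r_zero (Lmx omega (set_val M0) (X M0)))%N.
Proof.
move=> mu0.
pose H (M : bcT) := pencil (shifted_jacobi_mx omega (X M)) (weight_mx omega) (@trace_mx R d N')
  (Lmx omega (set_val M) (X M)) (mu%:C)%C.
have cH : mcvg (nbhs M0) H (H M0).
  have cT : mcvg (nbhs M0) (fun M => shifted_jacobi_mx omega (X M)) (shifted_jacobi_mx omega (X M0)).
    exact: (mcvgB (mcvg_cst (jacobi_mx omega))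
      (mcvgM (mcvgM (mcvg_cst ((@trace_mx R d N') ^t*)) cX) (mcvg_cst (@trace_mx R d N')))).
  exact: (mcvg_block (mcvgB cT (mcvg_cst ((mu%:C)%C *: weight_mx omega)))
    (mcvg_cst ((@trace_mx R d N') ^t*)) (mcvg_cst (@trace_mx R d N')) (mcvgN Lmx_mcvg)).
have muR : (mu%:C)%C \is @Num.real K by rewrite complex_real.
have hH M : X M \is hermsymmx -> Lmx omega (set_val M) (X M) \is hermsymmx ->
    H M \is hermsymmx.
  move=> hM hL; apply: herm_pencil => //; first exact: shifted_jacobi_mx_herm.
  exact: (weight_mx_posdef omega).1.
have nhH : \forall M \near M0, H M \is hermsymmx.
  by apply: filterS2 hX near_Lmx_herm => M; exact: hH.
have [_ _ /(_ mu)[uE0 nE0]] := eigenvalue_list_spec N'0 (is_bc_class_pi M0) hX0 uJ.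
have uH0 : H M0 \in unitmx by rewrite uE0.
have nconst := near_r_neg_eq cH (nbhs_singleton nhH) uH0 nhH.
have nunit := near_unitmx cH uH0.
near=> M.
have uM : Jmx omega (set_val M) (X M) \in unitmx by near: M; exact: near_Jmx_unit.
have hM : X M \is hermsymmx by near: M.
have [_ _ /(_ mu)[uE nE]] := eigenvalue_list_spec N'0 (is_bc_class_pi M) hM uM.
have : H M \in unitmx by near: M; exact: nunit.
have eM : r_neg (H M) = r_neg (H M0) by near: M; exact: nconst.
rewrite uE => mus.
exact: (etrans (esym (nE mus)) (etrans eM (nE0 mu0))).
Unshelve. all: by end_near. Qed.

End Near.

End LocalCount.

Section SortedCounts.
Context {R : realType}.
Implicit Types (s : seq R).

(** In a sorted list the entries below [mu] come first. *)
Lemma nth_lt_count s k mu : sorted <=%R s -> (k < size s)%N ->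
  (nth 0 s k < mu) = (k < count (fun x => (x < mu)%R) s)%N.
Proof.
elim: s k => [|x s IH] k //= ps; have ss := path_sorted ps.
have [xm|mx] := ltP x mu; case: k => [|k] /=; rewrite ?xm ?add1n ?add0n //.
- by rewrite !ltnS => ks; exact: IH.
- move=> _; rewrite ltNge mx /=; apply/esym/negbTE; rewrite -leqNgt leqn0.
  rewrite -[_ == _]negbK -lt0n -has_count; apply/hasPn => y ys.
  rewrite -leNgt (le_trans mx) //.
  by have /allP/(_ _ ys) := order_path_min (@le_trans _ R) ps.
- rewrite ltnS => ks.
  have c0 : count (fun z => (z < mu)%R) s = 0%N.
    apply/eqP; rewrite -[_ == _]negbK -lt0n -has_count; apply/hasPn => y ys.
    rewrite -leNgt (le_trans mx) //.
    by have /allP/(_ _ ys) := order_path_min (@le_trans _ R) ps.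
  rewrite c0 ltn0; apply/negbTE; rewrite -leNgt (le_trans mx) //.
  by have /allP := order_path_min (@le_trans _ R) ps; apply; exact: mem_nth.
Qed.

(** A finite list cannot exhaust an interval: halve it at each entry. *)
Lemma avoid_seq s (a b : R) : a < b -> exists mu, [/\ a < mu, mu < b & mu \notin s].
Proof.
elim: s a b => [|x s IH] a b ab.
  by exists ((a + b) / 2%:R); rewrite !(midf_lt ab).
have [xm|mx] := leP x ((a + b) / 2%:R).
  have [mu [m1 m2 m3]] := IH _ _ (midf_lt ab).2.
  exists mu; split=> //; first exact: lt_trans (midf_lt ab).1 m1.
  by rewrite inE negb_or m3 andbT gt_eqF // (le_lt_trans xm).
have [mu [m1 m2 m3]] := IH _ _ (midf_lt ab).1.
exists mu; split=> //; first exact: lt_trans m2 (midf_lt ab).2.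
by rewrite inE negb_or m3 andbT lt_eqF // (lt_trans m2).
Qed.

Variables (T : Type) (F : set_system T) (s : T -> seq R) (s0 : seq R) (D k : nat).
Hypothesis FF : Filter F.
Hypothesis ss : forall x, sorted <=%R (s x).
Hypothesis ss0 : sorted <=%R s0.
Hypothesis k0 : (0 < k)%N.
Hypothesis sk : \forall x \near F, (k <= size (s x))%N.
Hypothesis sD : forall mu, mu \notin s0 -> \forall x \near F,
  count (fun y => (y < mu)%R) (s x) = (count (fun y => (y < mu)%R) s0 + D)%N.

(** If the counting functions of the lists [s x] converge to that of [s0] up to
    a shift by [D], the first [D] entries escape to -oo, the following ones
    converge to the entries of [s0] and the remaining ones escape to +oo. *)
Lemma nth_cvg_ninfty : (k <= D)%N -> (fun x => nth 0 (s x) k.-1) @ F --> -oo.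
Proof.
move=> kD; apply/cvgrNyPlt => a.
have aa : a - 1 < a by rewrite gtrDl oppr_lt0.
have [mu [_ ma mu0]] := avoid_seq s0 aa.
apply: filterS2 sk (sD mu0) => x kx cx; apply: (lt_trans _ ma).
by rewrite nth_lt_count ?ss ?prednK // cx; apply: leq_trans kD (leq_addl _ _).
Qed.

Lemma nth_cvg_pinfty : (size s0 + D < k)%N -> (fun x => nth 0 (s x) k.-1) @ F --> +oo.
Proof.
move=> kD; apply/cvgryPge => a.
have aa : a < a + 1 by rewrite ltrDl.
have [mu [am _ mu0]] := avoid_seq s0 aa.
apply: filterS2 sk (sD mu0) => x kx cx; apply: (le_trans (ltW am)).
rewrite leNgt nth_lt_count ?ss ?prednK // cx -ltnNge.
by apply: leq_ltn_trans kD; rewrite leq_add2r count_size.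
Qed.

Lemma nth_cvg_shift : (D < k)%N -> (k - D <= size s0)%N ->
  (fun x => nth 0 (s x) k.-1) @ F --> nth 0 s0 (k - D).-1.
Proof.
move=> Dk ks; set l := nth 0 s0 _; apply/cvgrPdist_lt => e e0.
have le1 : l - e < l by rewrite gtrDl oppr_lt0.
have le2 : l < l + e by rewrite ltrDl.
have [m1 [a1 b1 c1]] := avoid_seq s0 le1.
have [m2 [a2 b2 c2]] := avoid_seq s0 le2.
near=> x; rewrite distrC ltr_distl; apply/andP.
have kx : (k <= size (s x))%N by near: x.
have e1 : count (fun y => (y < m1)%R) (s x) = (count (fun y => (y < m1)%R) s0 + D)%N.
  by near: x; exact: sD.
have e2 : count (fun y => (y < m2)%R) (s x) = (count (fun y => (y < m2)%R) s0 + D)%N.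
  by near: x; exact: sD.
have kD0 : (0 < k - D)%N by rewrite subn_gt0.
split.
  apply: (lt_le_trans a1); rewrite leNgt nth_lt_count ?ss ?prednK // e1 -ltnNge.
  have : ~~ (l < m1) by rewrite -leNgt ltW.
  by rewrite nth_lt_count ?prednK // -ltnNge addnC -ltn_subRL.
apply: (lt_trans _ b2); rewrite nth_lt_count ?ss ?prednK // e2.
by move: a2; rewrite nth_lt_count ?prednK // addnC -leq_subLR.
Unshelve. all: by end_near. Qed.

End SortedCounts.

(** * Continuity along the layers of constant nullity *)

Lemma count_from_indices (b b0 p p0 q q0 z z0 : nat) :
  (b + p + z = b0 + p0 + z0)%N -> (p0 <= p)%N -> (q0 <= q)%N -> z = z0 ->
  (z + p + q = z0 + p0 + q0)%N -> b = b0.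
Proof.
move=> eb pp qq ez; move: eb; rewrite ez => /addIn eb.
rewrite -!addnA => /addnI epq; suff ep : p = p0 by move: eb; rewrite ep => /addIn.
apply/eqP; rewrite eqn_leq pp andbT -(leq_add2r q0) -epq leq_add2l.
exact: qq.
Qed.

(** Substituting u = - i v in the symmetric identity gives 2 i v v^* = 0. *)
Lemma isotropic_i (C : numClosedFieldType) m (u v : 'rV[C]_m) :
  u = - ('i *: v) -> u *m v ^t* = v *m u ^t* -> v = 0.
Proof.
move=> ->; rewrite adjN adjZ mulNmx mulmxN -scalemxAl -scalemxAr conjCi scaleNr opprK.
move=> /eqP; rewrite eq_sym -subr_eq0 opprK -mulr2n -scaler_nat scalerA scaler_eq0.
rewrite mulf_eq0 pnatr_eq0 (negPf (neq0Ci _)) /= => /eqP vv.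
apply/eqP; apply: contraT => nv.
by have := posdefmx_inj (@posdefmx1 C m) nv; rewrite mulmx1 vv mxE ltxx.
Qed.

Section Layers.
Context {R : realType} {d N' : nat}.
Local Notation K := (cplx R).
Local Notation N := N'.+1.
Local Notation bcT := (set_type (@bc_pairs R d)).
Variable omega : Omega R d N.
Hypothesis N'0 : (0 < N')%N.

Local Notation evs A := (eigenvalue_list omega A).
Local Notation "[bc M ]" := (\pi_(bc R d) M)%qT.
Local Notation below mu s := (count (fun x => (x < mu)%R) s).

Lemma poly_avoid (p : {poly K}) (f : nat -> K) : p != 0 -> injective f ->
  exists j, ~~ root p (f j).
Proof.
move=> p0 fi; have us : uniq [seq f j | j <- iota 0 (size p)].
  by rewrite map_inj_uniq ?iota_uniq.
have : ~~ all (root p) [seq f j | j <- iota 0 (size p)].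
  by apply/negP => /(max_poly_roots p0)/(_ us); rewrite size_map size_iota ltnn.
by case/allPn => z /mapP[j _ ->] nr; exists j.
Qed.

(** Invertibility along a line of matrices is decided by one polynomial, which
    has finitely many roots. *)
Lemma det_affine_poly n (A D : 'M[K]_n) (z : K) :
  (\det (map_mx polyC A + 'X *: map_mx polyC D)).[z] = \det (A + z *: D).
Proof.
rewrite -horner_evalE -det_map_mx; congr (\det _); apply/matrixP => i j.
by rewrite !mxE /= horner_evalE hornerD hornerM hornerX !hornerC.
Qed.

Lemma pair_free (A : bc R d) M (x : 'rV[K]_(d + d)) : is_bc_class M A ->
  x *m Amx M = 0 -> x *m Dpair omega M = 0 -> x = 0.
Proof.
move=> AM xA; have [rM _] := bc_class_lagrangian omega AM.
rewrite DpairE mulmxDr mulmxA xA mul0mx add0r => xB.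
have fM : row_free M by apply/eqP.
apply/eqP; rewrite -(mulmx_free_eq0 x fM) -[M]hsubmxK mul_mx_row -/(Amx M) xA xB.
by rewrite row_mx0.
Qed.

(** For a Lagrangian pair the matrix A + i D is invertible, hence so is A + t D
    for some, in fact for almost every, real t. *)
Lemma exists_scalar_chart (A : bc R d) M : is_bc_class M A ->
  exists t : nat, Jmx omega M (t%:R)%:M \in unitmx.
Proof.
move=> AM; have [_ lag] := bc_class_lagrangian omega AM.
pose p := \det (map_mx polyC (Amx M) + 'X *: map_mx polyC (Dpair omega M)).
have p0 : p != 0.
  have : root p 'i = false; last by apply: contraFneq => ->; rewrite root0.
  apply/negbTE; rewrite /root det_affine_poly -unitfE -unitmxE -row_free_unit.
  rewrite -kermx_eq0 -nz_row_eq0; set x := nz_row _.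
  have /sub_kermxP : (x <= kermx (Amx M + 'i *: Dpair omega M))%MS by exact: nz_row_sub.
  rewrite mulmxDr -scalemxAr => xAD.
  pose u := x *m Amx M; pose v := x *m Dpair omega M.
  have euv : u = - ('i *: v) by apply/eqP; rewrite -addr_eq0 xAD.
  have h : u *m v ^t* = v *m u ^t*.
    by rewrite !adjM !mulmxA -[_ *m Amx M *m _]mulmxA lag !mulmxA.
  have v0 : v = 0 := isotropic_i euv h.
  have u0 : u = 0 by rewrite euv v0 scaler0 oppr0.
  by rewrite (pair_free AM u0 v0) eqxx.
have [t nr] := poly_avoid p0 (fun a b e => mulrIn (@oner_neq0 K) e).
exists t; rewrite unitmxE unitfE /Jmx mul_mx_scalar.
by rewrite -det_affine_poly.
Qed.

Lemma scalar_herm (t : nat) : ((t%:R)%:M : 'M[K]_(d + d)) \is hermsymmx.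
Proof. by apply/hermP; rewrite tr_scalar_mx map_scalar_mx rmorph_nat. Qed.

Lemma bc_pi_surj (A : bc R d) : exists M : bcT, A = [bc M].
Proof. by exists (repr A); rewrite reprK. Qed.

Lemma size_eigenvalue_list (A : bc R d) :
  (size (evs A) + (d + d - \rank (Dmx omega A)) = N * d)%N.
Proof.
have [M ->] := bc_pi_surj A; have AM := is_bc_class_pi M.
have [t ut] := exists_scalar_chart AM.
have [_ e _] := eigenvalue_list_spec N'0 AM (scalar_herm t) ut.
by rewrite -[RHS]e (rank_Dmx omega AM) (r_zero_Lmx AM (scalar_herm t) ut).
Qed.

Lemma sorted_eigenvalue_list (A : bc R d) : sorted <=%R (evs A).
Proof.
have [M ->] := bc_pi_surj A; have AM := is_bc_class_pi M.
have [t ut] := exists_scalar_chart AM.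
by have [] := eigenvalue_list_spec N'0 AM (scalar_herm t) ut.
Qed.

Lemma B_layer_size k A : B_layer omega k A -> (size (evs A) = N * d - k)%N.
Proof.
by rewrite /B_layer /= => kE; have := size_eigenvalue_list A; rewrite kE => <-; rewrite addnK.
Qed.

Lemma B_layer_dom k n A : B_layer omega k A -> (n <= N * d - k)%N -> lambda_dom omega n A.
Proof. by move=> /B_layer_size sA; rewrite /lambda_dom /= /nb_eigenvalues sA. Qed.

(** On a layer the nullity of [Lmx] is fixed while its two indices can only
    grow, so all three are locally constant, and so are the counts. *)
Lemma layer_count k A mu : B_layer omega k A -> mu \notin evs A ->
  \forall B \near within (B_layer omega k) (nbhs A),
    below mu (evs B) = below mu (evs A).
Proof.
have [M0 ->] := bc_pi_surj A; move=> kA mu0; have AM := is_bc_class_pi M0.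
have [t ut] := exists_scalar_chart AM.
pose X := fun _ : bcT => (t%:R)%:M : 'M[K]_(d + d).
have cX : mcvg (nbhs M0) X (X M0) by exact: (mcvg_cst (t%:R)%:M).
have hX : \forall M \near M0, X M \is hermsymmx by apply: (@filterE _ (nbhs M0)) => M; exact: scalar_herm.
have hL0 := Lmx_herm AM (scalar_herm t) ut.
have nL := near_Lmx_herm cX hX ut.
pose L (M : bcT) := Lmx omega (set_val M) (X M).
have np : \forall M \near M0, (r_pos (L M0) <= r_pos (L M))%N.
  exact: (near_r_pos (Lmx_mcvg cX ut) hL0 nL).
have nn : \forall M \near M0, (r_neg (L M0) <= r_neg (L M))%N.
  exact: (near_r_neg (Lmx_mcvg cX ut) hL0 nL).
have nu := near_Jmx_unit cX ut.
have nc := near_count N'0 cX hX ut mu0.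
have npn : \forall M \near M0, (r_pos (L M0) <= r_pos (L M))%N /\ (r_neg (L M0) <= r_neg (L M))%N.
  by apply: filterS2 np nn => M pM nM; split.
apply: near_pi_within; apply: filterS3 npn nu nc => M [pM nM] uM cM kM.
have hL := Lmx_herm (is_bc_class_pi M) (scalar_herm t) uM.
have z0 := r_zero_Lmx AM (scalar_herm t) ut.
have zM := r_zero_Lmx (is_bc_class_pi M) (scalar_herm t) uM.
rewrite -(rank_Dmx omega AM) kA in z0.
rewrite -(rank_Dmx omega (is_bc_class_pi M)) kM in zM.
exact: (count_from_indices cM pM nM (etrans zM (esym z0)) (etrans (r_total hL) (esym (r_total hL0)))).
Qed.

Lemma layer_cvg k n A : B_layer omega k A -> (1 <= n <= N * d - k)%N ->
  lambda omega n @ within (B_layer omega k) (nbhs A) --> lambda omega n A.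
Proof.
move=> kA /andP[n1 nk].
have nsz : \forall B \near within (B_layer omega k) (nbhs A), (n <= size (evs B))%N.
  apply: filterS (@withinT _ (nbhs A) (B_layer omega k) _) => B kB.
  by rewrite (B_layer_size kB).
have ncnt mu : mu \notin evs A -> \forall B \near within (B_layer omega k) (nbhs A),
    below mu (evs B) = (below mu (evs A) + 0)%N.
  by move=> mu0; have := layer_count kA mu0; apply: filterS => B e; exact: (etrans e (esym (addn0 _))).
have szA : (n - 0 <= size (evs A))%N by rewrite subn0 (B_layer_size kA).
have := nth_cvg_shift _ sorted_eigenvalue_list (sorted_eigenvalue_list A) n1 nsz ncnt n1 szA.
by rewrite subn0; apply.
Qed.

Lemma layer_continuous k n : (1 <= n <= N * d - k)%N ->
  {within B_layer omega k, continuous (lambda omega n)}.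
Proof. by move=> nk; apply/subspace_continuousP => A kA; exact: layer_cvg. Qed.

End Layers.

(** * Density of the regular boundary conditions *)

Lemma shift_affine (C : numClosedFieldType) m (L : 'M[C]_m) (t z : C) :
  1%:M - t *: (L + z *: 1%:M) = (1%:M - t *: L) + z *: (- t *: 1%:M).
Proof. by rewrite scalerDr opprD addrA scaleNr scalerN !scalerA [t * _]mulrC. Qed.

Lemma norm_shift_entry (C : numClosedFieldType) m n (A B : 'M[C]_(m, n)) (z : C) i j :
  `|A i j - (A + z *: B) i j| = `|z| * `|B i j|.
Proof. by rewrite !mxE opprD addrA subrr add0r normrN normrM. Qed.

Lemma small_shift (F : numFieldType) (e c a : F) j : 0 < e -> 0 <= c -> a <= c ->
  e / (c + j.+1%:R) * a < e.
Proof.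
move=> e0 c0 ac; have cj : 0 < c + j.+1%:R by rewrite ltr_wpDl // ltr0Sn.
rewrite mulrAC ltr_pdivrMr // ltr_pM2l //.
by apply: le_lt_trans ac _; rewrite ltrDl ltr0Sn.
Qed.

Section Density.
Context {R : realType} {d N' : nat}.
Local Notation K := (cplx R).
Local Notation N := N'.+1.
Local Notation bcT := (set_type (@bc_pairs R d)).
Variable omega : Omega R d N.
Hypothesis N'0 : (0 < N')%N.

Local Notation "[bc M ]" := (\pi_(bc R d) M)%qT.

Lemma nbhs_bc_pairs (M0 : bcT) (P : set bcT) : nbhs M0 P ->
  exists2 e : K, 0 < e &
    forall M : bcT, (forall i j, `|set_val M0 i j - set_val M i j| < e) -> P M.
Proof.
rewrite nbhsE => -[V [oV VM0] VP]; case: oV => W oW eW.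
have WM0 : nbhs (set_val M0) W.
  by apply: open_nbhs_nbhs; split=> //; rewrite -eW in VM0.
have /nbhs_ballP[e /= e0 eW'] := WM0; exists e => // M hM.
by apply: VP; rewrite -eW; apply: eW'; split.
Qed.

(** The boundary condition with prescribed blocks [A'] and [D'], [D'] being the
    block of [v] after the elimination of y_0. *)
Definition pair_of (A' D' : 'M[K]_(d + d)) : 'M[K]_(d + d, (d + d) + (d + d)) :=
  row_mx A' (D' - A' *m block_mx (Pinv omega ord0) 0 0 0).

Lemma Dpair_pair_of A' D' : Dpair omega (pair_of A' D') = D'.
Proof. by rewrite DpairE /pair_of row_mxKl row_mxKr addrC subrK. Qed.

Lemma pair_of_eta M : pair_of (Amx M) (Dpair omega M) = M.
Proof. by rewrite /pair_of DpairE /Amx addrAC subrr add0r hsubmxK. Qed.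

Lemma pair_ofM U A' D' : U *m pair_of A' D' = pair_of (U *m A') (U *m D').
Proof. by rewrite /pair_of mul_mx_row mulmxBr mulmxA. Qed.

Lemma pair_ofDZ A' D' A1 D1 (z : K) :
  pair_of (A' + z *: A1) (D' + z *: D1) = pair_of A' D' + z *: pair_of A1 D1.
Proof.
rewrite /pair_of scale_row_mx add_row_mx; congr row_mx.
by rewrite mulmxDl -scalemxAl opprD addrACA scalerBr.
Qed.

Lemma pair_of_shift L (t z : K) :
  pair_of (1%:M - t *: (L + z *: 1%:M)) (L + z *: 1%:M)
  = pair_of (1%:M - t *: L) L + z *: pair_of (- t *: 1%:M) 1%:M.
Proof. by rewrite shift_affine pair_ofDZ. Qed.

Lemma pair_of_bc A' D' : A' *m D' ^t* = D' *m A' ^t* ->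
  (forall x : 'rV[K]_(d + d), x *m A' = 0 -> x *m D' = 0 -> x = 0) ->
  bc_pairs (pair_of A' D').
Proof.
move=> lag free; split.
  apply/eqP; rewrite -/(row_free _) -kermx_eq0 -nz_row_eq0; set x := nz_row _.
  have /sub_kermxP : (x <= kermx (pair_of A' D'))%MS by exact: nz_row_sub.
  rewrite /pair_of mul_mx_row -row_mx0 => /eq_row_mx[xA].
  by rewrite mulmxBr mulmxA xA mul0mx subr0 => xD; rewrite (free _ xA xD).
rewrite /pair_of row_mxKl row_mxKr adjB adjM mulmxBr mulmxBl lag; congr (_ - _).
rewrite adj_block !adj0 (elimT (hermP _) (Pinv_herm omega ord0)).
by rewrite mulmxA.
Qed.

(** Shifting [Lmx] by a small real scalar makes it invertible: the boundary
    conditions with invertible [Dmx] are dense. *)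
Lemma closure_B_layer0 (A : bc R d) : closure (B_layer omega 0) A.
Proof.
have [M0 eA] := bc_pi_surj A; have AM := is_bc_class_pi M0.
have [t ut] := exists_scalar_chart omega AM.
set X : 'M[K]_(d + d) := (t%:R)%:M in ut.
have [L eL] : {L | L = Lmx omega (set_val M0) X} by eexists.
have hL : L ^t* = L by rewrite eL; apply/hermP; exact: (Lmx_herm AM (scalar_herm t) ut).
pose Lz (z : K) := L + z *: 1%:M.
have bcz z : z \is Num.real -> bc_pairs (pair_of (1%:M - t%:R *: Lz z) (Lz z)).
  move=> zr; have hLz : (Lz z) ^t* = Lz z by rewrite adjD adjZ adj1 hL (CrealP zr).
  apply: pair_of_bc.
    by rewrite adjB adj1 adjZ rmorph_nat hLz mulmxBl mulmxBr mul1mx mulmx1 -scalemxAl -scalemxAr.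
  move=> x; rewrite mulmxBr mulmx1 -scalemxAr => + xL.
  by rewrite xL scaler0 subr0.
pose Mz z (zr : z \is Num.real) : bcT :=
    exist (fun M => M \in @bc_pairs R d) _ (mem_set (bcz z zr)).
have eL0 : Lz 0 = L by rewrite /Lz scale0r addr0.
have eA0 : A = [bc Mz 0 (real0 K)].
  have uJ : invmx (Jmx omega (set_val M0) X) \in unitmx by rewrite unitmx_inv.
  have eJD : invmx (Jmx omega (set_val M0) X) *m Dpair omega (set_val M0) = L by rewrite eL.
  have eJA : invmx (Jmx omega (set_val M0) X) *m Amx (set_val M0) = 1%:M - t%:R *: L.
    apply: (canLR (mulKmx ut)); rewrite mulmxBr mulmx1 -scalemxAr -eJD mulKVmx //.
    by rewrite {1}/Jmx mul_mx_scalar addrK.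
  have eM : invmx (Jmx omega (set_val M0) X) *m set_val M0 = pair_of (1%:M - t%:R *: L) L.
    by rewrite -eJA -[in RHS]eJD -pair_ofM pair_of_eta.
  rewrite eA -(pi_bc_act uJ M0); congr (\pi_(bc R d) _)%qT; apply: val_inj.
  by rewrite /= eL0 -eM.
move=> B; rewrite eA0 => /pi_continuous /nbhs_bc_pairs[e e0 hB].
pose Nm := pair_of (- t%:R *: 1%:M) 1%:M.
pose c := \sum_i \sum_j `|Nm i j|.
have c0 : 0 <= c by apply: sumr_ge0 => i _; apply: sumr_ge0.
have cN i j : `|Nm i j| <= c.
  rewrite /c (bigD1 i) //= (bigD1 j) //= -addrA lerDl addr_ge0 ?sumr_ge0 // => *.
  by apply: sumr_ge0.
(* Infinitely many real shifts, all small enough to stay in the neighbourhood;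
   one of them is not a root. *)
pose f (j : nat) : K := e / (c + j.+1%:R).
have cj j : 0 < c + j.+1%:R by rewrite ltr_wpDl // ltr0Sn.
have fi : injective f.
  move=> a b /(mulfI (lt0r_neq0 e0))/invr_inj/addrI/eqP.
  by rewrite eqr_nat eqSS => /eqP.
pose p := \det (map_mx polyC L + 'X *: map_mx polyC 1%:M).
have p0 : p != 0.
  rewrite /p map_mx1 scalemx1.
  have -> : map_mx polyC L + 'X%:M = char_poly_mx (- L).
    by rewrite /char_poly_mx map_mxN opprK addrC.
  exact: monic_neq0 (char_poly_monic (- L)).
have [j nr] := poly_avoid p0 fi.
have zr : f j \is Num.real.
  by rewrite ger0_real // divr_ge0 ?ltW.
exists [bc Mz (f j) zr]; split.
  rewrite /B_layer /= (rank_Dmx omega (is_bc_class_pi (Mz (f j) zr))) Dpair_pair_of.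
  rewrite mxrank_unit ?subnn // unitmxE unitfE -det_affine_poly; exact: nr.
have eM0 : set_val (Mz 0 (real0 K)) = pair_of (1%:M - t%:R *: L) L.
  exact: (congr1 (fun l => pair_of (1%:M - t%:R *: l) l) eL0).
have eMz : set_val (Mz (f j) zr) = pair_of (1%:M - t%:R *: L) L + f j *: Nm.
  exact: (pair_of_shift L t%:R (f j)).
apply: hB => i k; rewrite eM0 eMz norm_shift_entry ger0_norm; last by rewrite divr_ge0 ?ltW.
exact: small_shift.
Qed.

End Density.

(** * Linear algebra of a coordinate chart *)

Lemma chart_D_block (C : numClosedFieldType) n (S E P : 'M[C]_n) :
  (S *m E + (E - 1%:M)) *m P + (S *m (1%:M - E) + E)
  = S *m (E *m P + 1%:M - E) + ((E - 1%:M) *m P + E).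
Proof. by rewrite mulmxDl -mulmxA addrACA -mulmxDr -addrA. Qed.

Section ChartAlgebra.
Context {C : numClosedFieldType} {d : nat}.
Variables (E1 E2 P S1 S2 S3 : 'M[C]_d).
Hypothesis aE1 : E1 ^t* = E1.
Hypothesis iE1 : E1 *m E1 = E1.
Hypothesis aE2 : E2 ^t* = E2.
Hypothesis iE2 : E2 *m E2 = E2.
Hypothesis aP : P ^t* = P.
Hypothesis aS3 : S3 ^t* = S3.

Let G := E1 *m P + 1%:M - E1.
Let F := (E1 - 1%:M) *m P + E1.
Hypothesis uG : G \in unitmx.

(** The two blocks of (S | I) E_K after the elimination of y_0, with
    P = P_0^{-1}. *)
Definition chart_A := block_mx (S1 *m E1 + (E1 - 1%:M)) (S2 *m E2)
  (S2 ^t* *m E1) (S3 *m E2 + (E2 - 1%:M)).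
Definition chart_D := block_mx (S1 *m G + F) (S2 *m (1%:M - E2))
  (S2 ^t* *m G) (S3 *m (1%:M - E2) + E2).

(** The shift adapted to the chart: it makes [chart_J] invertible, and its last
    block puts a negative definite summand on the coordinates that the matrix
    S_K^D discards. *)
Definition chart_X := block_mx (- (E1 *m (invmx G) ^t*)) 0 0 (E2 - E2 *m S3 *m E2).

Lemma compl_mul_E2 : (1%:M - E2) *m E2 = 0.
Proof. by rewrite mulmxBl mul1mx iE2 subrr. Qed.
Lemma E2_mul_compl : E2 *m (1%:M - E2) = 0.
Proof. by rewrite mulmxBr mulmx1 iE2 subrr. Qed.
Lemma compl_E2_idem : (1%:M - E2) *m (1%:M - E2) = 1%:M - E2.
Proof. by rewrite mulmxBr mulmx1 compl_mul_E2 subr0. Qed.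

Lemma chart_G_adj : G ^t* = P *m E1 + 1%:M - E1.
Proof. by rewrite adjB adjD adjM adj1 aE1 aP. Qed.

Lemma chart_G_E1 : G *m E1 = E1 *m G ^t*.
Proof.
rewrite chart_G_adj /G !(mulmxBl, mulmxBr) mulmxDl mulmxDr mul1mx mulmx1 iE1.
by rewrite !addrK !mulmxA.
Qed.

Lemma chart_G_E1_adjinv : G *m E1 *m (invmx G) ^t* = E1.
Proof. by rewrite chart_G_E1 adj_inv mulmxK // unitmx_adj. Qed.

Lemma chart_X_herm : chart_X \is hermsymmx.
Proof.
apply/hermP; rewrite adj_block !adj0 adjN adjB !adjM trmxCK aE1 aE2 aS3 mulmxA.
congr (block_mx (- _) _ _ _).
by rewrite -[RHS]mul1mx -(mulVmx uG) -mulmxA [G *m _]mulmxA chart_G_E1_adjinv.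
Qed.

Definition chart_J22 := (1%:M - E2) *m S3 *m E2 - (1%:M - E2) + E2.

Lemma chart_JE : chart_A + chart_D *m chart_X =
  block_mx (- (invmx G) ^t*) (S2 *m E2) 0 chart_J22.
Proof.
rewrite mulmx_block !mulmx0 addr0 add0r !mulmxN add_block_mx addr0 add0r.
congr block_mx.
- rewrite mulmxDl !mulmxA -[S1 *m G *m E1]mulmxA -[S1 *m (G *m E1) *m _]mulmxA chart_G_E1_adjinv.
  rewrite opprD addrACA subrr add0r.
  have uG' : (invmx G) ^t* \in unitmx by rewrite unitmx_adj unitmx_inv.
  suff e : (E1 - 1%:M) *m G ^t* - F *m E1 = - 1%:M.
    have := congr1 (fun Z => Z *m (invmx G) ^t*) e.
    by rewrite mulmxBl adj_inv mulmxK ?unitmx_adj // mulNmx mul1mx.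
  rewrite chart_G_adj /F [in X in _ - X]mulmxDl mulmxBr mulmxDr mulmx1.
  have -> : (E1 - 1%:M) *m E1 = 0 by rewrite mulmxBl iE1 mul1mx subrr.
  rewrite iE1 subr0 mulmxA opprD addrACA subrr add0r.
  by rewrite addrAC subrr add0r.
- by rewrite mulmxBr !mulmxA -[S2 *m _ *m E2]mulmxA compl_mul_E2 mulmx0 !mul0mx subrr addr0.
- by rewrite !mulmxA -[_ *m G *m E1]mulmxA -[_ *m (G *m E1) *m _]mulmxA chart_G_E1_adjinv subrr.
- set z := E2 - E2 *m S3 *m E2.
  have z0 : (1%:M - E2) *m z = 0 by rewrite mulmxBr !mulmxA compl_mul_E2 !mul0mx subrr.
  have z1 : E2 *m z = z by rewrite mulmxBr !mulmxA iE2.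
  rewrite mulmxDl -mulmxA z0 mulmx0 add0r z1 /z /chart_J22 !mulmxBl mul1mx.
  move: (S3 *m E2) (E2 *m S3 *m E2) => a b.
  by apply/matrixP => i j; rewrite !mxE; ring.
Qed.

(** It is an involution up to the nilpotent term, hence invertible: the diagonal
    part squares to 1 and anticommutes with the nilpotent one. *)
Lemma chart_J22_invol : chart_J22 *m chart_J22 = 1%:M.
Proof.
rewrite /chart_J22 -addrA; set a := (1%:M - E2) *m S3 *m E2.
have al : (1%:M - E2) *m a = a by rewrite /a !mulmxA compl_E2_idem.
have al0 : E2 *m a = 0 by rewrite /a !mulmxA E2_mul_compl !mul0mx.
have ar : a *m E2 = a by rewrite /a -!mulmxA iE2.
have ar0 : a *m (1%:M - E2) = 0 by rewrite /a -!mulmxA E2_mul_compl !mulmx0.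
move: a al al0 ar ar0 => a al al0 ar ar0.
move: compl_E2_idem compl_mul_E2 E2_mul_compl iE2 al al0 ar ar0; move: (1%:M - E2) (subrK E2 1%:M) => p p1 pp pe ep ee.
move=> al al0 ar ar0.
have aa : a *m a = 0 by rewrite -{1}ar -mulmxA al0 mulmx0.
rewrite !(mulmxDl, mulmxDr, mulmxN, mulNmx) aa al al0 ar ar0 pp pe ep ee.
by rewrite opprK !(oppr0, add0r, addr0) -p1 addrA addrA addrN add0r.
Qed.

Lemma chart_J_unit : chart_A + chart_D *m chart_X \in unitmx.
Proof.
rewrite chart_JE unitmxE det_ublock.
rewrite unitrM -!unitmxE; apply/andP; split.
  by rewrite -scaleN1r unitmxZ ?unitrN1 // unitmx_adj unitmx_inv.
by have [] := mulmx1_unit chart_J22_invol.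
Qed.

(** This form is congruent to - L, since J L J^* = D J^*. *)
Lemma chart_DJ :
  - (chart_D *m (chart_A + chart_D *m chart_X) ^t*) =
  block_mx (S1 + F *m invmx G) (S2 *m (1%:M - E2)) ((1%:M - E2) *m S2 ^t*)
    ((1%:M - E2) *m S3 *m (1%:M - E2) - E2).
Proof.
have aJ22 : chart_J22 ^t* = E2 *m S3 *m (1%:M - E2) - (1%:M - E2) + E2.
  by rewrite adjD adjB !adjM !adjB !adj1 aE2 aS3 !mulmxA.
rewrite chart_JE adj_block adj0 adjN trmxCK adjM aE2 aJ22 mulmx_block.
rewrite !mulmx0 !add0r opp_block_mx.
move: compl_mul_E2 E2_mul_compl compl_E2_idem iE2 (subrK E2 1%:M); move: (1%:M - E2) => p pe ep pp ee p1.
have pJ : p *m (E2 *m S3 *m p - p + E2) = - p.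
  by rewrite mulmxDr mulmxBr !mulmxA pe !mul0mx pp addr0 sub0r.
have eJ : E2 *m (E2 *m S3 *m p - p + E2) = E2 *m S3 *m p + E2.
  by rewrite mulmxDr mulmxBr !mulmxA ee ep subr0.
congr block_mx.
- by rewrite mulmxN mulmxDl mulmxK // !mulmxA -[S2 *m _ *m E2]mulmxA pe mulmx0 mul0mx addr0 opprK.
- by rewrite -mulmxA pJ mulmxN opprK.
- rewrite mulmxN mulmxK // mulmxDl !mulmxA -[S3 *m _ *m E2]mulmxA pe mulmx0 mul0mx add0r ee.
  by rewrite opprD opprK -[S2 ^t* in X in X - _]mul1mx -p1 mulmxDl addrK.
- rewrite mulmxDl -mulmxA pJ eJ mulmxN opprD opprK opprD addrA; congr (_ - _).
  by rewrite -[S3 in X in X - _]mul1mx -p1 !mulmxDl addrK.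
Qed.

(** Splitting off the discarded coordinates: with [E0] and [E0'] isometries onto
    the ranges of [1 - E2] and [E2], the form above is congruent to the sum of
    S_K^D and of - 1. *)
Lemma chart_congr r r' (E0 : 'M[C]_(d, r)) (E0' : 'M[C]_(d, r')) (T : 'M[C]_d) :
  E0 *m E0 ^t* = 1%:M - E2 -> E0' *m E0' ^t* = E2 ->
  E0 ^t* *m E0 = 1%:M -> E0' ^t* *m E0' = 1%:M ->
  let SD := block_mx T (S2 *m E0) (E0 ^t* *m S2 ^t*) (E0 ^t* *m S3 *m E0) in
  let V := block_mx (row_mx 1%:M 0) 0 (row_mx 0 E0) E0' in
  V ^t* *m V = 1%:M /\
  V *m block_mx SD 0 0 (- 1%:M) *m V ^t* =
  block_mx T (S2 *m (1%:M - E2)) ((1%:M - E2) *m S2 ^t*)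
    ((1%:M - E2) *m S3 *m (1%:M - E2) - E2).
Proof.
move=> e0 e0' k0 k0' SD V.
have o : E0 ^t* *m E0' = 0.
  rewrite -[E0']mulmx1 -k0' !mulmxA -[_ *m E0' *m _]mulmxA e0'.
  rewrite -[E0 ^t*]mul1mx -k0 -[_ *m E0 *m _]mulmxA e0 -[_ *m _ *m E2]mulmxA compl_mul_E2.
  by rewrite mulmx0 mul0mx.
have o' : E0' ^t* *m E0 = 0 by rewrite -[E0 in LHS]trmxCK -adjM o adj0.
have aV : V ^t* = block_mx (col_mx 1%:M 0) (col_mx 0 (E0 ^t*)) 0 (E0' ^t*).
  by rewrite /V adj_block !adj_row adj1 !adj0.
split.
  rewrite aV mulmx_block mulmx0 mul0mx add0r !mul_col_row.
  rewrite mul_col_mx !mulmx0 !mul0mx mul1mx o k0 mul_mx_row o' k0' !mulmx0.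
  rewrite add_block_mx !addr0 !add0r -scalar_mx_block.
  by rewrite col_mx0 row_mx0 -scalar_mx_block.
rewrite aV /V /SD !mulmx_block !(mulmx0, mul0mx, addr0, add0r).
rewrite !mul_row_block !(mulmx0, mul0mx, mul1mx, addr0, add0r) !mul_row_col.
rewrite !(mulmx0, mul0mx, mul1mx, mulmx1, addr0, add0r) mulmxN mulmx1 mulNmx e0'.
by rewrite -!e0 !mulmxA.
Qed.

Lemma coord_block :
  row_mx (block_mx S1 S2 (S2 ^t*) S3) 1%:M
  *m block_mx (block_mx E1 0 0 E2) (block_mx (1%:M - E1) 0 0 (1%:M - E2))
       (block_mx (E1 - 1%:M) 0 0 (E2 - 1%:M)) (block_mx E1 0 0 E2)
  = row_mx chart_A
      (block_mx (S1 *m (1%:M - E1) + E1) (S2 *m (1%:M - E2))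
         (S2 ^t* *m (1%:M - E1)) (S3 *m (1%:M - E2) + E2)).
Proof.
rewrite mul_row_block !mul1mx !mulmx_block !add_block_mx.
by rewrite !mulmx0 !addr0 !add0r.
Qed.

Lemma chart_D_shift :
  chart_A *m block_mx P 0 0 0
  + block_mx (S1 *m (1%:M - E1) + E1) (S2 *m (1%:M - E2))
      (S2 ^t* *m (1%:M - E1)) (S3 *m (1%:M - E2) + E2) = chart_D.
Proof.
rewrite mulmx_block !mulmx0 !addr0 add_block_mx !add0r; congr block_mx.
  exact: chart_D_block.
by rewrite -mulmxA -mulmxDr addrA.
Qed.

(** E_K is orthogonal; the second factor is its transpose. *)
Lemma chart_orth :
  block_mx (block_mx E1 0 0 E2) (block_mx (1%:M - E1) 0 0 (1%:M - E2))
    (block_mx (E1 - 1%:M) 0 0 (E2 - 1%:M)) (block_mx E1 0 0 E2)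
  *m block_mx (block_mx E1 0 0 E2) (block_mx (E1 - 1%:M) 0 0 (E2 - 1%:M))
       (block_mx (1%:M - E1) 0 0 (1%:M - E2)) (block_mx E1 0 0 E2) = 1%:M.
Proof.
have z (e : 'M[C]_d) : e *m e = e -> [/\ e *m e + (1%:M - e) *m (1%:M - e) = 1%:M,
    e *m (e - 1%:M) + (1%:M - e) *m e = 0,
    (e - 1%:M) *m e + e *m (1%:M - e) = 0
    & (e - 1%:M) *m (e - 1%:M) + e *m e = 1%:M].
  move=> ee.
  have em : e *m (1%:M - e) = 0 by rewrite mulmxBr mulmx1 ee subrr.
  have me : (1%:M - e) *m e = 0 by rewrite mulmxBl mul1mx ee subrr.
  have mm : (1%:M - e) *m (1%:M - e) = 1%:M - e by rewrite mulmxBr mulmx1 me subr0.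
  rewrite -(opprB 1%:M e) !mulmxN !mulNmx opprK ee em me mm !oppr0 addr0.
  by rewrite addrC subrK.
have [a1 b1 c1 f1] := z _ iE1; have [a2 b2 c2 f2] := z _ iE2.
rewrite !mulmx_block !add_block_mx !(mulmx0, mul0mx) !(addr0, add0r).
rewrite a1 a2 b1 b2 c1 c2 f1 f2 block_mx0 -!scalar_mx_block.
by [].
Qed.

End ChartAlgebra.

(** * The inertia of S_K^D *)

Lemma half_double (C : numClosedFieldType) m n (S : 'M[C]_(m, n)) :
  2%:R^-1 *: (S + S) = S.
Proof. by rewrite scalerDr -scalerDl -[X in X *: _]mulr2n -[_ *+ 2]mulr_natl mulfV ?scale1r ?pnatr_eq0. Qed.

Lemma zero_from_indices (z p q r r' z1 p1 q1 d : nat) :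
  (z + p + q = d + d)%N -> (z1 + p1 + q1 = d + r)%N -> (r + r' = d)%N ->
  q = p1 -> p = (q1 + r')%N -> z = z1.
Proof. by move=> *; lia. Qed.

Section Charts.
Context {R : realType} {d N' : nat}.
Local Notation Kf := (cplx R).
Local Notation N := N'.+1.
Local Notation bcT := (set_type (@bc_pairs R d)).
Variable omega : Omega R d N.
Hypothesis N'0 : (0 < N')%N.
Hypothesis hP0 : posdefmx (Pinv omega ord0).
Variable K : {set 'I_(d + d)}.

Local Notation evs A := (eigenvalue_list omega A).
Local Notation "[bc M ]" := (\pi_(bc R d) M)%qT.
Local Notation below mu s := (count (fun x => (x < mu)%R) s).
Local Notation P0 := (Pinv omega ord0).
Local Notation e1 := (@E1 R d K).
Local Notation e2 := (@E2 R d K).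

Lemma diag01_adj n (p : pred 'I_n) :
  (diag_mx (\row_i (p i)%:R) : 'M[Kf]_n) ^t* = diag_mx (\row_i (p i)%:R).
Proof.
rewrite tr_diag_mx map_diag_mx; congr diag_mx; apply/rowP => i.
by rewrite !mxE rmorph_nat.
Qed.

Lemma diag01_idem n (p : pred 'I_n) :
  diag_mx (\row_i (p i)%:R) *m diag_mx (\row_i (p i)%:R)
  = diag_mx (\row_i (p i)%:R) :> 'M[Kf]_n.
Proof.
rewrite mulmx_diag; congr diag_mx; apply/rowP => i.
by rewrite !mxE; case: (p i); rewrite ?mulr1 ?mulr0.
Qed.

Lemma E1_adj : e1 ^t* = e1. Proof. exact: diag01_adj. Qed.
Lemma E2_adj : e2 ^t* = e2. Proof. exact: diag01_adj. Qed.
Lemma E1_idem : e1 *m e1 = e1. Proof. exact: diag01_idem. Qed.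
Lemma E2_idem : e2 *m e2 = e2. Proof. exact: diag01_idem. Qed.

Lemma Pinv0_adj : P0 ^t* = P0.
Proof. by apply/hermP; exact: hP0.1. Qed.

(** Compressions of the positive definite P_0^{-1} are invertible. *)
Lemma chart_G_unit : e1 *m P0 + 1%:M - e1 \in unitmx.
Proof.
rewrite -unitmx_tr -row_free_unit -kermx_eq0 -nz_row_eq0; set x := nz_row _.
have /sub_kermxP : (x <= kermx ((e1 *m P0 + 1%:M - e1)^T))%MS by exact: nz_row_sub.
move: x => x xG; apply: contraT => x0.
have {xG} Gx : (e1 *m P0 + 1%:M - e1) *m x^T = 0.
  by rewrite -[RHS]trmx0 -xG trmx_mul trmxK.
have e1x : e1 *m x^T = x^T.
  move: Gx; rewrite -addrA mulmxDl => /(congr1 (fun y => (1%:M - e1) *m y)).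
  rewrite mulmx0 mulmxDr !mulmxA mulmxBl mul1mx E1_idem subrr !mul0mx add0r.
  by rewrite mulmxBr mulmx1 [in X in _ - X]mulmxBl mul1mx E1_idem subrr subr0 mulmxBl mul1mx
    => /eqP; rewrite subr_eq0 => /eqP <-.
have eP : e1 *m (P0 *m x^T) = 0.
  by move: Gx; rewrite mulmxBl mulmxDl mul1mx e1x addrK mulmxA.
have /hP0.2 : x^T != 0 by apply: contra x0 => /eqP e; rewrite -[x]trmxK e trmx0.
have -> : x^T ^t* *m P0 *m x^T = 0.
  by rewrite -[in X in X *m _]e1x adjM E1_adj -!mulmxA eP mulmx0.
by rewrite mxE ltxx.
Qed.

Definition coord_pair (S : 'M[Kf]_(d + d)) := row_mx S 1%:M *m E_ K.

Lemma coord_pairE S : S \is hermsymmx ->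
  Amx (coord_pair S) = chart_A e1 e2 (ulsubmx S) (ursubmx S) (drsubmx S) /\
  Dpair omega (coord_pair S) =
    chart_D e1 e2 P0 (ulsubmx S) (ursubmx S) (drsubmx S).
Proof.
move=> /hermP hS.
have eS : S = block_mx (ulsubmx S) (ursubmx S) ((ursubmx S) ^t*) (drsubmx S).
  rewrite -[LHS]submxK; congr block_mx.
  by rewrite -[in LHS]hS; apply/matrixP => i j; rewrite !mxE.
have eM := coord_block e1 e2 (ulsubmx S) (ursubmx S) (drsubmx S).
rewrite -eS -/(E_ K) -/(coord_pair S) in eM.
split; first by rewrite eM /Amx row_mxKl.
by rewrite DpairE eM row_mxKl row_mxKr; exact: chart_D_shift.
Qed.

Definition E_Kinv : 'M[Kf]_((d + d) + (d + d)) :=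
  block_mx (block_mx e1 0 0 e2) (block_mx (e1 - 1%:M) 0 0 (e2 - 1%:M))
           (block_mx (1%:M - e1) 0 0 (1%:M - e2)) (block_mx e1 0 0 e2).

Lemma E_K_orth : E_ K *m E_Kinv = 1%:M.
Proof. exact: (chart_orth E1_idem E2_idem). Qed.

(** The coordinate matrix read off an arbitrary representative; taking the
    Hermitian part makes it Hermitian also outside the chart. *)
Definition coord_of (M : 'M[Kf]_(d + d, (d + d) + (d + d))) : 'M[Kf]_(d + d) :=
  let T := invmx (rsubmx (M *m E_Kinv)) *m lsubmx (M *m E_Kinv) in
  2%:R^-1 *: (T + T ^t*).

Lemma coord_of_herm M : coord_of M \is hermsymmx.
Proof.
apply/hermP; rewrite adjZ adjD trmxCK fmorphV rmorph_nat; congr (_ *: _).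
by rewrite addrC.
Qed.

Lemma coord_pair_inv (U S : 'M[Kf]_(d + d)) : U *m coord_pair S *m E_Kinv = row_mx (U *m S) U.
Proof. by rewrite /coord_pair mulmxA -mulmxA E_K_orth mulmx1 mul_mx_row mulmx1. Qed.

Lemma coord_of_coord_pair (U S : 'M[Kf]_(d + d)) : S \is hermsymmx -> U \in unitmx ->
  coord_of (U *m coord_pair S) = S.
Proof.
move=> /hermP hS uU; rewrite /coord_of coord_pair_inv row_mxKl row_mxKr mulKmx // hS.
exact: half_double.
Qed.

Definition chart_shift (S : 'M[Kf]_(d + d)) : 'M[Kf]_(d + d) :=
  chart_X e1 e2 P0 (drsubmx S).

Lemma drsub_herm (S : 'M[Kf]_(d + d)) : S \is hermsymmx -> (drsubmx S) ^t* = drsubmx S.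
Proof. by move=> /hermP hS; rewrite -[in RHS]hS; apply/matrixP => i j; rewrite !mxE. Qed.

Lemma chart_shift_herm S : S \is hermsymmx -> chart_shift S \is hermsymmx.
Proof.
move=> hS.
exact: (chart_X_herm E1_adj E1_idem E2_adj Pinv0_adj (drsub_herm hS) chart_G_unit).
Qed.

Lemma class_transfer (A : bc R d) M M' : is_bc_class M A -> is_bc_class M' A ->
  exists2 U : 'M[Kf]_(d + d), U \in unitmx & M = U *m M'.
Proof.
move=> /bc_class_repr[U uU eU] /bc_class_repr[V uV eV].
exists (invmx U *m V); first by rewrite unitmx_mul unitmx_inv uU.
by rewrite -mulmxA -eV eU mulKmx.
Qed.

Lemma JmxM U M (X : 'M[Kf]_(d + d)) : Jmx omega (U *m M) X = U *m Jmx omega M X.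
Proof. by rewrite /Jmx AmxM DpairM mulmxDr mulmxA. Qed.

Lemma E0_facts :
  [/\ @E0 R d K *m (E0 K) ^t* = 1%:M - e2, (E0 K) ^t* *m @E0 R d K = 1%:M
    & exists E0' : 'M[Kf]_(d, #|~: K_hi K|),
        E0' *m E0' ^t* = e2 /\ E0' ^t* *m E0' = 1%:M].
Proof.
split.
- rewrite (@sel_adj Kf d (mem (K_hi K))); apply/matrixP => i j; rewrite !mxE.
  by case: (i == j); case: (i \in K_hi K); rewrite /= ?mulr1n ?mulr0n ?subrr ?subr0.
- exact: (@sel_adjK Kf d (mem (K_hi K))).
- exists (sel (mem (~: K_hi K))); split; last exact: sel_adjK.
  rewrite sel_adj; congr diag_mx; apply/rowP => i; rewrite !mxE.
  by rewrite inE.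
Qed.

(** In the chart the inertia of [Lmx] is, up to the sign and a constant, that of
    S_K^D. *)
Lemma chart_indices (A : bc R d) S M : is_coord K A S -> is_bc_class M A ->
  [/\ Jmx omega M (chart_shift S) \in unitmx,
      r_neg (Lmx omega M (chart_shift S)) = r_pos (S_D omega K S)
    & r_zero (Lmx omega M (chart_shift S)) = r_zero (S_D omega K S)].
Proof.
move=> [hS AS] AM; have [U uU eM] := class_transfer AM AS.
have [eA eD] := coord_pairE hS.
have hX := chart_shift_herm hS.
have uJS : Jmx omega (coord_pair S) (chart_shift S) \in unitmx.
  rewrite /Jmx eA eD.
  have h := chart_J_unit (ulsubmx S) (ursubmx S) (drsubmx S) E1_adj E1_idem E2_idem Pinv0_adj chart_G_unit.
  exact h.
have uJ : Jmx omega M (chart_shift S) \in unitmx by rewrite eM JmxM unitmx_mul uU.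
have hL := Lmx_herm AM hX uJ.
pose DJ := Dpair omega (coord_pair S) *m (Jmx omega (coord_pair S) (chart_shift S)) ^t*.
have eJ : Jmx omega M (chart_shift S) *m Lmx omega M (chart_shift S) *m (Jmx omega M (chart_shift S)) ^t*
    = U *m DJ *m U ^t*.
  by rewrite (Lmx_congr uJ) eM JmxM DpairM adjM /DJ !mulmxA.
have hDJ : DJ \is hermsymmx.
  apply/hermP; rewrite adjM trmxCK; symmetry.
  have h := @JD_herm R d N' omega _ _ _ AS hX.
  exact h.
have [k0 k1 [E0' [k2 k3]]] := E0_facts.
have [VV eV] := chart_congr (ursubmx S) (drsubmx S) E2_idem
  (ulsubmx S + ((e1 - 1%:M) *m P0 + e1) *m invmx (e1 *m P0 + 1%:M - e1)) k0 k2 k1 k3.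
set V := block_mx _ _ _ _ in VV eV.
have eDJ : - DJ = V *m block_mx (S_D omega K S) 0 0 (- 1%:M) *m V ^t*.
  rewrite eV /DJ /Jmx eA eD.
  have h := chart_DJ (ulsubmx S) (ursubmx S) E1_adj E1_idem E2_adj E2_idem Pinv0_adj
    (drsub_herm hS) chart_G_unit.
  exact h.
have hSD : S_D omega K S \is hermsymmx.
  have hN : - DJ \is hermsymmx := hermN hDJ.
  have e : block_mx (S_D omega K S) 0 0 (- 1%:M) = V ^t* *m (- DJ) *m V.
    by rewrite eDJ !mulmxA VV mul1mx -mulmxA VV mulmx1.
  have : block_mx (S_D omega K S) 0 0 (- 1%:M : 'M[Kf]_(#|~: K_hi K|)) \is hermsymmx.
    by rewrite e -[V in X in _ *m X]trmxCK; exact: herm_conj.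
  move=> /hermP; rewrite adj_block => /eq_block_mx[h _ _ _].
  exact/hermP.
have h1 : (- 1%:M : 'M[Kf]_(#|~: K_hi K|)) \is hermsymmx by exact: hermN (herm1 _).
have hB := herm_block_diag hSD h1.
have nL : r_neg (Lmx omega M (chart_shift S)) = r_neg DJ.
  rewrite -(r_neg_congr hL (mulVmx uJ)) eJ.
  exact: (r_neg_congr hDJ (mulVmx uU)).
have pL : r_pos (Lmx omega M (chart_shift S)) = r_pos DJ.
  rewrite -(r_pos_congr hL (mulVmx uJ)) eJ.
  exact: (r_pos_congr hDJ (mulVmx uU)).
have n1 : r_neg DJ = r_pos (S_D omega K S).
  rewrite (r_negE hDJ) eDJ (r_pos_congr hB VV) (r_pos_block hSD h1).
  by rewrite -(r_negE (herm1 _)) r_neg1 addn0.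
have p1 : r_pos DJ = (r_neg (S_D omega K S) + #|~: K_hi K|)%N.
  rewrite (r_posE hDJ) eDJ (r_neg_congr hB VV) (r_neg_block hSD h1).
  by rewrite -(r_posE (herm1 _)) r_pos1.
have cK : (#|K_hi K| + #|~: K_hi K| = d)%N by rewrite cardsC card_ord.
have zE := zero_from_indices (r_total hL) (r_total hSD) cK (etrans nL n1) (etrans pL p1).
exact (And3 uJ (etrans nL n1) zE).
Qed.

End Charts.

(** * Limits between the layers of a chart *)

Lemma counts_shift (z p q z0 p0 q0 b b0 m rp rp' : nat) :
  (b + p + z = b0 + p0 + z0)%N -> (z + p + q = m)%N -> (z0 + p0 + q0 = m)%N ->
  q = rp -> q0 = rp' -> (rp' <= rp)%N -> b = (b0 + (rp - rp'))%N.
Proof. by move=> *; lia. Qed.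

Lemma shift_small (T r0 rp rm rp' dr n : nat) :
  (dr <= T)%N -> (r0 + rp + rm = dr)%N -> (n <= rp - rp')%N -> (n <= T - r0)%N.
Proof. by lia. Qed.

Lemma shift_middle (T s r0 rp rm r0' rp' rm' dr n : nat) :
  (s + r0' = T)%N -> (dr <= T)%N -> (r0 + rp + rm = dr)%N ->
  (r0' + rp' + rm' = dr)%N -> (rp' <= rp)%N -> (rm' <= rm)%N ->
  (rp - rp' < n)%N -> (n <= T - r0 - (rm - rm'))%N ->
  [/\ (0 < n)%N, (n <= T - r0)%N & (n - (rp - rp') <= s)%N].
Proof. by move=> *; split; lia. Qed.

Lemma shift_large (T s r0 rp rm r0' rp' rm' dr n : nat) :
  (s + r0' = T)%N -> (dr <= T)%N -> (r0 + rp + rm = dr)%N ->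
  (r0' + rp' + rm' = dr)%N -> (rp' <= rp)%N -> (rm' <= rm)%N ->
  (T - r0 - (rm - rm') < n)%N -> (0 < n)%N /\ (s + (rp - rp') < n)%N.
Proof. by move=> *; split; lia. Qed.

Section ChartLimits.
Context {R : realType} {d N' : nat}.
Local Notation Kf := (cplx R).
Local Notation N := N'.+1.
Local Notation bcT := (set_type (@bc_pairs R d)).
Variable omega : Omega R d N.
Hypothesis N'0 : (0 < N')%N.
Hypothesis hP0 : posdefmx (Pinv omega ord0).
Variable K : {set 'I_(d + d)}.

Local Notation evs A := (eigenvalue_list omega A).
Local Notation "[bc M ]" := (\pi_(bc R d) M)%qT.
Local Notation below mu s := (count (fun x => (x < mu)%R) s).

Lemma coord_of_mcvg (M0 : bcT) : rsubmx (set_val M0 *m E_Kinv K) \in unitmx ->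
  mcvg (nbhs M0) (fun M : bcT => coord_of K (set_val M)) (coord_of K (set_val M0)).
Proof.
move=> u0.
have cY : mcvg (nbhs M0) (fun M : bcT => set_val M *m E_Kinv K) (set_val M0 *m E_Kinv K).
  exact: (mcvgM (set_val_mcvg M0) (mcvg_cst (E_Kinv K))).
pose T (M : bcT) := invmx (rsubmx (set_val M *m E_Kinv K)) *m lsubmx (set_val M *m E_Kinv K).
have cT : mcvg (nbhs M0) T (T M0).
  exact: (mcvgM (mcvg_inv (mcvg_rsub cY) u0) (mcvg_lsub cY)).
have cS : mcvg (nbhs M0) (fun M => T M + (T M) ^t*) (T M0 + (T M0) ^t*).
  exact: (mcvgD cT (mcvg_adj cT)).
have h : mcvg (nbhs M0) (fun M => 2%:R^-1 *: (T M + (T M) ^t*))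
    (2%:R^-1 *: (T M0 + (T M0) ^t*)) by exact: (mcvgZ cS).
exact h.
Qed.

Lemma chart_shift_mcvg (M0 : bcT) : rsubmx (set_val M0 *m E_Kinv K) \in unitmx ->
  mcvg (nbhs M0) (fun M : bcT => chart_shift omega K (coord_of K (set_val M)))
    (chart_shift omega K (coord_of K (set_val M0))).
Proof.
move=> u0.
have e2S : mcvg (nbhs M0) (fun M : bcT => E2 K *m drsubmx (coord_of K (set_val M)) *m E2 K)
    (E2 K *m drsubmx (coord_of K (set_val M0)) *m E2 K).
  exact: (mcvgM (mcvgM (mcvg_cst (E2 K)) (mcvg_rsub (mcvg_dsub (coord_of_mcvg u0))))
    (mcvg_cst (E2 K))).
exact: (mcvg_block (mcvg_cst _) (mcvg_cst 0) (mcvg_cst 0) (mcvgB (mcvg_cst (E2 K)) e2S)).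
Qed.

(** Comparing two layers of the chart: the number of eigenvalues below a fixed
    level jumps by the number of positive eigenvalues of S_K^D gained. *)
Lemma chart_count r0 rp rm r0' rp' rm' A mu :
  B_chart_layer omega K r0' rp' rm' A -> (rp' <= rp)%N -> mu \notin evs A ->
  \forall B \near within (B_chart_layer omega K r0 rp rm) (nbhs A),
    below mu (evs B) = (below mu (evs A) + (rp - rp'))%N.
Proof.
move=> [S AS [S0 Sp Sm]] rpp mu0.
have [hS [M0 vM0 eA]] := AS.
have AM : is_bc_class (set_val M0) A by rewrite eA; exact: is_bc_class_pi.
have u0 : rsubmx (set_val M0 *m E_Kinv K) \in unitmx.
  rewrite vM0 -/(coord_pair K S) -[coord_pair K S]mul1mx coord_pair_inv row_mxKr.
  exact: unitmx1.
have eS : coord_of K (set_val M0) = S.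
  by rewrite vM0 -/(coord_pair K S) -[coord_pair K S]mul1mx coord_of_coord_pair ?unitmx1.
pose X (M : bcT) := chart_shift omega K (coord_of K (set_val M)).
have eX : X M0 = chart_shift omega K S by rewrite /X eS.
have hX M : X M \is hermsymmx.
  exact (chart_shift_herm hP0 K (coord_of_herm K (set_val M))).
have nX : \forall M \near M0, X M \is hermsymmx by apply: (@filterE _ (nbhs M0)).
have [uJ nL0 zL0] := chart_indices hP0 AS AM.
rewrite -eX in uJ nL0.
rewrite eA in mu0 *.
have nc := near_count N'0 (chart_shift_mcvg u0) nX uJ mu0.
apply: near_pi_within; apply: filterS2 (near_Jmx_unit (chart_shift_mcvg u0) uJ) nc => M uM cM.
move=> [S' BS' [S0' Sp' Sm']].
have BM := is_bc_class_pi M.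
have eS' : coord_of K (set_val M) = S'.
  have [U uU ->] := class_transfer BM BS'.2.
  exact (coord_of_coord_pair K BS'.1 uU).
have [uJ' nL zL] := chart_indices hP0 BS' BM.
have nL' : r_neg (Lmx omega (set_val M) (X M)) = rp.
  exact (etrans (congr1 (fun s => r_neg (Lmx omega (set_val M) (chart_shift omega K s))) eS')
    (etrans nL Sp')).
have hL0 := Lmx_herm AM (hX M0) uJ.
have hL := Lmx_herm BM (hX M) uM.
exact: (counts_shift cM (r_total hL) (r_total hL0) nL' (etrans nL0 Sp) rpp).
Qed.

(** The nullities of S_K^D and of D agree in the chart. *)
Lemma chart_layer_size r0 rp rm B : B_chart_layer omega K r0 rp rm B ->
  (size (evs B) + r0 = N * d)%N.
Proof.
move=> [S BS [S0 _ _]]; have [hS BM] := BS.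
have [uJ _ zL] := chart_indices hP0 BS BM.
have [_ e _] := eigenvalue_list_spec N'0 BM (chart_shift_herm hP0 K hS) uJ.
by rewrite -S0 -zL.
Qed.

End ChartLimits.

Section Main.
Context {R : realType} {d N' : nat}.
Local Notation N := N'.+1.
Variable omega : Omega R d N.
Hypothesis N'0 : (0 < N')%N.
Hypothesis hP0 : posdefmx (Pinv omega ord0).
Local Notation evs A := (eigenvalue_list omega A).

(** The counting functions shift by rp - rp', and the given sums identify the
    ranges of n: the eigenvalues numbered up to the shift are lost to -oo, those
    beyond the number of eigenvalues at [A] plus the shift are lost to +oo. *)
Lemma chart_limits (K : {set 'I_(d + d)}) (r0 rp rm r0' rp' rm' : nat) A :
  (r0 + rp + rm = d + #|K_hi K|)%N -> (r0' + rp' + rm' = d + #|K_hi K|)%N ->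
  (rp' <= rp)%N -> (rm' <= rm)%N -> B_chart_layer omega K r0' rp' rm' A ->
  [/\ (forall n : nat, (1 <= n <= N * d - r0)%N ->
         B_chart_layer omega K r0 rp rm `<=` lambda_dom omega n),
      (forall n : nat, (1 <= n <= rp - rp')%N ->
         lambda omega n @ within (B_chart_layer omega K r0 rp rm) (nbhs A) --> -oo),
      (forall n : nat, (rp - rp' < n <= N * d - r0 - (rm - rm'))%N ->
         lambda_dom omega (n - (rp - rp')) A /\
         lambda omega n @ within (B_chart_layer omega K r0 rp rm) (nbhs A)
           --> lambda omega (n - (rp - rp')) A)
    & (forall n : nat, (N * d - r0 - (rm - rm') < n <= N * d - r0)%N ->
         lambda omega n @ within (B_chart_layer omega K r0 rp rm) (nbhs A) --> +oo)].
Proof.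
move=> sum sum' rpp rmm AL.
have szA := chart_layer_size N'0 hP0 AL.
have szB B : B_chart_layer omega K r0 rp rm B -> (size (evs B) + r0 = N * d)%N.
  exact: chart_layer_size.
have cnt mu : mu \notin evs A ->
    \forall B \near within (B_chart_layer omega K r0 rp rm) (nbhs A),
    count (fun x => (x < mu)%R) (evs B) = (count (fun x => (x < mu)%R) (evs A) + (rp - rp'))%N.
  by move=> mu0; exact (chart_count N'0 hP0 r0 rm AL rpp mu0).
have nsz n : (n <= N * d - r0)%N ->
    \forall B \near within (B_chart_layer omega K r0 rp rm) (nbhs A), (n <= size (evs B))%N.
  move=> nr; apply: filterS (@withinT _ (nbhs A) (B_chart_layer omega K r0 rp rm) _) => B kB.
  by move: nr; rewrite -(szB _ kB) addnK.
have drT : (d + #|K_hi K| <= N * d)%N.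
  have cK : (#|K_hi K| <= d)%N by rewrite -[X in (_ <= X)%N](card_ord d) max_card.
  by apply: (@leq_trans (d + d)); [rewrite leq_add2l | rewrite mulSn leq_add2l leq_pmull].
have srt := @sorted_eigenvalue_list R d N' omega N'0.
split=> [n /andP[_ nr] B kB|n /andP[n1 nD]|n /andP[Dn nu]|n /andP[un nr]].
- by rewrite /lambda_dom /= /nb_eigenvalues; move: nr; rewrite -(szB _ kB) addnK.
- have nr : (n <= N * d - r0)%N := shift_small drT sum nD.
  exact: (nth_cvg_ninfty _ srt n1 (nsz n nr) cnt nD).
- have [n0 nr nA] := shift_middle szA drT sum sum' rpp rmm Dn nu.
  split; first exact: nA.
  exact: (nth_cvg_shift _ srt (srt A) n0 (nsz n nr) cnt Dn nA).
- have [n0 nA] := shift_large szA drT sum sum' rpp rmm un.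
  exact: (nth_cvg_pinfty _ srt n0 (nsz n nr) cnt nA).
Qed.

End Main.

(** * The singular set *)

Section SingularSet.
Context {R : realType} {d N' : nat}.
Local Notation N := N'.+1.
Variable omega : Omega R d N.
Hypothesis N'0 : (0 < N')%N.
Local Notation evs A := (eigenvalue_list omega A).

(** Invertibility of D is an open condition. *)
Lemma near_B_layer0 A : B_layer omega 0 A -> nbhs A (B_layer omega 0).
Proof.
have [M0 ->] := bc_pi_surj A; rewrite /B_layer /= => A0.
have u0 : Dpair omega (set_val M0) \in unitmx.
  rewrite -row_free_unit -row_leq_rank -subn_eq0.
  by rewrite -(rank_Dmx omega (is_bc_class_pi M0)) A0.
have nu : \forall M \near M0, Dpair omega (set_val M) \in unitmx.
  exact: (near_unitmx (@Dpair_mcvg R d N' omega M0) u0).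
suff : \forall B \near within setT (nbhs (\pi_(bc R d) M0)%qT), B_layer omega 0 B.
  move=> h; have h' : nbhs (\pi_(bc R d) M0)%qT (fun B => setT B -> B_layer omega 0 B) := h.
  by apply: filterS h' => B; exact.
apply: near_pi_within; apply: filterS nu => M uM _.
by rewrite /B_layer /= (rank_Dmx omega (is_bc_class_pi M)) mxrank_unit // subnn.
Qed.

(** The layers k >= 1 are singular because the eigenvalue number N d - k + 1,
    which does not exist there, exists on the dense layer 0; layer 0 is regular
    because it is open and every eigenvalue is continuous along it. *)
Lemma singular_setE : singular_set omega =
  \bigcup_(k in [set k | (1 <= k <= d + d)%N]) B_layer omega k.
Proof.
have kT : (d + d <= N * d)%N by rewrite mulSn leq_add2l leq_pmull.
rewrite eqEsubset; split=> [A [n /andP[n1 nT] nA]|A [k /= /andP[k1 kd] kA]].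
  exists (d + d - \rank (Dmx omega A))%N => //=; rewrite leq_subr andbT lt0n.
  apply/negP => /eqP A0; case: nA => [[An nc]|[nAn _]].
    apply: nc; have nT0 : (1 <= n <= N * d - 0)%N by rewrite subn0 n1.
    have c := layer_cvg N'0 A0 nT0.
    apply: cvg_within_filter => P nP.
    have h : nbhs A (fun B => B_layer omega 0 B -> P (lambda omega n B)) := c _ nP.
    have n0 := near_B_layer0 A0.
    suff : nbhs A (fun B => P (lambda omega n B)) by [].
    by apply: filterS2 n0 h => B B0; exact.
  by apply: nAn; apply: (B_layer_dom N'0 A0); rewrite subn0.
exists (N * d - k).+1.
  by rewrite /= -subSn ?leq_subLR ?(leq_trans kd) // -add1n leq_add2r.
right; split.
  rewrite /lambda_dom /= /nb_eigenvalues (B_layer_size N'0 kA).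
  by rewrite ltnn.
have sub : B_layer omega 0 `<=` lambda_dom omega (N * d - k).+1.
  move=> B B0; apply: (B_layer_dom N'0 B0); rewrite subn0 -subSn ?(leq_trans kd) //.
  by rewrite leq_subLR -add1n leq_add2r.
have := @closure_subset (bc R d) _ _ sub.
by apply; exact: closure_B_layer0.
Qed.

End SingularSet.

Theorem theorem4p4 (R : realType) (d N : nat) (hd : (1 <= d)%N)
    (hN : (2 <= N)%N) (omega : Omega R d N)
    (hP0 : posdefmx (Pinv omega ord0)) :
  [/\ (forall k n : nat, (k <= d + d)%N -> (1 <= n <= N * d - k)%N ->
         B_layer omega k `<=` lambda_dom omega n /\
         {within B_layer omega k, continuous (lambda omega n)}),
      (forall (K : {set 'I_(d + d)}) (r0 rp rm r0' rp' rm' : nat),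
         (r0 + rp + rm = d + #|K_hi K|)%N ->
         (r0' + rp' + rm' = d + #|K_hi K|)%N ->
         (r0 < r0' <= d + #|K_hi K|)%N -> (rp' <= rp)%N -> (rm' <= rm)%N ->
         forall A : bc R d, B_chart_layer omega K r0' rp' rm' A ->
         [/\ (forall n : nat, (1 <= n <= N * d - r0)%N ->
                B_chart_layer omega K r0 rp rm `<=` lambda_dom omega n),
             (forall n : nat, (1 <= n <= rp - rp')%N ->
                lambda omega n
                  @ within (B_chart_layer omega K r0 rp rm) (nbhs A) --> -oo),
             (forall n : nat,
                (rp - rp' < n <= N * d - r0 - (rm - rm'))%N ->
                lambda_dom omega (n - (rp - rp')) A /\
                lambda omega n
                  @ within (B_chart_layer omega K r0 rp rm) (nbhs A)
                  --> lambda omega (n - (rp - rp')) A)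
           & (forall n : nat,
                (N * d - r0 - (rm - rm') < n <= N * d - r0)%N ->
                lambda omega n
                  @ within (B_chart_layer omega K r0 rp rm) (nbhs A) --> +oo)])
    & singular_set omega = \bigcup_(k in [set k | (1 <= k <= d + d)%N])
                             B_layer omega k].
Proof.
case: N hN omega hP0 => [//|N'] hN omega hP0.
have N'0 : (0 < N')%N by [].
split.
- move=> k n kd nk; split; last exact: layer_continuous.
  by move=> A kA; case/andP: nk => _; exact: B_layer_dom.
- move=> K r0 rp rm r0' rp' rm' sum sum' _ rpp rmm A AL.
  exact: chart_limits sum sum' rpp rmm AL.
- exact: singular_setE.
Qed.
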